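(* Let $\theta>0$. As $\alpha\to+\infty$ and $\xi\to0$ in such a way that $\alpha\xi\to\theta$, the point processes $\mathsf{M}_{\alpha,\xi}$ on $\mathbb{Z}_{>0}$ converge to the poissonized Plancherel measure $\mathsf{Pl}_\theta$. $\mathsf{Pl}_\theta$ is a determinantal point process on $\mathbb{Z}_{>0}$ supported by finite configurations. Its correlation kernel $\mathbf{K}_\theta$ can be expressed, for $x,y\in\mathbb{Z}_{>0}$ and with $J_k=J_k(2\sqrt\theta)$, as the series $$\mathbf{K}_{\theta}(x,y)=\frac{2\sqrt{xy}}{x+y}\sum_{m=0}^{\infty}2^{-\delta(m)}J_{m+x}J_{m+y},$$ and in the integrable form $$\mathbf{K}_{\theta}(x,y)=\frac{2\sqrt{xy}}{x^2-y^2}\Big(\sqrt\theta\, J_{x-1}J_{y}-\sqrt\theta\, J_{y-1}J_x-\tfrac12(x-y)J_xJ_y\Big)$$ (for $x=y$ understood by L'Hospital's rule, with $J_k$ regarded as an analytic function of its order).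
   Context: A strict partition $\lambda=(\lambda_1>\dots>\lambda_\ell>0)$ is identified with the finite configuration $\{\lambda_1,\dots,\lambda_\ell\}\subset\mathbb{Z}_{>0}$; $\mathbb{S}$ is the (countable) set of strict partitions. $\nu=\frac12\sqrt{1-4\alpha}$ (real in $[0,\frac12)$ or purely imaginary). For $\alpha>0$, $0<\xi<1$, $$\mathsf{M}_{\alpha,\xi}(\lambda)=(1-\xi)^{\alpha/2}\prod_{k=1}^{\ell}w_{\alpha,\xi}(\lambda_k)\prod_{1\le k<j\le\ell}\Big(\frac{\lambda_k-\lambda_j}{\lambda_k+\lambda_j}\Big)^2,\quad w_{\alpha,\xi}(x)=\frac{\xi^x\cos(\pi\nu)}{2\pi}\frac{\Gamma(\frac12-\nu+x)\Gamma(\frac12+\nu+x)}{(x!)^2},$$ and for $\theta>0$ $$\mathsf{Pl}_\theta(\lambda)=\frac{(\theta/2)^{|\lambda|}e^{-\theta/2}}{|\lambda|!}\cdot\frac{2^{|\lambda|-\ell}\,|\lambda|!}{(\lambda_1!\cdots\lambda_\ell!)^2}\prod_{1\le k<j\le\ell}\Big(\frac{\lambda_k-\lambda_j}{\lambda_k+\lambda_j}\Big)^2,\qquad |\lambda|=\sum\lambda_j.$$ Both are probability measures on $\mathbb{S}$; convergence is weak convergence of probability measures on the countable set $\mathbb{S}$ (equivalently, pointwise convergence $\mathsf{M}_{\alpha,\xi}(\lambda)\to\mathsf{Pl}_\theta(\lambda)$). A point process on $\mathbb{Z}_{>0}$ is determinantal with kernel $K$ if $\mathrm{Prob}\{\text{configuration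 contains }x_1,\dots,x_n\}=\det[K(x_k,x_j)]_{k,j=1}^n$ for all $n$ and distinct $x_j$. $J_k(2\sqrt\theta)=\sum_{r\ge0}\frac{(-1)^r\theta^{r+k/2}}{r!\,\Gamma(r+k+1)}$; $\delta(m)=\delta_{m,0}$. *)

(* Defs.v *)
From HB Require Import structures.
From mathcomp Require Import all_boot all_order all_algebra.
From mathcomp Require Import all_classical all_reals all_analysis.
From mathcomp.real_closed Require Import complex.
From mathcomp Require Import lra.

Set Implicit Arguments.
Unset Strict Implicit.
Unset Printing Implicit Defensive.

Import Order.TTheory GRing.Theory Num.Theory numFieldNormedType.Exports.

Local Open Scope classical_set_scope.
Local Open Scope ring_scope.
Local Open Scope complex_scope.

(* A strict partition is the decreasing list of its parts; it stands for the
   finite configuration of its parts in Z_{>0}. *)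
Definition is_strict_partition (s : seq nat) : bool :=
  sorted gtn s && (0%N \notin s).

Definition strict_partition : Type := {s : seq nat | is_strict_partition s}.

HB.instance Definition _ := Countable.on strict_partition.

Definition parts (l : strict_partition) : seq nat := sval l.

Definition empty_partition : strict_partition := exist _ [::] isT.

HB.instance Definition _ := isPointed.Build strict_partition empty_partition.

(* Every set of strict partitions is an event. *)
HB.instance Definition _ := @isMeasurable.Build default_measure_display
  strict_partition discrete_measurable discrete_measurable0
  discrete_measurableC discrete_measurableU.

Section discrete_measure.
Context {R : realType}.
Local Open Scope ereal_scope.

Definition discrete_measure (p : strict_partition -> {nonneg R})
    (A : set strict_partition) : \bar R :=
  \esum_(l in A) (p l)%:num%:E.

Variable p : strict_partition -> {nonneg R}.

Let discrete_measure0 : discrete_measure p set0 = 0.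
Proof. exact: esum_set0. Qed.

Let discrete_measure_ge0 A : 0 <= discrete_measure p A.
Proof. by apply: esum_ge0 => l _; rewrite lee_fin. Qed.

Let discrete_measure_sigma_additive :
  semi_sigma_additive (discrete_measure p).
Proof.
move=> F _ tF _.
have -> : discrete_measure p (\bigcup_n F n) =
    \sum_(0 <= i <oo) discrete_measure p (F i).
  by apply: nneseries_sum_bigcup => // l; rewrite lee_fin.
by apply: is_cvg_ereal_nneg_natsum => n _; exact: discrete_measure_ge0.
Qed.

HB.instance Definition _ := isMeasure.Build _ _ _ (discrete_measure p)
  discrete_measure0 discrete_measure_ge0 discrete_measure_sigma_additive.

End discrete_measure.

Section special_functions.
Context {R : realType}.
Implicit Types z : R[i].

Definition expC z : R[i] :=
  (expR (complex.Re z) * cos (complex.Im z)) +i* (expR (complex.Re z) * sin (complex.Im z)).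

Definition cosC z : R[i] := (expC ('i * z) + expC (- ('i * z))) / 2.

(* Gauss's definition of the Gamma function,
     Gamma(z) = lim_n  n! n^z / (z (z + 1) ... (z + n)),
   with the complex limit taken componentwise. *)
Definition gauss_Gamma z (n : nat) : R[i] :=
  n`!%:R * expC (z * (ln n%:R)%:C) / \prod_(j < n.+1) (z + j%:R).

Definition Gamma z : R[i] :=
  limn (fun n => complex.Re (gauss_Gamma z n)) +i* limn (fun n => complex.Im (gauss_Gamma z n)).

(* [Gamma] maps reals to reals, so nothing is lost by taking the real part. *)
Definition rGamma (x : R) : R := complex.Re (Gamma x%:C).

(* J_k(2 sqrt(theta)), as a function of the real order k. *)
Definition besselJ (theta k : R) : R :=
  limn (series (fun r : nat =>
    (-1) ^+ r * theta `^ (r%:R + k / 2) / (r`!%:R * rGamma (r%:R + k + 1)))).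

End special_functions.

Section gamma_weight.
Context {R : realType}.
Implicit Types (alpha : {posnum R}) (z : R[i]).

Definition nu alpha : R[i] := 2^-1 * sqrtC (1 - 4 * alpha%:num)%:C.

Definition gamma_factor alpha (x : nat) : R[i] :=
  cosC ((pi : R)%:C * nu alpha) *
  Gamma (2^-1 - nu alpha + x%:R) * Gamma (2^-1 + nu alpha + x%:R).

Let expC_conj z : expC (conjc z) = conjc (expC z).
Proof. by case: z => a b; rewrite /expC /= cosN sinN mulrN. Qed.

Let expC_real (x : R) : expC x%:C = (expR x)%:C.
Proof. by rewrite /expC /= cos0 sin0 mulr1 mulr0. Qed.

Let conjcM (u v : R[i]) : conjc (u * v) = conjc u * conjc v.
Proof. exact: rmorphM. Qed.

Let conjcD (u v : R[i]) : conjc (u + v) = conjc u + conjc v.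
Proof. exact: rmorphD. Qed.

Let gauss_conj z n : gauss_Gamma (conjc z) n = conjc (gauss_Gamma z n).
Proof.
rewrite /gauss_Gamma !conjcM conjc_inv conjc_nat -expC_conj conjcM conjc_real.
congr (_ / _); rewrite (big_morph (@conjc R) conjcM (conjc1 R)).
by apply: eq_bigr => j _; rewrite conjcD conjc_nat.
Qed.

Let limn_opp (u : R^nat) : limn (fun n => - u n) = - limn u.
Proof.
have [cu|ncu] := pselect (cvgn u); first exact: limN.
rewrite (dvgP ncu) (_ : limn (fun n => - u n) = point) ?oppr0//.
apply: dvgP => cNu; apply: ncu.
have -> : u = - (fun n => - u n) by apply/funext => n; rewrite fctE opprK.
exact: is_cvgN.
Qed.

Let limn_ge0 (u : R^nat) : (forall n, 0 <= u n) -> 0 <= limn u.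
Proof.
move=> u0; have [cu|ncu] := pselect (cvgn u); last by rewrite (dvgP ncu).
by apply: limr_ge => //; exact: nearW.
Qed.

Let Gamma_conj z : Gamma (conjc z) = conjc (Gamma z).
Proof.
rewrite /Gamma /= -limn_opp; congr (limn _ +i* limn _); apply/funext => n;
  by rewrite gauss_conj; case: gauss_Gamma.
Qed.

Let Gamma_ge0 z : 0 <= z -> 0 <= Gamma z.
Proof.
move=> z0.
have u0 n : 0 <= gauss_Gamma z n.
  have ez : z = (complex.Re z)%:C by case: z z0 => a b /ger0_Im /= ->.
  rewrite /gauss_Gamma ez -rmorphM /= expC_real -ez.
  rewrite divr_ge0 ?mulr_ge0 ?ler0n ?lecR ?expR_ge0//.
  by rewrite prodr_ge0// => j _; rewrite addr_ge0.
rewrite lecE /=; apply/andP; split.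
  under eq_fun do rewrite (ger0_Im (u0 _)).
  by rewrite lim_cst.
by apply: limn_ge0 => n; have := u0 n; rewrite lecE => /andP[].
Qed.

Let nu_cases alpha :
  (exists2 r : R, nu alpha = r%:C & 0 <= r <= 2^-1) \/
  (exists b : R, nu alpha = b*i).
Proof.
rewrite /nu; set c : R := 1 - 4 * alpha%:num.
have c1 : c <= 1 by rewrite /c gerBl.
have half : (2^-1 : R[i]) = (2^-1 : R)%:C by rewrite fmorphV rmorph_nat.
have sq := sqrtCK (c%:C : R[i]).
have [c0|c0] := lerP 0 c; [left|right].
  have : 0 <= sqrtC (c%:C : R[i]) by rewrite sqrtC_ge0 lecR.
  move: sq; case: (sqrtC _) => a b sq; rewrite lecE /= => /andP[/eqP b0 a0].
  exists (2^-1 * a); first by rewrite half b0 rmorphM.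
  rewrite mulr_ge0//= ler_piMr//.
  rewrite -(@ler_pXn2r _ 2)// ?nnegrE// expr1n.
  by move: sq; rewrite b0 !expr2; simpc => /(congr1 (@complex.Re R)) /= ->.
move: sq; case: (sqrtC _) => a b; rewrite expr2 /= => -[].
move=> reE imE; exists (2^-1 * b).
have : a * b = 0.
  have /eqP : (a * b) *+ 2 = 0 by rewrite mulr2n -{2}(mulrC b) imE.
  by rewrite mulrn_eq0 /= => /eqP.
move=> /eqP; rewrite mulf_eq0 => /orP[/eqP a0|/eqP b0].
  by rewrite half a0; simpc.
by move: c0; rewrite -reE b0 mulr0 subr0 ltNge -expr2 sqr_ge0.
Qed.

(* In the order of R[i] this says that [gamma_factor] is real and nonnegative. *)
Lemma gamma_factor_ge0 alpha x : 0 <= gamma_factor alpha x.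
Proof.
rewrite /gamma_factor.
have half : (2^-1 : R[i]) = (2^-1 : R)%:C by rewrite fmorphV rmorph_nat.
have [[r -> /andP[r0 r2]]|[b ->]] := nu_cases alpha.
  rewrite half -(rmorph_nat (real_complex R)) -rmorphB -!rmorphD -rmorphM /=.
  apply: mulr_ge0; first apply: mulr_ge0; last 2 first.
  - by apply: Gamma_ge0; rewrite lecR addr_ge0// subr_ge0.
  - by apply: Gamma_ge0; rewrite lecR !addr_ge0.
  rewrite (_ : cosC _ = (cos (pi * r))%:C).
    rewrite lecR cos_ge0_pihalf//; apply/andP; split.
      by rewrite (@le_trans _ _ 0) ?mulr_ge0 ?pi_ge0// oppr_le0 divr_ge0 ?pi_ge0.
    by rewrite ler_wpM2l ?pi_ge0.
  have -> (t : R) : cosC t%:C = (cos t)%:C; last by [].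
  rewrite /cosC half (_ : 'i * t%:C = 0 +i* t); last by simpc.
  rewrite (_ : - (0 +i* t) = 0 +i* - t); last by simpc.
  rewrite /expC /= cosN sinN expR0 !mul1r; simpc.
  by congr (_ +i* _); lra.
rewrite -mulrA mulr_ge0//.
  rewrite /cosC (_ : 'i * _ = (- (pi * b))%:C); last by simpc.
  rewrite -rmorphN !expC_real -rmorphD half.
  by rewrite -rmorphM lecR divr_ge0 ?addr_ge0 ?expR_ge0.
rewrite (_ : 2^-1 - _ + _ = conjc (2^-1 + b*i + x%:R)).
  by rewrite Gamma_conj mulrC mulcJ_ge0.
by rewrite !conjcD conjc_nat half conjc_real; simpc.
Qed.

Definition weight alpha (xi : R) (x : nat) : R :=
  xi ^+ x / (2 * pi) * complex.Re (gamma_factor alpha x) / x`!%:R ^+ 2.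

Lemma weight_ge0 alpha (xi : R) x : 0 <= xi -> 0 <= weight alpha xi x.
Proof.
move=> xi0; rewrite /weight !mulr_ge0 ?invr_ge0 ?exprn_ge0 ?mulr_ge0 ?pi_ge0//.
by have := gamma_factor_ge0 alpha x; rewrite lecE => /andP[].
Qed.

End gamma_weight.

Section point_processes.
Context {R : realType}.
Implicit Types (alpha theta : {posnum R}) (xi : {itv R & `]0, 1[}).
Implicit Types l : strict_partition.

Definition pair_factor l : R :=
  \prod_(k < size (parts l)) \prod_(j < size (parts l) | (k < j)%N)
    (((nth 0%N (parts l) k)%:R - (nth 0%N (parts l) j)%:R) /
     ((nth 0%N (parts l) k)%:R + (nth 0%N (parts l) j)%:R)) ^+ 2.

Lemma pair_factor_ge0 l : 0 <= pair_factor l.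
Proof.
by apply: prodr_ge0 => k _; apply: prodr_ge0 => j _; exact: sqr_ge0.
Qed.

Definition M_mass alpha xi l : R :=
  (1 - xi%:num) `^ (alpha%:num / 2) *
  (\prod_(x <- parts l) weight alpha xi%:num x) * pair_factor l.

Lemma M_mass_ge0 alpha xi l : 0 <= M_mass alpha xi l.
Proof.
rewrite /M_mass !mulr_ge0 ?powR_ge0 ?pair_factor_ge0//.
by apply: prodr_ge0 => x _; exact: weight_ge0.
Qed.

Definition M alpha xi : {measure set strict_partition -> \bar R} :=
  discrete_measure (fun l => NngNum (M_mass_ge0 alpha xi l)).

Definition Pl_mass theta l : R :=
  (theta%:num / 2) ^+ sumn (parts l) * expR (- (theta%:num / 2)) /
    (sumn (parts l))`!%:R *
  (2 ^+ (sumn (parts l) - size (parts l)) * (sumn (parts l))`!%:R /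
    (\prod_(x <- parts l) x`!%:R) ^+ 2 * pair_factor l).

Lemma Pl_mass_ge0 theta l : 0 <= Pl_mass theta l.
Proof.
by rewrite /Pl_mass !mulr_ge0 ?invr_ge0 ?exprn_ge0 ?expR_ge0 ?pair_factor_ge0//
  ?prodr_ge0.
Qed.

Definition Pl theta : {measure set strict_partition -> \bar R} :=
  discrete_measure (fun l => NngNum (Pl_mass_ge0 theta l)).

(* Weak convergence along a filter: every function on the discrete space of
   strict partitions is continuous, so the test functions are the bounded ones. *)
Definition weak_cvg (T : Type) (F : set_system T)
    (mu : T -> {measure set strict_partition -> \bar R})
    (P : {measure set strict_partition -> \bar R}) : Prop :=
  forall f : strict_partition -> R, (exists C : R, forall l, `|f l| <= C) ->
    (\int[mu t]_(l in setT) f l) @[t --> F] --> \int[P]_(l in setT) f l.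

(* For n = 0 this says that P has total mass 1. *)
Definition determinantal (P : {measure set strict_partition -> \bar R})
    (K : nat -> nat -> R) : Prop :=
  forall (n : nat) (x : 'I_n -> nat), injective x -> (forall i, (0 < x i)%N) ->
    P [set l | forall i, x i \in parts l] =
    (\det (\matrix_(k < n, j < n) K (x k) (x j)))%:E.

(* The right-hand side of the integrable form for real arguments x <> y. *)
Definition integrable_kernel theta (x y : R) : R :=
  let J := besselJ theta%:num in
  2 * Num.sqrt (x * y) / (x ^+ 2 - y ^+ 2) *
  (Num.sqrt theta%:num * J (x - 1) * J y -
   Num.sqrt theta%:num * J (y - 1) * J x - 2^-1 * (x - y) * J x * J y).

End point_processes.

(* Main.v *)
(* Idea.  Restricted to parts at most N, the weight of a strict partition is a
   principal minor of the Cauchy-like matrix L(x, y) = a(x) a(y) / (x + y) with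
   a(x) = sqrt(x) theta^(x/2) / x!, so the truncated ensemble is determinantal
   with kernel L (1 + L)^-1.  An explicit kernel K, given by a power series in
   theta, solves K (1 + L) = L on all of Z_{>0}; since L is positive semidefinite,
   1 + L is bounded below and the truncated kernels converge to K.  The identity
   sum_x x K(x, x) = theta / 2 gives the mean size and, by comparing coefficients
   in theta, the total mass e^(theta / 2).  The Bessel series for K is a telescoped
   product formula, and the integrable form is a Christoffel-Darboux summation,
   valid for real orders by the recurrence of J.

   For alpha > 1/4 the parameter nu is imaginary and
   |Gamma(1/2 + i b)|^2 = pi / cosh(pi b), obtained from the integrals of
   cos^m(x) cosh(2 b x) as Wallis' formula is for b = 0, turns the weight into
   w(x) = 1/2 prod_{j < x} (xi j (j + 1) + alpha xi) / (j + 1)^2, which tends to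
   theta^x / (2 x!^2) and is dominated by a geometric sequence.  Dominated
   convergence then gives weak convergence. *)
Require Import Defs.
From mathcomp Require Import all_boot all_order all_algebra.
From mathcomp Require Import all_classical all_reals all_analysis.
From mathcomp.real_closed Require Import complex.
From mathcomp Require Import ring lra zify.

Set Implicit Arguments.
Unset Strict Implicit.
Unset Printing Implicit Defensive.

Import Order.TTheory GRing.Theory Num.Theory numFieldNormedType.Exports.

Local Open Scope classical_set_scope.
Local Open Scope ring_scope.

(** Not even the total mass of [Pl theta] is presupposed, so everything is computed for parts at
    most [N], where sums are finite and determinants are those of matrices. The lower bound on 1 + L
    carries the result to the limit entry by entry; no Fredholm determinant occurs. The factor 1 /
    (x + y) makes L Cauchy-like: eliminating one row and column leaves a matrix of the same shape
    with another [a], so one induction scheme yields both the expansion into minors and positivity.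
    The kernel is expanded in powers of theta because each coefficient of its equation is a finite
    alternating binomial sum, that is, a high-order difference of a rational function with a single
    pole. The mean size is theta Z' / Z for the partition function Z, whence Z' = Z / 2. As [Gamma]
    is made of separate limits of real and imaginary parts, the moduli of the Gauss products do not
    suffice: their phases must converge too. Bessel functions are needed at real orders on both
    sides of an integer, because the diagonal of the integrable form is a limit in a real
    variable. *)

(** * Series: tails, Tannery's theorem, regrouping, uniqueness of coefficients *)

Section series_tools.
Context {R : realType}.
Implicit Types u v h g : nat -> R.

Lemma abs_cvg_series h u : (forall n, `|h n| <= u n) -> cvgn (series u) ->
  cvgn (series h).
Proof.
move=> hu cu; apply: normed_cvg.
apply: (@series_le_cvg R _ u) => [n|n|n|//] /=; [exact: normr_ge0| |exact: hu].
exact: le_trans (hu n).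
Qed.

Lemma cvgn_limn h (l : R) : h @ \oo --> l -> limn h = l.
Proof. by move=> H; apply/cvg_lim. Qed.

Lemma cvg0_le (T : Type) (F : set_system T) {FF : Filter F} (f g : T -> R) :
  (\forall t \near F, `|f t| <= g t) -> g t @[t --> F] --> 0 -> f t @[t --> F] --> 0.
Proof.
move=> fg g0; apply/norm_cvg0P.
apply: (squeeze_cvgr _ (cvg_cst 0) g0).
by apply: filterS fg => t ->; rewrite normr_ge0.
Qed.

Lemma series_tail h u N : (forall n, `|h n| <= u n) -> cvgn (series u) ->
  `|limn (series h) - series h N| <= limn (series u) - series u N.
Proof.
move=> hu cu; have ch := abs_cvg_series hu cu.
have H : (fun n => `|series h n - series h N|) @ \oo -->
   `|limn (series h) - series h N|.
  by apply: cvg_norm; apply: cvgB; [exact: ch | exact: cvg_cst].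
have H' : (fun n => series u n - series u N) @ \oo -->
   limn (series u) - series u N by apply: cvgB; [exact: cu | exact: cvg_cst].
rewrite -(cvgn_limn H) -(cvgn_limn H').
apply: ler_lim; [exact: cvgP H | exact: cvgP H' |].
near=> n.
have Nn : (N <= n)%N by near: n; exact: nbhs_infty_ge.
rewrite !sub_series_geq//; apply: le_trans (ler_norm_sum _ _ _) _.
exact: ler_sum.
Unshelve. all: by end_near. Qed.

Lemma series_lim_norm h u : (forall n, `|h n| <= u n) -> cvgn (series u) ->
  `|limn (series h)| <= limn (series u).
Proof.
by move=> hu cu; have := series_tail 0 hu cu; rewrite /series/= !big_geq// !subr0.
Qed.

Lemma series_le_lim u N : (forall n, 0 <= u n) -> cvgn (series u) ->
  series u N <= limn (series u).
Proof.
move=> u0 cu; apply: nondecreasing_cvgn_le => //.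
by apply: nondecreasing_series => n _ _.
Qed.

Lemma limn_series_fin h N : (forall n, (N <= n)%N -> h n = 0) ->
  series h @ \oo --> \sum_(0 <= n < N) h n.
Proof.
move=> h0; apply: cvg_near_cst; near=> n.
have Nn : (N <= n)%N by near: n; exact: nbhs_infty_ge.
rewrite /series/= (@big_cat_nat _ _ _ N)//= [X in _ + X]big_nat.
by rewrite [X in _ + X]big1 ?addr0// => i /andP[Ni _]; exact: h0.
Unshelve. all: by end_near. Qed.

Lemma limn_seriesS h : cvgn (series h) ->
  limn (series h) = h 0%N + limn (series (fun n => h n.+1)).
Proof.
move=> ch; have H : (fun n => series h n.+1) @ \oo --> limn (series h).
  by rewrite (cvg_shiftS (series h)).
have H2 : series (fun n => h n.+1) @ \oo --> limn (series h) - h 0%N.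
  rewrite (_ : series (fun n => h n.+1) = fun n => series h n.+1 - h 0%N).
    by apply: cvgB => //; exact: cvg_cst.
  apply/funext => n; rewrite /series/= [in RHS]big_nat_recl//.
  by rewrite addrC addKr.
by rewrite (cvgn_limn H2) addrC subrK.
Qed.

Lemma is_cvg_seriesS h : cvgn (series h) -> cvgn (series (fun n => h n.+1)).
Proof.
move=> ch; have H : (fun n => series h n.+1) @ \oo --> limn (series h).
  by rewrite (cvg_shiftS (series h)).
rewrite (_ : series (fun n => h n.+1) = fun n => series h n.+1 - h 0%N).
  by apply: is_cvgB; [exact: cvgP H | exact: is_cvg_cst].
apply/funext => n; rewrite /series/= [in RHS]big_nat_recl//.
by rewrite addrC addKr.
Qed.

Lemma is_cvg_seriesSV h : cvgn (series (fun n => h n.+1)) -> cvgn (series h).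
Proof.
move=> ch; have H : (fun n => series h n.+1) @ \oo -->
    h 0%N + limn (series (fun n => h n.+1)).
  rewrite (_ : (fun n => series h n.+1) = fun n => h 0%N + series (fun n => h n.+1) n).
    by apply: cvgD => //; exact: cvg_cst.
  by apply/funext => n; rewrite /series/= big_nat_recl.
by rewrite (cvg_shiftS (series h)) in H; exact: cvgP H.
Qed.

Lemma cvg_sum_nat (T : Type) (F : set_system T) {FF : Filter F}
    (f : T -> nat -> R) g N : (forall n, f t n @[t --> F] --> g n) ->
  (\sum_(0 <= n < N) f t n) @[t --> F] --> \sum_(0 <= n < N) g n.
Proof.
move=> fg; elim: N => [|N IH].
  rewrite big_geq//; under eq_fun do rewrite big_geq//; exact: cvg_cst.
rewrite big_nat_recr//=; under eq_fun do rewrite big_nat_recr//=.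
exact: cvgD.
Qed.

(** Dominated convergence for series along a filter: the tails beyond a fixed [N] are at most the
    tail of [u], uniformly in [t], so finitely many termwise limits decide. *)
Lemma tannery (T : Type) (F : set_system T) {FF : ProperFilter F}
    (f : T -> nat -> R) g u :
  cvgn (series u) -> (\forall t \near F, forall n, `|f t n| <= u n) ->
  (forall n, f t n @[t --> F] --> g n) ->
  limn (series (f t)) @[t --> F] --> limn (series g).
Proof.
move=> cu fu fg.
have gu n : `|g n| <= u n.
  apply: (@closed_cvg _ _ F FF (fun t => `|f t n|) (fun x => x <= u n)).
  - exact: closed_le.
  - by near=> t; near: t; apply: filterS fu => t /(_ n).
  - exact: cvg_norm.
apply/cvgrPdist_le => /= e e0.
have [N HN] : exists N, limn (series u) - series u N <= e / 3.
  have /cvgrPdist_le /(_ (e / 3)) : series u @ \oo --> limn (series u) by [].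
  rewrite divr_gt0// => /(_ isT) [N _ /(_ N (leqnn N))] /=.
  by move=> H; exists N; apply: le_trans H; exact: ler_norm.
have H : (\sum_(0 <= n < N) f t n) @[t --> F] --> \sum_(0 <= n < N) g n.
  exact: cvg_sum_nat.
have e3 : 0 < e / 3 by rewrite divr_gt0.
move/cvgrPdist_le : H => /(_ _ e3) H.
near=> t.
have ft : forall n, `|f t n| <= u n by near: t.
have Ht : `|\sum_(0 <= n < N) g n - \sum_(0 <= n < N) f t n| <= e / 3.
  by near: t.
have T1 := le_trans (series_tail N gu cu) HN.
have T2 := le_trans (series_tail N ft cu) HN.
move: T1 T2 Ht; rewrite /series/=.
rewrite !ler_norml; lra.
Unshelve. all: by end_near. Qed.

Lemma sum_triangle (a : nat -> nat -> R) N :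
  \sum_(0 <= n < N) \sum_(0 <= i < n.+1) a i (n - i)%N =
  \sum_(0 <= i < N) \sum_(0 <= j < N - i) a i j.
Proof.
elim: N => [|N IH]; first by rewrite !big_geq.
rewrite big_nat_recr//= IH [in RHS]big_nat_recr//= subSnn big_nat1.
rewrite [in X in _ + X]big_nat_recr//= subnn addrA; congr (_ + _).
rewrite -big_split/=; apply: eq_big_nat => i /andP[_ iN].
by rewrite subSn ?(ltnW iN)// [in RHS]big_nat_recr.
Qed.

(** Regrouping by antidiagonals is how double series are sorted by powers of theta below. A partial
    sum over antidiagonals is a triangle, hence a sum of rows [i] cut at length [N - i], and
    [tannery] lets [N] grow inside it. *)
Lemma cvg_series_diag (a : nat -> nat -> R) u v :
  (forall i, 0 <= u i) -> (forall j, 0 <= v j) ->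
  cvgn (series u) -> cvgn (series v) ->
  (forall i j, `|a i j| <= u i * v j) ->
  series (fun n => \sum_(0 <= i < n.+1) a i (n - i)%N) @ \oo -->
  limn (series (fun i => limn (series (a i)))).
Proof.
move=> u0 v0 cu cv auv.
(* Rows outside the triangle are set to 0, so that it becomes a full series in [i]. *)
pose f N i := if (i < N)%N then \sum_(0 <= j < N - i) a i j else 0.
have E N : series (fun n => \sum_(0 <= i < n.+1) a i (n - i)%N) N =
    limn (series (f N)).
  rewrite {1}/series/= sum_triangle.
  rewrite (@cvgn_limn _ _ (@limn_series_fin (f N) N _)); last first.
    by move=> n Nn; rewrite /f ltnNge Nn.
  by apply: eq_big_nat => i /andP[_ iN]; rewrite /f iN.
rewrite [X in X x @[x --> _]](_ : _ = fun N => limn (series (f N))); last first.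
  by apply/funext => N; exact: E.
apply: (@tannery _ \oo _ _ _ (fun i => u i * limn (series v))).
- have -> : (fun i => u i * limn (series v)) = limn (series v) *: u.
    by apply/funext => i; rewrite mulrC.
  exact: is_cvg_seriesZ.
- near=> N => i; rewrite /f; case: ifP => _; last first.
    rewrite normr0 mulr_ge0//.
    by apply: le_trans (series_le_lim 0 v0 cv); rewrite /series/= big_geq.
  apply: le_trans (ler_norm_sum _ _ _) _.
  apply: (@le_trans _ _ (\sum_(0 <= j < N - i) u i * v j)); first exact: ler_sum.
  by rewrite -mulr_sumr ler_wpM2l// (series_le_lim (N - i) v0 cv).
- move=> i.
  have ca : cvgn (series (a i)).
    apply: (@abs_cvg_series _ (u i *: v)) => [j|]; first exact: auv.
    exact: is_cvg_seriesZ.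
  rewrite -(cvg_shiftn i).
  apply: cvg_trans ca; apply: near_eq_cvg; near=> N.
  rewrite /f/= addnK -[X in (X < _)%N]add0n ltn_add2r.
  by have -> : (0 < N)%N by near: N; exact: nbhs_infty_gt.
Unshelve. all: by end_near. Qed.

Lemma is_cvg_pseries (c : nat -> R) t : cvgn (series (fun n => `|c n|)) ->
  0 < t <= 1 -> cvgn (series (fun n => c n * t ^+ n)).
Proof.
move=> cc /andP[t0 t1].
apply: (@abs_cvg_series _ (fun n => `|c n|)) => // k.
by rewrite normrM ler_piMr// normrX exprn_ile1// gtr0_norm.
Qed.

(** Letting [t] decrease to 0 isolates the constant term, and dividing by [t] shifts the
    coefficients. Only positive [t] is asked for, as theta is positive in the application. *)
Lemma pseries_uniq (c : nat -> R) : cvgn (series (fun n => `|c n|)) ->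
  (forall t : R, 0 < t <= 1 -> limn (series (fun n => c n * t ^+ n)) = 0) ->
  forall n, c n = 0.
Proof.
move=> cc c0 n.
have base (d : nat -> R) : cvgn (series (fun n => `|d n|)) ->
  (forall t : R, 0 < t <= 1 -> limn (series (fun n => d n * t ^+ n)) = 0) ->
  d 0%N = 0.
  move=> dc d0.
  have H : limn (series (fun n => d n * t ^+ n)) @[t --> (0:R)^'+] -->
      limn (series (fun n => d n * 0 ^+ n)).
    apply: (@tannery _ _ _ _ _ (fun n => `|d n|)) => //.
      near=> t => m; rewrite normrM ler_piMr// normrX exprn_ile1//.
      by rewrite gtr0_norm//; near: t; exact: nbhs_right_le.
    move=> m; apply: cvgM; first exact: cvg_cst.
    apply: cvg_within_filter; exact: exprn_continuous.
  have H0 : limn (series (fun n => d n * 0 ^+ n)) = 0.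
    apply: (cvg_unique _ H) => //.
    apply: cvg_near_cst; near=> t; apply/eqP; rewrite d0//.
    by apply/andP; split; near: t; [exact: nbhs_right_gt | exact: nbhs_right_le].
  rewrite -[RHS]H0.
  rewrite (@cvgn_limn _ _ (@limn_series_fin (fun n => d n * 0 ^+ n) 1 _)).
    by rewrite big_nat1 expr0 mulr1.
  by move=> [|k] // _; rewrite expr0n mulr0.
elim: n c cc c0 => [|n IH] c cc c0; first exact: base.
have c00 := base c cc c0.
apply: (IH (fun n => c n.+1)) => [|t t01]; first exact: is_cvg_seriesS cc.
have /andP[t0 t1] := t01.
have ct := is_cvg_pseries (is_cvg_seriesS cc) t01.
have := c0 _ t01; rewrite limn_seriesS; last exact: is_cvg_pseries.
rewrite c00 mul0r add0r => H.
have tu : t != 0 by rewrite gt_eqF.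
apply: (mulfI tu); rewrite mulr0 -H -[LHS]lim_seriesZ//.
congr (limn (series _)); apply/funext => k /=.
by rewrite exprS mulrCA.
Unshelve. all: by end_near. Qed.

End series_tools.

(** * Cauchy-like matrices and truncated ensembles of strict partitions *)

(** Recursion on the largest allowed part, to match the bordering of a matrix by one row and
    column. *)
Fixpoint sparts (N : nat) : seq (seq nat) :=
  if N is n.+1 then sparts n ++ [seq n.+1 :: l | l <- sparts n] else [:: [::]].

Section cauchy_ensemble.
Context {R : realFieldType}.
Implicit Types a d : nat -> R.

Fixpoint pairs (l : seq nat) : R :=
  if l is x :: l' then
    \prod_(y <- l') ((x%:R - y%:R) / (x%:R + y%:R)) ^+ 2 * pairs l' else 1.

(** By Cauchy's determinant formula, the principal minor on [l] of the matrix a(x) a(y) / (x +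
    y). *)
Definition cweight a (l : seq nat) : R :=
  \prod_(x <- l) (a x ^+ 2 / (2 * x%:R)) * pairs l.

(* The new factor is the square root of the pair factor of [x] and [N], up to
   sign, so prepending the part [N] to a partition twists the weight. *)
Definition twist N a (x : nat) : R := a x * ((x%:R - N%:R) / (x%:R + N%:R)).

Lemma cweight_cons N a l :
  cweight a (N :: l) = a N ^+ 2 / (2 * N%:R) * cweight (twist N a) l.
Proof.
rewrite /cweight/= big_cons -!mulrA; congr (_ * _); congr (_ * _).
congr (_ * _); rewrite !mulrA; congr (_ * _).
rewrite -big_split/=; apply: eq_bigr => x _.
rewrite /twist -(opprB N%:R) (addrC x%:R) mulNr mulrN sqrrN [in RHS]exprMn; ring.
Qed.

Lemma pairs_ge0 l : 0 <= pairs l.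
Proof.
elim: l => //= x l IH; rewrite mulr_ge0// prodr_ge0// => y _; exact: sqr_ge0.
Qed.

Lemma pairs_le1 l : pairs l <= 1.
Proof.
elim: l => //= x l IH.
have h0 (y : nat) : 0 <= ((x%:R - y%:R) / (x%:R + y%:R)) ^+ 2 :> R by exact: sqr_ge0.
have h1 (y : nat) : ((x%:R - y%:R) / (x%:R + y%:R)) ^+ 2 <= 1 :> R.
  rewrite exprMn exprVn; have [->|xy] := eqVneq (x%:R + y%:R) (0 : R).
    by rewrite expr0n/= invr0 mulr0.
  rewrite ler_pdivrMr ?mul1r; last by rewrite lt_neqAle eq_sym sqrf_eq0 xy sqr_ge0.
  have : 0 <= x%:R * y%:R :> R by rewrite mulr_ge0.
  rewrite -subr_ge0; nra.
apply: mulr_ile1 => //; first by rewrite prodr_ge0.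
  exact: pairs_ge0.
elim: l {IH} => [|y l IH]; first by rewrite big_nil.
by rewrite big_cons mulr_ile1// prodr_ge0.
Qed.

Lemma sparts_le N l x : l \in sparts N -> x \in l -> (0 < x <= N)%N.
Proof.
elim: N l => [|N IH] l /=; first by rewrite inE => /eqP ->.
rewrite mem_cat => /orP[/IH H /H /andP[-> /leqW ->] //|/mapP[l' /IH H ->]].
by rewrite inE => /orP[/eqP ->|/H /andP[-> /leqW ->]]; rewrite ?leqnn.
Qed.

Lemma sparts_notin N l : l \in sparts N -> N.+1 \notin l.
Proof. by move=> lN; apply/negP => /(sparts_le lN); rewrite ltnn andbF. Qed.

(* Index [i] stands for the part [N - i]: with the parts in decreasing order,
   [Lmx N.+1 a] is [Lmx N a] bordered by a first row and column. *)
Definition Lmx N a : 'M[R]_N :=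
  \matrix_(i, j) (a (N - i)%N * a (N - j)%N / ((N - i)%N%:R + (N - j)%N%:R)).

Definition Dmx N d : 'M[R]_N := diag_mx (\row_i d (N - i)%N).

Definition trow N a : 'rV[R]_N :=
  \row_j (2 * N.+1%:R * a (N - j)%N / (a N.+1 * ((N - j)%N%:R + N.+1%:R))).

Definition pivot N a : R := a N.+1 ^+ 2 / (2 * N.+1%:R).

Lemma schur_border (b c x n : R) : c != 0 -> n != 0 -> x + n != 0 ->
  c * b / (n + x) = c ^+ 2 / (2 * n) * (2 * n * b / (c * (x + n))).
Proof.
by move=> c0 n0 xn; rewrite (addrC n); field; apply/and3P; split.
Qed.

(** Elimination with the pivot at [n] subtracts 2 n a b / ((x + n) (y + n)), and (x + n) (y + n) - 2
    n (x + y) = (x - n) (y - n). Hence the Schur complement is again Cauchy-like. *)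
Lemma schur_corner (a b c x y n : R) :
  c != 0 -> n != 0 -> x + y != 0 -> x + n != 0 -> y + n != 0 ->
  a * b / (x + y) =
  a * ((x - n) / (x + n)) * (b * ((y - n) / (y + n))) / (x + y) +
  2 * n * a / (c * (x + n)) * (c ^+ 2 / (2 * n)) * (2 * n * b / (c * (y + n))).
Proof.
by move=> c0 n0 xy xn yn; field; rewrite c0 n0 xy xn yn.
Qed.

Lemma Lmx_block N a d : a N.+1 != 0 ->
  (Dmx N.+1 d + Lmx N.+1 a : 'M[R]_(1 + N)) =
  block_mx (d N.+1 + pivot N a)%:M (pivot N a *: trow N a)
           (pivot N a *: (trow N a)^T) (Dmx N d + Lmx N a).
Proof.
move=> aN; have N0 : N.+1%:R != 0 :> R by rewrite pnatr_eq0.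
have pos (i : 'I_N) : 0 < (N - i)%N%:R :> R by rewrite ltr0n subn_gt0.
rewrite -[LHS](@submxK R 1 N 1 N); congr block_mx.
- apply/matrixP => i j; rewrite !ord1 !mxE/= !subn0 !mulr1n /pivot.
  by congr (_ + _); rewrite -expr2 mulr_natl mulr2n.
- apply/matrixP => i j; rewrite !ord1 !mxE/= !subn0 subSS add0r.
  by rewrite /pivot schur_border// lt0r_neq0// addr_gt0.
- apply/matrixP => i j; rewrite !ord1 !mxE/= !subn0 subSS add0r.
  rewrite /pivot [_ + N.+1%:R]addrC [a _ * a _]mulrC schur_border//.
  by rewrite [_ + N.+1%:R]addrC.
- by apply/matrixP => i j; rewrite !mxE/= !subSS.
Qed.

Lemma Lmx_corner N a : a N.+1 != 0 ->
  Lmx N a = Lmx N (twist N.+1 a) + pivot N a *: ((trow N a)^T *m trow N a).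
Proof.
move=> aN; have N0 : N.+1%:R != 0 :> R by rewrite pnatr_eq0.
have pos (i : 'I_N) : 0 < (N - i)%N%:R :> R by rewrite ltr0n subn_gt0.
apply/matrixP => i j; rewrite !mxE big_ord1 !mxE/= /pivot /twist.
rewrite (@schur_corner (a (N - i)%N) (a (N - j)%N) (a N.+1) _ _ N.+1%:R)//.
- by congr (_ + _); rewrite [RHS]mulrCA !mulrA.
- by rewrite lt0r_neq0// addr_gt0.
Qed.

Lemma det_block_split N (x y : R) (v : 'rV[R]_N) (u : 'cV[R]_N) (B : 'M[R]_N) :
  \det (block_mx (x + y)%:M v u B : 'M[R]_(1 + N)) =
  x * \det B + \det (block_mx y%:M v u B : 'M[R]_(1 + N)).
Proof.
have H : \det (block_mx 1%:M 0 u B : 'M[R]_(1 + N)) = \det B.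
  by rewrite det_lblock det1 mul1r.
rewrite -H -[\det (block_mx y%:M _ _ _)]mul1r.
apply: (@determinant_multilinear _ _ _ _ _ (lshift N ord0)).
- apply/rowP => j; rewrite !mxE.
  rewrite (unsplitK (inl ord0 : 'I_1 + 'I_N)) !mxE.
  case: split_ordP => k _; rewrite !mxE ?ord1 ?eqxx.
    by rewrite mulr1 mul1r.
  by rewrite mulr0 add0r mul1r.
- by apply/matrixP => i j; rewrite !mxE; case: split_ordP => k // /(congr1 val) /=;
   rewrite (ord1 k).
- by apply/matrixP => i j; rewrite !mxE; case: split_ordP => k // /(congr1 val) /=;
   rewrite (ord1 k).
Qed.

(** Induction that splits the corner entry [d N.+1 + pivot N a]. The summand [d N.+1] deletes the
    first row and column and yields the partitions without the part [N.+1]. The summand [pivot N a]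
    leaves, after elimination, the matrix of [twist N.+1 a], which by [cweight_cons] yields the
    partitions with that part. Both constant 1 and an indicator are used for [d] later. *)
Lemma det_sparts N d a : (forall x, (0 < x <= N)%N -> a x != 0) ->
  \det (Dmx N d + Lmx N a) =
  \sum_(l <- sparts N) (\prod_(1 <= x < N.+1 | x \notin l) d x) * cweight a l.
Proof.
elim: N a => [|N IH] a a0.
  by rewrite det_mx00 big_seq1 big_geq// /cweight big_nil !mul1r.
have aN : a N.+1 != 0 by apply: a0; rewrite leqnn.
rewrite [Dmx _ _ + _](Lmx_block d aN) det_block_split.
set w := pivot N a; set t := trow N a.
have -> : block_mx w%:M (w *: t) (w *: t^T) (Dmx N d + Lmx N a) =
    block_mx 1%:M 0 t^T 1%:M *m
    block_mx w%:M (w *: t) 0 (Dmx N d + Lmx N (twist N.+1 a)).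
  rewrite mulmx_block !(mulmx0, mul0mx, addr0, add0r, mul1mx).
  rewrite mul_mx_scalar; congr block_mx.
  by rewrite -scalemxAr (Lmx_corner aN) -/w -/t addrA addrC.
rewrite det_mulmx det_lblock !det1 !mul1r det_ublock det_scalar1.
rewrite IH; last first.
  by move=> x /andP[x0 xN]; apply: a0; rewrite x0 leqW.
rewrite IH; last first.
  move=> x /andP[x0 xN]; rewrite /twist mulf_neq0 ?a0 ?x0 ?leqW//.
  rewrite mulf_neq0 ?invr_eq0// ?subr_eq0 ?eqr_nat ?ltn_eqF//.
rewrite /= big_cat/= big_map !mulr_sumr; congr (_ + _).
  rewrite big_seq [in RHS]big_seq; apply: eq_bigr => l lN.
  rewrite [in RHS]big_mkcond [in RHS]big_nat_recr//= sparts_notin//.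
  by rewrite -[in RHS]big_mkcond/= mulrA [d _ * _]mulrC.
rewrite big_seq [in RHS]big_seq; apply: eq_bigr => l lN.
rewrite cweight_cons -/(pivot N a) -/w [RHS]mulrCA; congr (w * (_ * _)).
rewrite [in RHS]big_mkcond [in RHS]big_nat_recr//= inE eqxx mulr1.
rewrite -[in RHS]big_mkcond/=.
rewrite big_nat_cond [in RHS]big_nat_cond; apply: eq_bigl => x.
case: (boolP (0 < x < N.+1)%N) => //= /andP[_ xN].
by rewrite in_cons negb_or ltn_eqF.
Qed.

Lemma cweight_ge0 a l : 0 <= cweight a l.
Proof.
by rewrite mulr_ge0 ?pairs_ge0// prodr_ge0// => x _; rewrite divr_ge0 ?sqr_ge0.
Qed.

Lemma Dmx1 N : Dmx N (fun=> 1) = 1%:M.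
Proof. by apply/matrixP => i j; rewrite !mxE. Qed.

Lemma det_1L N a : (forall x, (0 < x <= N)%N -> a x != 0) ->
  \det (1%:M + Lmx N a) = \sum_(l <- sparts N) cweight a l.
Proof.
by move=> a0; rewrite -Dmx1 det_sparts//; apply: eq_bigr => l _; rewrite big1 ?mul1r.
Qed.

Lemma sparts_nil N : [::] \in sparts N.
Proof. by elim: N => //= N IH; rewrite mem_cat IH. Qed.

Lemma det_1L_ge1 N a : (forall x, (0 < x <= N)%N -> a x != 0) ->
  1 <= \det (1%:M + Lmx N a).
Proof.
move=> a0; rewrite det_1L// (big_rem [::]) ?sparts_nil//= /cweight big_nil mul1r.
by rewrite lerDl sumr_ge0// => l _; exact: cweight_ge0.
Qed.

Definition psd N (A : 'M[R]_N) := forall v : 'rV_N, 0 <= (v *m A *m v^T) 0 0.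

(** Completing the square: the form at (v1, v2) is [w] times the square of v1 + v2 t^T, plus the
    form of [C] at v2. *)
Lemma psd_schur N (w : R) (t : 'rV[R]_N) (C : 'M[R]_N) : 0 <= w -> psd C ->
  psd (block_mx w%:M (w *: t) (w *: t^T) (C + w *: (t^T *m t)) : 'M[R]_(1 + N)).
Proof.
move=> w0 pC v; rewrite -[v]hsubmxK.
set v1 := lsubmx v; set v2 := rsubmx v.
rewrite mul_row_block tr_row_mx mul_row_col.
set z := v1 + v2 *m t^T.
suff -> : (v1 *m w%:M + v2 *m (w *: t^T)) *m v1^T +
    (v1 *m (w *: t) + v2 *m (C + w *: (t^T *m t))) *m v2^T =
    w *: (z *m z^T) + v2 *m C *m v2^T.
  rewrite mxE addr_ge0//.
  by rewrite mxE mulr_ge0// mxE big_ord1 !mxE -expr2 sqr_ge0.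
have -> : z^T = v1^T + t *m v2^T.
  by rewrite -[in RHS](trmxK t) -trmx_mul -raddfD.
rewrite /z mul_mx_scalar.
rewrite !(mulmxDl, mulmxDr) -!scalemxAr -!scalemxAl !mulmxA !scalerDr.
rewrite -!addrA; congr (_ + _); rewrite [LHS]addrCA; congr (_ + _).
by congr (_ + _); rewrite addrC.
Qed.

Lemma Lmx_psd N a : (forall x, (0 < x <= N)%N -> a x != 0) -> psd (Lmx N a).
Proof.
elim: N a => [|N IH] a a0; first by move=> v; rewrite mxE big_ord0.
have aN : a N.+1 != 0 by apply: a0; rewrite leqnn.
have := Lmx_block (fun=> 0) aN.
have -> : Dmx N.+1 (fun=> 0) = 0 by apply/matrixP => i j; rewrite !mxE mul0rn.
have -> : Dmx N (fun=> 0) = 0 by apply/matrixP => i j; rewrite !mxE mul0rn.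
rewrite !add0r => ->; rewrite (Lmx_corner aN); apply: psd_schur.
  by rewrite /pivot divr_ge0 ?sqr_ge0.
apply: IH => x /andP[x0 xN]; rewrite /twist mulf_neq0 ?a0 ?x0 ?leqW//.
by rewrite mulf_neq0 ?invr_eq0// ?subr_eq0 ?eqr_nat ?ltn_eqF.
Qed.

Lemma rnorm_sum N (v : 'rV[R]_N) : (v *m v^T) 0 0 = \sum_i v 0 i ^+ 2.
Proof. by rewrite mxE; apply: eq_bigr => i _; rewrite mxE expr2. Qed.

(** Pairing the equation with [v] gives |v|^2 <= <r, v>, and <r, v> <= (|r|^2 + |v|^2) / 2. *)
Lemma psd_contract N (A : 'M[R]_N) (v r : 'rV_N) : psd A -> v *m (1%:M + A) = r ->
  \sum_i v 0 i ^+ 2 <= \sum_i r 0 i ^+ 2.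
Proof.
move=> pA vr; have := pA v.
have -> : v *m A *m v^T = r *m v^T - v *m v^T.
  by rewrite -vr mulmxDr mulmx1 mulmxDl addrC addKr.
rewrite mxE [X in _ + X]mxE rnorm_sum subr_ge0 => H.
have {}H : \sum_i v 0 i ^+ 2 <= \sum_i r 0 i * v 0 i.
  by apply: le_trans H _; rewrite mxE; apply: ler_sum => i _; rewrite mxE.
have : \sum_i r 0 i * v 0 i <= 2^-1 * (\sum_i r 0 i ^+ 2 + \sum_i v 0 i ^+ 2).
  rewrite -big_split/= mulr_sumr; apply: ler_sum => i _.
  by have := sqr_ge0 (r 0 i - v 0 i); nra.
by move: H; lra.
Qed.

Definition KN N a : 'M[R]_N := 1%:M - invmx (1%:M + Lmx N a).

Lemma sylvester m n (A : 'M[R]_(m, n)) (B : 'M[R]_(n, m)) :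
  \det (1%:M - A *m B) = \det (1%:M - B *m A).
Proof.
have H1 : block_mx 1%:M 0 B 1%:M *m block_mx 1%:M A 0 (1%:M - B *m A) =
   block_mx 1%:M A B 1%:M.
  rewrite mulmx_block !(mulmx0, mul0mx, addr0, add0r, mul1mx, mulmx1).
  by rewrite addrC subrK.
have H2 : block_mx (1%:M - A *m B) A 0 1%:M *m block_mx 1%:M 0 B 1%:M =
   block_mx 1%:M A B 1%:M.
  rewrite mulmx_block !(mulmx0, mul0mx, addr0, add0r, mul1mx, mulmx1).
  by rewrite subrK.
have := congr1 determinant H1; rewrite -[in RHS]H2 !det_mulmx.
by rewrite !det_lblock !det_ublock !det1 !mul1r !mulr1.
Qed.

(** Multiplied by det (1 + L), the minor of 1 - (1 + L)^-1 on the chosen sites becomes det (1 + L -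
    P), where P projects onto these sites ([sylvester]). The diagonal 1 is thus erased there, and
    [det_sparts] retains exactly the partitions that contain all the sites. *)
Lemma det_correlation N a n (f : 'I_n -> 'I_N) : injective f ->
  (forall x, (0 < x <= N)%N -> a x != 0) ->
  \sum_(l <- sparts N | [forall k, (N - f k)%N \in l]) cweight a l =
  (\sum_(l <- sparts N) cweight a l) * \det (mxsub f f (KN N a)).
Proof.
move=> injf a0; rewrite -det_1L//.
set A := 1%:M + Lmx N a.
have uA : A \in unitmx.
  by rewrite unitmxE unitfE gt_eqF// (lt_le_trans _ (det_1L_ge1 a0)).
pose E : 'M[R]_(n, N) := rowsub f 1%:M.
pose E' : 'M[R]_(N, n) := colsub f 1%:M.
have Esub (M : 'M[R]_N) : E *m M *m E' = mxsub f f M.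
  by rewrite /E mul_rowsub_mx mul1mx /E' mulmx_colsub mulmx1 -mxsubcr.
have EE : E *m E' = 1%:M.
  rewrite -[E]mulmx1 Esub; apply/matrixP => i j; rewrite !mxE.
  by rewrite (inj_eq injf).
rewrite -Esub /KN -/A mulmxBr mulmx1 mulmxBl EE -mulmxA sylvester.
rewrite -det_mulmx mulmxBr mulmx1.
have -> : A *m (invmx A *m E' *m E) = E' *m E by rewrite !mulmxA mulmxV// mul1mx.
(* The diagonal of 1 - P: it is 0 at the chosen parts and 1 elsewhere. *)
pose d x : R := (~~ [exists k, (N - f k)%N == x])%:R.
have subE (i j : 'I_N) : ((N - i)%N == (N - j)%N) = (i == j).
  by rewrite -val_eqE/=; have := ltn_ord i; have := ltn_ord j; lia.
have -> : A - E' *m E = Dmx N d + Lmx N a.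
  rewrite /A addrAC; congr (_ + _); apply/matrixP => i j; rewrite !mxE /d.
  under eq_existsb do rewrite subE.
  under eq_bigr do rewrite !mxE.
  case: existsP => [[k /eqP <-]|nk].
    rewrite (bigD1 k)//= eqxx mul1r big1 ?addr0 ?subrr ?mul0rn// => k' kk'.
    by rewrite (inj_eq injf) eq_sym (negbTE kk') mul0r.
  rewrite big1 ?subr0// => k _; case: eqP => [ik|]; last by rewrite mul0r.
  by case: nk; exists k; rewrite ik.
rewrite det_sparts// big_mkcond/=; apply: eq_big_seq => l lN.
case: ifPn => [/forallP H|].
  rewrite big1_seq ?mul1r// => x /andP[xl _].
  rewrite /d; case: existsP => //= -[k /eqP kx].
  by move: xl; rewrite -kx H.
rewrite negb_forall => /existsP[k kl].
rewrite big_mkcond (bigD1_seq (N - f k)%N)/= ?iota_uniq//; last first.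
  by rewrite mem_index_iota ltnS leq_subr subn_gt0 ltn_ord.
rewrite kl /d (_ : [exists _, _]) ?mul0r//.
by apply/existsP; exists k.
Qed.

End cauchy_ensemble.

(** * Differences of polynomials and of functions with one simple pole *)

Section finite_differences.
Context {R : realFieldType}.

(** This is (-1)^N times the usual forward difference of order [N] at 0. *)
Fixpoint fdiff (N : nat) (g : nat -> R) : R :=
  if N is n.+1 then fdiff n g - fdiff n (fun z => g z.+1) else g 0%N.

Lemma eq_fdiff N g h : (forall z, (z <= N)%N -> g z = h z) -> fdiff N g = fdiff N h.
Proof.
elim: N g h => [|N IH] g h gh; first exact: gh.
by rewrite /= (IH g h) ?(IH (fun z => g z.+1) (fun z => h z.+1))// => z zN;
  apply: gh => //; exact: leqW.
Qed.

Lemma fdiffD N g h : fdiff N (fun z => g z + h z) = fdiff N g + fdiff N h.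
Proof. by elim: N g h => //= N IH g h; rewrite !IH opprD addrACA. Qed.

Lemma fdiffZ N c g : fdiff N (fun z => c * g z) = c * fdiff N g.
Proof. by elim: N g => //= N IH g; rewrite !IH mulrBr. Qed.

Lemma fdiff_sum N g : fdiff N g =
  \sum_(0 <= z < N.+1) (-1) ^+ z * 'C(N, z)%:R * g z.
Proof.
elim: N g => [|N IH] g; first by rewrite big_nat1 expr0 bin0 !mul1r.
rewrite /= !IH [in RHS]big_nat_recl// [X in X - _]big_nat_recl//=.
rewrite !bin0 -addrA; congr (_ + _).
have -> : \sum_(0 <= i < N) (-1) ^+ i.+1 * 'C(N, i.+1)%:R * g i.+1 =
    \sum_(0 <= i < N.+1) (-1) ^+ i.+1 * 'C(N, i.+1)%:R * g i.+1.
  by rewrite [in RHS]big_nat_recr//= bin_small// mulr0 mul0r addr0.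
rewrite -sumrN -big_split/=; apply: eq_bigr => i _.
by rewrite binS natrD exprS; ring.
Qed.

Lemma size_polyB_shift (p : {poly R}) :
  (size (p - (p \Po ('X + 1)))%R <= (size p).-1)%N.
Proof.
elim/poly_ind: p => [|p c IH]; first by rewrite comp_poly0 subr0 size_poly0.
rewrite comp_polyD comp_polyM comp_polyX comp_polyC.
have -> : p * 'X + c%:P - ((p \Po ('X + 1)) * ('X + 1) + c%:P) =
   (p - (p \Po ('X + 1))) * 'X - (p \Po ('X + 1)) by ring.
have [->|p0] := eqVneq p 0.
  by rewrite comp_poly0 !subr0 mul0r size_poly0.
have sp : (0 < size p)%N by rewrite size_poly_gt0.
rewrite size_MXaddC (negbTE p0)/=.
rewrite (leq_trans (size_polyD _ _))// size_polyN geq_max; apply/andP; split.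
  have [->|d0] := eqVneq (p - (p \Po ('X + 1))) 0; first by rewrite mul0r size_poly0.
  by rewrite size_mulX// -(prednK sp) ltnS.
by rewrite -polyC1 size_comp_poly2// size_XaddC.
Qed.

Lemma fdiff_poly0 N (p : {poly R}) : (size p <= N)%N ->
  fdiff N (fun z => p.[z%:R]) = 0.
Proof.
elim: N p => [|N IH] p pN.
  by move: pN; rewrite leqn0 size_poly_eq0 => /eqP ->; rewrite /= horner0.
rewrite /= -[fdiff N (fun z => p.[z.+1%:R])]mul1r -mulNr -fdiffZ -fdiffD.
rewrite -[RHS](IH (p - (p \Po ('X + 1)))); last first.
  by apply: leq_trans (size_polyB_shift p) _; case: (size p) pN.
apply: eq_fdiff => z _; rewrite !hornerE horner_comp !hornerE.
by rewrite mulN1r -natr1.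
Qed.

Lemma fdiff_inv N (y : R) : 0 < y ->
  fdiff N (fun z => (z%:R + y)^-1) = N`!%:R / \prod_(0 <= i < N.+1) (y + i%:R).
Proof.
elim: N y => [|N IH] y y0; first by rewrite /= big_nat1 add0r addr0 mul1r.
have yi (i : nat) : y + i%:R != 0 by rewrite gt_eqF// ltr_wpDr.
rewrite /= IH//.
have -> : fdiff N (fun z => (z.+1%:R + y)^-1) = fdiff N (fun z => (z%:R + (y + 1))^-1).
  by apply: eq_fdiff => z _; rewrite -natr1 addrAC -addrA.
rewrite IH ?ltr_wpDr//.
have -> : \prod_(0 <= i < N.+1) (y + 1 + i%:R) = \prod_(0 <= i < N.+1) (y + i.+1%:R).
  by apply: eq_bigr => i _; rewrite -natr1 (addrC i%:R) addrA.
rewrite [in RHS]big_nat_recl// [in X in X - _]big_nat_recl// [in X in _ - X]big_nat_recr//=.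
rewrite [in RHS]big_nat_recr//= addr0 factS natrM.
have P0 : \prod_(0 <= i < N) (y + i.+1%:R) != 0.
  by rewrite prodf_seq_neq0; apply/allP => i _; exact: yi.
have := yi N.+1; move: (\prod_(0 <= i < N) _) P0 => P P0 h.
move: (N.+1%:R) h => M h; field; rewrite P0 h gt_eqF//.
Qed.

(** Dividing [p] by X + y leaves a quotient of degree below [N], which the difference kills, and the
    remainder [p.[- y]] over z + y. *)
Lemma fdiff_partial_fraction N (p : {poly R}) (y : R) : 0 < y ->
  (size p <= N.+1)%N ->
  fdiff N (fun z => p.[z%:R] / (z%:R + y)) =
  p.[- y] * (N`!%:R / \prod_(0 <= i < N.+1) (y + i%:R)).
Proof.
move=> y0 pN.
have /factor_theorem[p1 E] : root (p - p.[- y]%:P) (- y).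
  by rewrite /root !hornerE subrr.
have p1N : (size p1 <= N)%N.
  have [->|p10] := eqVneq p1 0; first by rewrite size_poly0.
  have : (size (p1 * ('X - (- y)%:P))%R <= N.+1)%N.
    rewrite -E (leq_trans (size_polyD _ _))// size_polyN geq_max pN/=.
    by rewrite (leq_trans (size_polyC_leq1 _)).
  by rewrite size_Mmonic ?monicXsubC// size_XsubC addn2.
have e z : p.[z%:R] / (z%:R + y) = p1.[z%:R] + p.[- y] * (z%:R + y)^-1.
  have zy : z%:R + y != 0 by rewrite gt_eqF// ltr_wpDl.
  have := congr1 (fun q => q.[z%:R]) E; rewrite !hornerE opprK => H.
  have -> : p.[z%:R] = p1.[z%:R] * (z%:R + y) + p.[- y] by rewrite -H subrK.
  by field.
rewrite (eq_fdiff (fun z _ => e z)) fdiffD fdiff_poly0// add0r fdiffZ.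
by rewrite fdiff_inv.
Qed.

End finite_differences.

(** * The kernel equation and the trace identity, coefficient by coefficient *)

Section kernel_coefficients.
Context {R : realFieldType}.
Definition factR (n : nat) : R := n`!%:R.

Lemma factR_gt0 n : 0 < factR n.
Proof. by rewrite ltr0n fact_gt0. Qed.

Lemma factR_ge0 n : 0 <= factR n.
Proof. exact/ltW/factR_gt0. Qed.

Lemma factR_neq0 n : factR n != 0.
Proof. by rewrite gt_eqF ?factR_gt0. Qed.

Lemma factRS n : factR n.+1 = n.+1%:R * factR n.
Proof. by rewrite /factR factS natrM. Qed.

Lemma binR m k : (k <= m)%N -> 'C(m, k)%:R = factR m / (factR k * factR (m - k)).
Proof.
move=> km; rewrite /factR -(bin_fact km) !natrM mulfK//.
Qed.

(* The kernel is [K(x, y) = aw x * aw y * sum_n (- theta)^n kcoef n x y]; the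
   identities it satisfies are proved coefficient by coefficient. *)
Definition kcoef (n x y : nat) : R :=
  factR x * factR y * factR (n.*2 + x + y).-1 / (factR n * factR (n + x) * factR (n + y) * factR (n + x + y)).

Lemma kcoef_ge0 n x y : 0 <= kcoef n x y.
Proof. by rewrite divr_ge0 // !mulr_ge0 // ltW ?factR_gt0. Qed.

Lemma kcoef0 x y : (0 < x)%N -> kcoef 0 x y = (x%:R + y%:R)^-1.
Proof.
case: x => // x _; rewrite /kcoef !add0n addSn/= factRS -natrD addSn.
have -> : factR 0 = 1 by []; rewrite mul1r [factR (x + y).+1]factRS.
have h1 : x.+1%:R != 0 :> R by rewrite pnatr_eq0.
have h2 : (x + y).+1%:R != 0 :> R by rewrite pnatr_eq0.
move: (x.+1%:R) ((x + y).+1%:R) (factR x) (factR y) (factR (x + y)) h1 h2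
  (factR_neq0 x) (factR_neq0 y) (factR_neq0 (x + y)) => a b c d e *.
by field; apply/and5P; split.
Qed.

(** The binomial coefficient of 2n + x + y over n is at most 2^(2n + x + y), while n! x! <= (n + x)!
    and n! y! <= (n + y)!. A spare factor 1 / n! is given away: the aim is a bound that separates
    the variables and is summable in [n]. *)
Lemma kcoef_le n x y : kcoef n x y <= 2 ^+ x * 2 ^+ y * (4 ^+ n / factR n).
Proof.
have H : factR (n.*2 + x + y).-1 <= factR n * factR (n + x + y) * (2 ^+ x * 2 ^+ y * 4 ^+ n).
  have e : (n.*2 + x + y = n + (n + x + y))%N by rewrite -addnn; lia.
  have := bin_fact (leq_addr (n + x + y) n); rewrite addKn -e => F.
  have L : ('C(n.*2 + x + y, n) <= 2 ^ (n.*2 + x + y))%N.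
    have := Pascal 1 1 (n.*2 + x + y); rewrite addn1 => ->.
    have nn : (n < (n.*2 + x + y).+1)%N by rewrite ltnS -addnn; lia.
    rewrite (bigD1 (Ordinal nn))//= !exp1n !muln1; exact: leq_addr.
  have E2 : (2 ^ (n.*2 + x + y))%:R = 2 ^+ x * 2 ^+ y * 4 ^+ n :> R.
    have -> : (4 : R) = 2 ^+ 2 by rewrite -natrX.
    by rewrite natrX -!exprM -!exprD; congr (_ ^+ _); rewrite -mul2n; lia.
  rewrite -E2 -!natrM ler_nat (@leq_trans (n.*2 + x + y)`!)//.
    by case: (n.*2 + x + y)%N => // m; rewrite leq_fact.
  by rewrite -F mulnC leq_mul2l L orbT.
rewrite /kcoef ler_pdivrMr ?mulr_gt0 ?factR_gt0//.
have m1 (a b : nat) : factR a * factR b <= factR (a + b).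
  rewrite -natrM ler_nat -(bin_fact (leq_addr b a)) addKn.
  by rewrite leq_pmull// bin_gt0 leq_addr.
have -> : 2 ^+ x * 2 ^+ y * (4 ^+ n / factR n) * (factR n * factR (n + x) * factR (n + y) * factR (n + x + y))
   = factR (n + x) * factR (n + y) * (factR (n + x + y) * (2 ^+ x * 2 ^+ y * 4 ^+ n)).
  by field; rewrite factR_neq0.
apply: (@le_trans _ _ (factR x * factR y * (factR n * (factR n * factR (n + x + y) * (2 ^+ x * 2 ^+ y * 4 ^+ n))))).
  rewrite ler_pM2l ?mulr_gt0 ?factR_gt0//; apply: le_trans H _.
  rewrite -[leLHS]mul1r ler_wpM2r//; last by rewrite ler1n fact_gt0.
  by rewrite !mulr_ge0// exprn_ge0.
have E0 : 0 <= factR (n + x + y) * (2 ^+ x * 2 ^+ y * 4 ^+ n).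
  by rewrite !mulr_ge0 ?exprn_ge0// ltW ?factR_gt0.
rewrite -!(mulrA (factR n)) [leLHS](_ : _ = factR n * factR x * (factR n * factR y) *
   (factR (n + x + y) * (2 ^+ x * 2 ^+ y * 4 ^+ n))); last by ring.
by rewrite ler_wpM2r// ler_pM ?m1// mulr_ge0 ?ler0n.
Qed.

(* Coefficient form of K + K L = L. *)
Lemma kcoef_conv N x y : (0 < x)%N -> (0 < y)%N -> (0 < N)%N ->
  \sum_(0 <= z < N.+1) (-1) ^+ (N - z) * (z%:R / (factR z ^+ 2 * (z%:R + y%:R))) *
     kcoef (N - z) x z = - ((-1) ^+ N * kcoef N x y).
Proof.
case: N => // N x0 y0 _.
(* Up to sign, [p.[z%:R]] is the quotient of the two factorials of the summand that depend on [z]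
   and are not absorbed by a binomial coefficient. *)
pose p : {poly R} := \prod_(0 <= i < N) ('X - (N.+1 + x + i.+1)%:R%:P).
have sp : size p = N.+1.
  by rewrite /p size_prod_XsubC size_iota subn0.
have prodf (m k : nat) : \prod_(0 <= i < k) ((m + i.+1)%:R : R) = factR (m + k) / factR m.
  elim: k => [|k IH]; first by rewrite big_geq// addn0 divff ?factR_neq0.
  by rewrite big_nat_recr//= IH addnS factRS; field; rewrite factR_neq0.
have pz z : (z <= N.+1)%N -> p.[z%:R] =
    (-1) ^+ N * (factR (N.+1.*2 + x - z).-1 / factR (N.+1 + x - z)).
  move=> zN; have e : (N.+1 + x - z + N = (N.+1.*2 + x - z).-1)%N by lia.
  rewrite -e -prodf horner_prod -[in (-1) ^+ N](subn0 N) -prodr_const_nat -big_split/=.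
  apply: eq_bigr => i _; rewrite !hornerE mulN1r; apply/eqP.
  by rewrite -subr_eq0 opprK addrAC -natrD subr_eq0 eqr_nat; apply/eqP; lia.
have py : p.[- y%:R] = (-1) ^+ N * (factR (N.+1.*2 + x + y).-1 / factR (N.+1 + x + y)).
  have e : (N.+1 + x + y + N = (N.+1.*2 + x + y).-1)%N by lia.
  rewrite -e -prodf horner_prod -[in (-1) ^+ N](subn0 N) -prodr_const_nat -big_split/=.
  apply: eq_bigr => i _; rewrite !hornerE mulN1r -opprD; congr (- _).
  by rewrite -natrD; congr (_%:R); lia.
have yR : 0 < y%:R :> R by rewrite ltr0n.
have D1 := fdiff_partial_fraction yR (leqW (leq_trans (eq_leq sp) (leqnn _))).
have D0 : fdiff N.+1 (fun z => p.[z%:R]) = 0 by rewrite fdiff_poly0 ?sp.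
(* As z / (z + y) = 1 - y / (z + y), this is [p] minus a function with one pole. The difference of
   order [N.+1] kills [p], of degree [N], and the pole gives the right-hand side. *)
pose g z : R := z%:R * p.[z%:R] / (z%:R + y%:R).
have Dg : fdiff N.+1 g = - (y%:R * (p.[- y%:R] * (factR N.+1 /
    \prod_(0 <= i < N.+2) (y%:R + i%:R)))).
  rewrite -D1 -fdiffZ -[RHS]add0r -[X in _ = X - _]D0 -mulN1r -fdiffZ -fdiffD.
  apply: eq_fdiff => z _; rewrite /g; field.
  by rewrite gt_eqF// ltr_wpDl.
have yp : \prod_(0 <= i < N.+2) (y%:R + i%:R : R) = factR (y + N.+1) / factR y.-1.
  have -> : (y + N.+1 = y.-1 + N.+2)%N by lia.
  rewrite -prodf; apply: eq_bigr => i _.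
  by rewrite -natrD; congr (_%:R); lia.
have E : (factR x / (factR N.+1 ^+ 2 * factR (N.+1 + x))) * fdiff N.+1 g =
  (-1) ^+ N.+1 * kcoef N.+1 x y.
  have fy : factR y = y%:R * factR y.-1 by rewrite -[in LHS](prednK y0) factRS prednK.
  have f0 := factR_neq0.
  rewrite Dg py yp /kcoef fy (addnC y) (exprS (-1) N).
  by field; rewrite -?/(factR _) !f0.
have sgn (m k : nat) : (k <= m)%N -> (-1) ^+ (m - k) = (-1) ^+ m * (-1) ^+ k :> R.
  by move=> km; rewrite -{2}(subnK km) exprD -mulrA -expr2 sqrr_sign mulr1.
rewrite -E fdiff_sum mulr_sumr -sumrN; apply: eq_big_nat => z /andP[_ zN].
have {}zN : (z <= N.+1)%N by [].
rewrite /g pz// /kcoef sgn// exprS.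
have -> : ((N.+1 - z).*2 + x + z = N.+1.*2 + x - z)%N by lia.
have -> : (N.+1 - z + x = N.+1 + x - z)%N by lia.
have -> : (N.+1 - z + z = N.+1)%N by lia.
have -> : (N.+1 + x - z + z = N.+1 + x)%N by lia.
rewrite binR//.
have zy : z%:R + y%:R != 0 :> R by rewrite gt_eqF// ltr_wpDl.
have f0 := factR_neq0.
move: ((-1) ^+ N) ((-1) ^+ z) => e e'.
by field; rewrite -?/(factR _) !f0 zy.
Qed.

(* Coefficient form of sum_x x K(x, x) = theta / 2. *)
Lemma kcoef_trace N :
  \sum_(0 <= x < N.+1) (-1) ^+ (N - x) * (x%:R / factR x) ^+ 2 *
     kcoef (N - x) x x = (N == 1%N)%:R / 2.
Proof.
case: N => [|N].
  by rewrite big_nat1 mul0r expr0n mulr0 mul0r mul0r.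
have f0 := factR_neq0.
(* An antidifference, up to the factor -2N, of the alternating summand left once [c] is taken out.
   It works for x <= N only: at [x = N.+1] truncated subtraction reads 1 / (-1)! as 1 instead of 0.
   So the last term is added by hand, and N = 0 is computed directly. *)
pose t x : R := (-1) ^+ x * (x%:R * (x%:R - 1)) / (factR (N.+1 - x) * factR (N + x)).
pose c : R := factR (N.+1.*2).-1 / factR N.+1 ^+ 2.
have tS x : (x < N.+1)%N -> t x.+1 - t x =
   - (2 * N%:R) * ((-1) ^+ x * x%:R ^+ 2 / (factR (N.+1 - x) * factR (N.+1 + x))).
  move=> xN; rewrite /t (addSn N) addnS.
  have -> : (N.+1 - x = (N - x).+1)%N by lia.
  have -> : (N.+1 - x.+1 = N - x)%N by lia.
  have Nx : (x <= N)%N by [].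
  have xx : (N - x)%:R + 1 + x%:R = N%:R + 1 :> R by rewrite natrB// addrAC subrK.
  rewrite !factRS exprS -!natr1 natrD natrB//; field.
  by rewrite -!/(factR _) !f0 -natrD -natrB// !natr1 !pnatr_eq0.
have Hsum : \sum_(0 <= x < N.+2) (-1) ^+ (N.+1 - x) * (x%:R / factR x) ^+ 2 *
     kcoef (N.+1 - x) x x = (-1) ^+ N.+1 * c * \sum_(0 <= x < N.+2) ((-1) ^+ x * x%:R ^+ 2 / (factR (N.+1 - x) * factR (N.+1 + x))).
  rewrite mulr_sumr; apply: eq_big_nat => x /andP[_ xN].
  rewrite /kcoef /c.
  have -> : ((N.+1 - x).*2 + x + x = N.+1.*2)%N by lia.
  have -> : (N.+1 - x + x = N.+1)%N by lia.
  have -> : (-1) ^+ (N.+1 - x) = (-1) ^+ N.+1 * (-1) ^+ x :> R.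
    by rewrite -{2}(subnK (xN : (x <= N.+1)%N)) exprD -mulrA -expr2 sqrr_sign mulr1.
  by field; rewrite !f0.
rewrite Hsum; case: N => [|N] in t c tS Hsum *.
  rewrite big_nat_recl// big_nat1 /c subn0 addn0 subnn addn1.
  rewrite (_ : factR 1 = 1)// (_ : factR 0 = 1)// (_ : factR 2 = 2)//.
  by rewrite !expr1 eqxx mulr1n expr0; field.
have t0 : t 0%N = 0 by rewrite /t expr0 !mul0r mulr0 mul0r.
have M1 : 2 * N.+1%:R != 0 :> R by rewrite mulf_neq0 ?pnatr_eq0.
have E : \sum_(0 <= x < N.+2) ((-1) ^+ x * x%:R ^+ 2 / (factR (N.+2 - x) * factR (N.+2 + x)))
    = - (2 * N.+1%:R)^-1 * t N.+2.
  have -> : t N.+2 = \sum_(0 <= x < N.+2) (t x.+1 - t x).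
    by rewrite telescope_sumr// t0 subr0.
  rewrite mulr_sumr; apply: eq_big_nat => x /andP[_ xN].
  by rewrite tS// mulrA mulrNN mulVf// mul1r.
rewrite big_nat_recr//= E /t subnn (_ : factR 0 = 1)// !mul1r mul0r.
have e2 : N.+2%:R = N%:R + 2 :> R by rewrite -addn2 natrD.
have e1 : N.+1%:R = N%:R + 1 :> R by rewrite natr1.
have EF : factR (N.+2 + N.+2) = 2 * (N%:R + 2) * factR (N.+1 + N.+2).
  rewrite [LHS](factRS (N.+1 + N.+2)); congr (_ * _).
  by rewrite -addSn natrD e2; ring.
have n1 : N%:R + 1 != 0 :> R by rewrite natr1 pnatr_eq0.
have n2 : N%:R + 2 != 0 :> R by rewrite -e2 pnatr_eq0.
rewrite EF e2 e1; have F0 := f0 (N.+1 + N.+2)%N; move: (factR _) F0 => F F0.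
rewrite [X in _ * X](_ : _ = 0) ?mulr0//.
move: (N%:R : R) n1 n2 => n n1 n2; move: (_ ^+ N.+2) => e.
by field; rewrite F0 n1 n2.
Qed.

End kernel_coefficients.

(** * The kernel as a power series in theta, and its Bessel series *)

Section plancherel_kernel.
Context {R : realType} (th : R) (th0 : 0 < th).
Let th0' : 0 <= th := ltW th0.

(** J_k(2 sqrt theta) / theta^(k / 2), free of square roots. *)
Definition pbes (k : nat) : R :=
  limn (series (fun r => (- th) ^+ r / (factR r * factR (r + k)))).

Definition kap (x y : nat) : R :=
  limn (series (fun n => (- th) ^+ n * kcoef n x y)).

Definition aw (x : nat) : R := Num.sqrt x%:R * Num.sqrt th ^+ x / factR x.

Definition Kpl (x y : nat) : R := aw x * aw y * kap x y.

Lemma normNth n : `|(- th) ^+ n| = th ^+ n.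
Proof. by rewrite normrX normrN gtr0_norm. Qed.

Lemma aw_sq x : aw x ^+ 2 = x%:R * th ^+ x / factR x ^+ 2.
Proof.
by rewrite /aw expr_div_n exprMn sqr_sqrtr// -exprM mulnC exprM sqr_sqrtr// ltW.
Qed.

Lemma aw_neq0 x : (0 < x)%N -> aw x != 0.
Proof.
move=> x0; rewrite /aw !mulf_neq0 ?invr_neq0 ?factR_neq0//.
  by rewrite sqrtr_eq0 -ltNge ltr0n.
by rewrite expf_neq0// sqrtr_eq0 -ltNge.
Qed.

Lemma aw_ge0 x : 0 <= aw x.
Proof. by rewrite /aw divr_ge0 ?mulr_ge0 ?exprn_ge0 ?sqrtr_ge0// ?factR_ge0. Qed.

Lemma leq_fact_self n : (n <= n`!)%N.
Proof. by case: n => // n; rewrite factS leq_pmulr// fact_gt0. Qed.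

Lemma aw_sq_le (c : R) x : 0 <= c -> c ^+ x * aw x ^+ 2 <= exp_coeff (c * th) x.
Proof.
move=> c0; rewrite aw_sq /exp_coeff/= exprMn -/(factR x) !mulrA.
rewrite ler_pdivrMr ?exprn_gt0 ?factR_gt0// expr2 mulrA divfK ?factR_neq0//.
rewrite -mulrA (mulrC x%:R) mulrA ler_wpM2l ?mulr_ge0 ?exprn_ge0//.
by rewrite ler_nat leq_fact_self.
Qed.

Lemma kap_bound n x y :
  `|(- th) ^+ n * kcoef n x y| <= 2 ^+ x * 2 ^+ y * exp_coeff (4 * th) n.
Proof.
rewrite normrM normNth ger0_norm ?kcoef_ge0//.
rewrite (le_trans (ler_wpM2l _ (kcoef_le n x y))) ?exprn_ge0//.
rewrite /exp_coeff/= exprMn -/(factR n); by rewrite le_eqVlt; apply/orP; left; apply/eqP; ring.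
Qed.

Lemma is_cvg_expc (c x : R) : cvgn (series (fun n => c * exp_coeff x n)).
Proof. exact/is_cvg_seriesZ/is_cvg_series_exp_coeff. Qed.

Arguments is_cvg_expc : clear implicits.

Lemma lim_expc (c x : R) : limn (series (fun n => c * exp_coeff x n)) = c * expR x.
Proof. by rewrite [LHS]lim_seriesZ//; exact: is_cvg_series_exp_coeff. Qed.

Lemma is_cvg_kap x y : cvgn (series (fun n => (- th) ^+ n * kcoef n x y)).
Proof. exact: abs_cvg_series (fun n => kap_bound n x y) (is_cvg_expc _ _). Qed.

Lemma kap_le x y : `|kap x y| <= 2 ^+ x * 2 ^+ y * expR (4 * th).
Proof.
by rewrite -lim_expc; apply: series_lim_norm (fun n => kap_bound n x y) (is_cvg_expc _ _).
Qed.

Lemma powM (z N : nat) : (z <= N)%N ->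
  th ^+ z * (- th) ^+ (N - z) = (-1) ^+ (N - z) * th ^+ N.
Proof.
by move=> zN; rewrite [in LHS]exprNn mulrCA -exprD subnKC.
Qed.

Lemma exp_coeff_ge0' (x : R) n : 0 <= x -> 0 <= exp_coeff x n.
Proof. by move=> x0; rewrite /exp_coeff/= divr_ge0// exprn_ge0. Qed.

(** Entry (x, y) of K (1 + L) = L divided by [aw x * aw y]. Expanding [kap] gives a double series
    whose antidiagonals collect equal powers of theta; [kcoef_conv] evaluates them. *)
Lemma kap_conv x y : (0 < x)%N -> (0 < y)%N ->
  limn (series (fun z => aw z ^+ 2 / (z%:R + y%:R) * kap x z)) =
  (x%:R + y%:R)^-1 - kap x y.
Proof.
move=> x0 y0.
pose A z n : R := aw z ^+ 2 / (z%:R + y%:R) * ((- th) ^+ n * kcoef n x z).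
have zy z : 1 <= z%:R + y%:R :> R by rewrite -natrD ler1n addn_gt0 y0 orbT.
have th2 : 0 <= 2 * th by rewrite mulr_ge0.
have th4 : 0 <= 4 * th by rewrite mulr_ge0.
have Ab z n : `|A z n| <= 2 ^+ x * exp_coeff (2 * th) z * exp_coeff (4 * th) n.
  rewrite /A normrM ger0_norm; last by rewrite divr_ge0 ?sqr_ge0// (le_trans ler01).
  apply: (@le_trans _ _ (aw z ^+ 2 * (2 ^+ x * 2 ^+ z * exp_coeff (4 * th) n))).
    rewrite ler_pM ?kap_bound// ?divr_ge0 ?sqr_ge0// ?(le_trans ler01)//.
    by rewrite ler_piMr ?sqr_ge0// invf_le1 ?(lt_le_trans ltr01).
  rewrite mulrA ler_wpM2r ?exp_coeff_ge0'// mulrCA.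
  by rewrite ler_wpM2l ?exprn_ge0// mulrC aw_sq_le.
have := cvg_series_diag _ _ (is_cvg_expc _ _) _ Ab.
move=> /(_ (fun i => mulr_ge0 (exprn_ge0 x (ler0n R 2)) (exp_coeff_ge0' i th2))).
move=> /(_ (fun i => exp_coeff_ge0' i th4) (is_cvg_series_exp_coeff _)).
have -> : (fun z => limn (series (A z))) = (fun z => aw z ^+ 2 / (z%:R + y%:R) * kap x z).
  apply/funext => z; rewrite /A [LHS]lim_seriesZ//; exact: is_cvg_kap.
move=> /cvgn_limn <-; apply: cvgn_limn.
have -> : (fun n => \sum_(0 <= i < n.+1) A i (n - i)%N) =
   (fun n => (n == 0%N)%:R / (x%:R + y%:R) - (- th) ^+ n * kcoef n x y).
  (* For n = 0 only z = 0 occurs on the left, where [aw] vanishes; the right side cancels by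
     [kcoef0]. *)
  apply/funext => -[|n].
    by rewrite big_nat1 /A aw_sq !mul0r eqxx expr0 !mul1r kcoef0// subrr.
  rewrite mul0r add0r exprNn mulrAC -mulNr -kcoef_conv// mulr_suml.
  apply: eq_big_nat => z /andP[_ zn]; rewrite /A aw_sq.
  transitivity (z%:R / factR z ^+ 2 / (z%:R + y%:R) * kcoef (n.+1 - z) x z *
     (th ^+ z * (- th) ^+ (n.+1 - z))); first by ring.
  rewrite powM// [(factR z ^+ 2 * _)^-1]invfM.
  by move: ((-1) ^+ _) (th ^+ _) => u v; ring.
rewrite [X in series X](_ : _ = (fun n => (n == 0%N)%:R / (x%:R + y%:R)) -
   (fun n => (- th) ^+ n * kcoef n x y))// seriesD seriesN.
apply: cvgB; last exact: is_cvg_kap.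
have := @limn_series_fin R (fun n => (n == 0%N)%:R / (x%:R + y%:R)) 1.
by rewrite big_nat1 mul1r; apply; case=> // n _; rewrite mul0r.
Qed.

Lemma Kpl_trace : limn (series (fun x => x%:R * Kpl x x)) = th / 2.
Proof.
pose A z n : R := (z%:R * aw z ^+ 2) * ((- th) ^+ n * kcoef n z z).
have th8 : 0 <= 8 * th by rewrite mulr_ge0.
have th4 : 0 <= 4 * th by rewrite mulr_ge0.
have Ab z n : `|A z n| <= exp_coeff (8 * th) z * exp_coeff (4 * th) n.
  rewrite /A normrM ger0_norm; last by rewrite mulr_ge0 ?sqr_ge0.
  apply: (@le_trans _ _ (2 ^+ z * aw z ^+ 2 * (2 ^+ z * 2 ^+ z * exp_coeff (4 * th) n))).
    apply: ler_pM => //; [by rewrite mulr_ge0 ?sqr_ge0| |exact: kap_bound].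
    rewrite ler_wpM2r ?sqr_ge0//.
    by rewrite -natrX ler_nat ltnW// ltn_expl.
  rewrite mulrA ler_wpM2r ?exp_coeff_ge0'//.
  apply: le_trans (aw_sq_le z (ler0n R 8)).
  have -> : (8 : R) = 2 * 2 * 2 by rewrite -!natrM.
  by rewrite le_eqVlt; apply/orP; left; apply/eqP; rewrite !exprMn; ring.
have := cvg_series_diag _ _ (is_cvg_series_exp_coeff _) (is_cvg_series_exp_coeff _) Ab.
move=> /(_ (fun i => exp_coeff_ge0' i th8) (fun i => exp_coeff_ge0' i th4)).
have -> : (fun z => limn (series (A z))) = (fun z => z%:R * Kpl z z).
  apply/funext => z; rewrite /A [LHS]lim_seriesZ//; last exact: is_cvg_kap.
  by rewrite /Kpl mulrA -expr2.
move=> /cvgn_limn <-; apply: cvgn_limn.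
have -> : (fun n => \sum_(0 <= i < n.+1) A i (n - i)%N) =
   (fun n => th ^+ n * ((n == 1%N)%:R / 2)).
  apply/funext => n; rewrite -kcoef_trace mulr_sumr.
  apply: eq_big_nat => z /andP[_ zn]; rewrite /A aw_sq.
  transitivity ((z%:R / factR z) ^+ 2 * kcoef (n - z) z z *
     (th ^+ z * (- th) ^+ (n - z))); first by rewrite expr_div_n; ring.
  by rewrite powM//; move: ((-1) ^+ _) (th ^+ _) => u v; ring.
have := @limn_series_fin R (fun n => th ^+ n * ((n == 1%N)%:R / 2)) 2.
rewrite big_nat_recl// big_nat1 !mul0r mulr0 add0r expr1 mulrA mulr1.
by apply; case=> [|[|n]]// _; rewrite mul0r mulr0.
Qed.

Lemma pbes_bound k n : `|(- th) ^+ n / (factR n * factR (n + k))| <=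
  (factR k)^-1 * exp_coeff th n.
Proof.
rewrite normrM normNth ger0_norm; last first.
  by rewrite invr_ge0 mulr_ge0// ?factR_ge0.
rewrite /exp_coeff/= -/(factR n) mulrCA ler_wpM2l ?exprn_ge0//.
rewrite invfM mulrC ler_wpM2r// ?invr_ge0 ?factR_ge0//.
by rewrite lef_pV2 ?posrE ?factR_gt0// ler_nat leq_fact// leq_addl.
Qed.

Lemma pbes_le k : `|pbes k| <= (factR k)^-1 * expR th.
Proof.
by rewrite -lim_expc; apply: series_lim_norm (pbes_bound k) (is_cvg_expc _ _).
Qed.

(** Coefficient of (- theta)^n in [pbes x * pbes y], in the closed form given by Vandermonde's
    convolution. *)
Definition pcoef (n x y : nat) : R :=
  factR (n.*2 + x + y) / (factR n * factR (n + x) * factR (n + y) * factR (n + x + y)).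

Lemma pcoef_vandermonde n x y :
  \sum_(0 <= r < n.+1) (factR r * factR (r + x))^-1 *
     (factR (n - r) * factR (n - r + y))^-1 = pcoef n x y.
Proof.
have f0 := @factR_neq0 R.
have := binomial.Vandermonde (n + y) (n + x) n => /(congr1 (fun m => m%:R : R)).
rewrite binR; last by rewrite -addnA leq_addr.
have -> : (n + y + (n + x) = n.*2 + x + y)%N by rewrite -addnn; lia.
have -> : (n.*2 + x + y - n = n + x + y)%N by rewrite -addnn; lia.
move=> H; rewrite /pcoef.
have -> : factR (n.*2 + x + y) / (factR n * factR (n + x) * factR (n + y) * factR (n + x + y))
   = (factR (n + x) * factR (n + y))^-1 * (factR (n.*2 + x + y) / (factR n * factR (n + x + y))) :> R.
  by field; rewrite -?/(factR _) !f0.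
rewrite -H natr_sum mulr_sumr big_mkord; apply: eq_bigr => -[r rn] _ /=.
rewrite ltnS in rn.
rewrite natrM !binR; [|lia..].
have -> : (n + x - (n - r) = r + x)%N by lia.
have -> : (n + y - r = n - r + y)%N by lia.
by field; rewrite -?/(factR _) !f0.
Qed.

Lemma pbesM x y :
  series (fun n => (- th) ^+ n * pcoef n x y) @ \oo --> pbes x * pbes y.
Proof.
have th1 : 0 <= th by exact: ltW.
pose A i j : R := ((- th) ^+ i / (factR i * factR (i + x))) *
   ((- th) ^+ j / (factR j * factR (j + y))).
have Ab i j : `|A i j| <= ((factR x)^-1 * exp_coeff th i) * ((factR y)^-1 * exp_coeff th j).
  by rewrite normrM ler_pM ?pbes_bound.
have fx k : 0 <= (factR k)^-1 :> R by rewrite invr_ge0 factR_ge0.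
have := cvg_series_diag _ _ (is_cvg_expc _ _) (is_cvg_expc _ _) Ab.
move=> /(_ (fun i => mulr_ge0 (fx x) (exp_coeff_ge0' i th1))).
move=> /(_ (fun i => mulr_ge0 (fx y) (exp_coeff_ge0' i th1))).
have cb k := abs_cvg_series (pbes_bound k) (is_cvg_expc _ _).
have -> : limn (series (fun i => limn (series (A i)))) = pbes x * pbes y.
  under eq_fun do rewrite [limn _]lim_seriesZ ?cb//.
  rewrite -/(pbes y) mulrC -[RHS]lim_seriesZ ?cb//.
  by congr (limn (series _)); apply/funext => i; exact: mulrC.
have -> // : (fun n => \sum_(0 <= i < n.+1) A i (n - i)%N) =
  (fun n => (- th) ^+ n * pcoef n x y).
apply/funext => n.
rewrite -pcoef_vandermonde mulr_sumr; apply: eq_big_nat => i /andP[_ ni].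
by rewrite /A mulrACA -exprD subnKC.
Qed.

(** What is left of [Kpl x y] without the prefactor 2 sqrt(x y) / (x + y) and the powers of sqrt
    theta: the part that telescopes. *)
Definition Tpl x y : R := (x%:R + y%:R) / 2 * kap x y / (factR x * factR y).

Definition tcoef n x y : R := (x%:R + y%:R) / 2 * kcoef n x y / (factR x * factR y).

Lemma tcoefE n x y : tcoef n x y = (x%:R + y%:R) / 2 *
  (factR (n.*2 + x + y).-1 / (factR n * factR (n + x) * factR (n + y) * factR (n + x + y))).
Proof.
by have f0 := @factR_neq0 R; rewrite /tcoef /kcoef; field; rewrite -?/(factR _) !f0.
Qed.

Lemma tcoef_rec n x y : (0 < x)%N ->
  tcoef n.+1 x y + tcoef n x.+1 y.+1 = (pcoef n.+1 x y - pcoef n x.+1 y.+1) / 2.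
Proof.
case: x => // x _; rewrite !tcoefE /pcoef.
pose e := (n.*2 + x + y).+2.
have -> : (n.+1.*2 + x.+1 + y).-1 = e by rewrite /e -!addnn; lia.
have -> : (n.*2 + x.+2 + y.+1).-1 = e by rewrite /e -!addnn; lia.
have -> : (n.+1.*2 + x.+1 + y = e.+1)%N by rewrite /e -!addnn; lia.
have -> : (n.*2 + x.+2 + y.+1 = e.+1)%N by rewrite /e -!addnn; lia.
have -> : (n.+1 + x.+1 = n + x.+2)%N by lia.
have -> : (n.+1 + y = n + y.+1)%N by lia.
have -> : (n + x.+2 + y = (n + x + y).+2)%N by lia.
have -> : (n + x.+2 + y.+1 = (n + x + y).+3)%N by lia.
rewrite (factRS n) (factRS e) (factRS (n + x + y).+2).
have E1 : e.+1%:R = 2 * n%:R + x%:R + y%:R + 3 :> R.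
  by rewrite /e -[(_ + y).+3]addn3 !natrD -muln2 natrM; ring.
have E2 : (n + x + y).+3%:R = n%:R + x%:R + y%:R + 3 :> R.
  by rewrite -[(_ + y).+3]addn3 !natrD.
have E3 : x.+1%:R = x%:R + 1 :> R by rewrite natr1.
have E4 : x.+2%:R = x%:R + 2 :> R by rewrite -[x.+2]addn2 natrD.
have E5 : y.+1%:R = y%:R + 1 :> R by rewrite natr1.
have E6 : n.+1%:R = n%:R + 1 :> R by rewrite natr1.
have n1 : n.+1%:R != 0 :> R by rewrite pnatr_eq0.
have n3 : (n + x + y).+3%:R != 0 :> R by rewrite pnatr_eq0.
rewrite E6 in n1 *; rewrite E2 in n3 *; rewrite E1 E3 E4 E5.
have := @factR_neq0 R => f0.
move: (n%:R : R) (x%:R : R) (y%:R : R) n1 n3 (f0 n) (f0 (n + x.+2)%N)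
  (f0 (n + y.+1)%N) (f0 (n + x + y).+2).
move: (factR e) (factR n) (factR (n + x.+2)) (factR (n + y.+1)) (factR (n + x + y).+2).
move=> E a B C D n' x' y' *.
by field; repeat (apply/andP; split).
Qed.

Lemma tcoef0 x y : (0 < x)%N -> tcoef 0 x y = pcoef 0 x y / 2.
Proof.
move=> x0; have f0 := @factR_neq0 R.
rewrite /tcoef kcoef0// /pcoef !add0n (_ : factR 0 = 1)//.
have h : x%:R + y%:R != 0 :> R by rewrite -natrD pnatr_eq0 -lt0n addn_gt0 x0.
by field; rewrite -?/(factR _) !f0 h.
Qed.

(** Compared on partial sums, with one more term at (x, y) than at (x + 1, y + 1) because the factor
    theta raises the degree by one; the finite sums then agree exactly by [tcoef_rec]. *)
Lemma Tpl_rec x y : (0 < x)%N ->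
  Tpl x y - th * Tpl x.+1 y.+1 =
  (pbes x * pbes y + th * (pbes x.+1 * pbes y.+1)) / 2.
Proof.
move=> x0.
have TE a b : series (fun n => (- th) ^+ n * tcoef n a b) @ \oo --> Tpl a b.
  rewrite /Tpl mulrAC.
  rewrite (_ : series _ = fun N => (a%:R + b%:R) / 2 / (factR a * factR b) *
      series (fun n => (- th) ^+ n * kcoef n a b) N).
    by apply: cvgM; [exact: cvg_cst | exact: is_cvg_kap].
  apply/funext => N; rewrite /series/= mulr_sumr; apply: eq_bigr => i _.
  by rewrite /tcoef; ring.
have L : (fun N => series (fun n => (- th) ^+ n * tcoef n x y) N.+1 -
    th * series (fun n => (- th) ^+ n * tcoef n x.+1 y.+1) N) @ \oo -->
    Tpl x y - th * Tpl x.+1 y.+1.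
  apply: cvgB; first by rewrite (cvg_shiftS (series _)).
  by apply: cvgM; [exact: cvg_cst | exact: TE].
rewrite -(cvgn_limn L).
apply: cvgn_limn.
rewrite [X in X @ _ --> _](_ : _ = fun N =>
   (series (fun n => (- th) ^+ n * pcoef n x y) N.+1 +
    th * series (fun n => (- th) ^+ n * pcoef n x.+1 y.+1) N) / 2).
  apply: cvgM; last exact: cvg_cst.
  apply: cvgD; first by rewrite (cvg_shiftS (series _)); exact: pbesM.
  by apply: cvgM; [exact: cvg_cst | exact: pbesM].
apply/funext; elim=> [|N IH].
  by rewrite /series/= !big_nat1 !big_geq// !mulr0 subr0 addr0 !expr0 !mul1r tcoef0.
rewrite !(seriesSr _ N.+1) !(seriesSr _ N) in IH *.
have := tcoef_rec N y x0.
move: IH; rewrite exprS.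
move: (series _ N) (series _ N) (series _ N) (series _ N) => a b c d.
move=> IH H.
have : (- th) * (- th) ^+ N * (tcoef N.+1 x y + tcoef N x.+1 y.+1) = (- th) * (- th) ^+ N * ((pcoef N.+1 x y - pcoef N x.+1 y.+1) / 2).
  by rewrite H.
move: IH; lra.
Qed.

(** Each use of [Tpl_rec] contributes half of the term at [m] and half of the next one. Inner terms
    thus get weight 1 and the first keeps 1/2, the origin of 2^(- delta(m)). *)
Lemma Tpl_sum M x y : (0 < x)%N ->
  \sum_(0 <= m < M.+1) (2^-1) ^+ (m == 0%N) * th ^+ m *
     (pbes (m + x) * pbes (m + y)) =
  Tpl x y - th ^+ M * Tpl (M + x) (M + y) +
  th ^+ M * (pbes (M + x) * pbes (M + y)) / 2.
Proof.
move=> x0; elim: M => [|M IH].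
  by rewrite big_nat1 eqxx expr1 expr0 !add0n; ring.
rewrite big_nat_recr//= IH expr0 mul1r.
have := @Tpl_rec (M + x) (M + y); rewrite addn_gt0 x0 orbT => /(_ isT) H.
rewrite !addSn exprS.
have := congr1 ( *%R (th ^+ M)) H; lra.
Qed.

(** Serves both remainders of the telescoped sum: the factorials beat the powers coming from
    [kap_le] and [pbes_le], and [c] absorbs the constants. *)
Lemma cvg_vanish x y : (0 < x)%N -> (0 < y)%N -> forall c : R,
  th ^+ M * (((M + x)%:R + (M + y)%:R) * (c * 2 ^+ (M + x) * 2 ^+ (M + y))
    / (factR (M + x) * factR (M + y))) @[M --> \oo] --> (0 : R).
Proof.
move=> x0 y0 c.
have H : (2 * `|c| * 2 ^+ x * 2 ^+ y) * exp_coeff (4 * th) M @[M --> \oo] --> (0 : R).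
  rewrite -[X in _ --> X](mulr0 (2 * `|c| * 2 ^+ x * 2 ^+ y)).
  by apply: cvgM; [exact: cvg_cst | exact: cvg_exp_coeff].
apply/norm_cvg0P; apply: (squeeze_cvgr _ (cvg_cst 0) H).
near=> M; rewrite normr_ge0/=.
have fM : `|((M + x)%:R + (M + y)%:R) / (factR (M + x) * factR (M + y))| <= 2 / factR M :> R.
  case: x x0 {H} => // x _; case: y y0 => // y _.
  rewrite ger0_norm ?divr_ge0 ?addr_ge0 ?mulr_ge0 ?factR_ge0//.
  rewrite !addnS !factRS.
  rewrite ler_pdivrMr ?mulr_gt0 ?factR_gt0// mulrAC ler_pdivlMr ?factR_gt0//.
  have f1 k : 1 <= factR k :> R by rewrite ler1n fact_gt0.
  have fm : factR M <= factR (M + x) :> R by rewrite ler_nat leq_fact// leq_addr.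
  have a1 : 1 <= (M + x).+1%:R :> R by rewrite ler1n.
  have b1 : 1 <= (M + y).+1%:R :> R by rewrite ler1n.
  have := f1 (M + y)%N; have F0 : 0 < factR M :> R by exact: factR_gt0.
  move: (_.+1%:R : R) (_.+1%:R : R) (factR (M + y)) (factR (M + x)) (factR M) a1 b1 fm F0.
  move=> a b g h f a1 b1 fm F0 g1.
  have ab : b + a <= 2 * (a * b) by nra.
  apply: le_trans (ler_wpM2r (ltW F0) ab) _.
  have fhg : f <= h * g by nra.
  rewrite [leRHS](_ : _ = 2 * (a * b) * (h * g)); last by ring.
  by rewrite ler_wpM2l// !mulr_ge0// (le_trans ler01).
rewrite [X in `|X|](_ : _ = (((M + x)%:R + (M + y)%:R) / (factR (M + x) * factR (M + y))) *
   (c * (2 ^+ (M + x) * 2 ^+ (M + y) * th ^+ M))); last by ring.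
rewrite normrM (le_trans (ler_wpM2r (normr_ge0 _) fM))// normrM.
rewrite (ger0_norm (_ : 0 <= 2 ^+ (M + x) * 2 ^+ (M + y) * th ^+ M)) ?mulr_ge0 ?exprn_ge0//.
rewrite /exp_coeff/= -/(factR M) !exprD exprMn.
rewrite (_ : 4 = 2 * 2); last by rewrite -natrM.
by rewrite le_eqVlt; apply/orP; left; apply/eqP; rewrite exprMn; ring.
Unshelve. all: by end_near. Qed.

Lemma Kpl_series x y : (0 < x)%N -> (0 < y)%N ->
  (fun N : nat => 2 * Num.sqrt (x%:R * y%:R) / (x%:R + y%:R) *
    \sum_(0 <= m < N) (2^-1) ^+ (m == 0%N) *
      (Num.sqrt th ^+ (m + x) * pbes (m + x)) *
      (Num.sqrt th ^+ (m + y) * pbes (m + y))) @ \oo --> Kpl x y.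
Proof.
move=> x0 y0; rewrite -cvg_shiftS/=.
have s2 m : Num.sqrt th ^+ m * Num.sqrt th ^+ m = th ^+ m.
  by rewrite -exprMn -expr2 sqr_sqrtr.
pose s := Num.sqrt th.
have xy : x%:R + y%:R != 0 :> R by rewrite -natrD pnatr_eq0 -lt0n addn_gt0 x0.
rewrite [X in X @ _ --> _](_ : _ = fun N =>
  2 * Num.sqrt (x%:R * y%:R) / (x%:R + y%:R) * (s ^+ x * s ^+ y *
   (Tpl x y - th ^+ N * Tpl (N + x) (N + y) +
  th ^+ N * (pbes (N + x) * pbes (N + y)) / 2))); last first.
  apply/funext => N; rewrite -Tpl_sum//; congr (_ * _); rewrite mulr_sumr.
  by apply: eq_bigr => m _; rewrite !exprD -s2; rewrite -/s; ring.
have -> : Kpl x y = 2 * Num.sqrt (x%:R * y%:R) / (x%:R + y%:R) *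
   (s ^+ x * s ^+ y * (Tpl x y - 0 + 0 / 2)).
  rewrite /Kpl /aw /Tpl sqrtrM// -/s; field.
  by rewrite -?/(factR _) !factR_neq0 xy.
have T0 : th ^+ N * Tpl (N + x) (N + y) @[N --> \oo] --> (0 : R).
  have H := cvg_vanish x0 y0 (expR (4 * th) / 2).
  apply: cvg0_le H; apply: nearW => N.
  rewrite normrM ger0_norm ?exprn_ge0// ler_wpM2l ?exprn_ge0//.
  rewrite /Tpl normrM normfV (ger0_norm (_ : 0 <= factR _ * _)) ?mulr_ge0 ?factR_ge0//.
  rewrite ler_wpM2r ?invr_ge0 ?mulr_ge0 ?factR_ge0//.
  have a0 : 0 <= (N + x)%:R + (N + y)%:R :> R by rewrite addr_ge0.
  have a2 := divr_ge0 a0 (ler0n R 2).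
  rewrite normrM (ger0_norm a2) (le_trans (ler_wpM2l a2 (kap_le _ _)))//.
  by rewrite le_eqVlt; apply/orP; left; apply/eqP; ring.
have P0 : th ^+ N * (pbes (N + x) * pbes (N + y)) @[N --> \oo] --> (0 : R).
  have H := cvg_vanish x0 y0 (expR th * expR th).
  apply: cvg0_le H; apply: nearW => N.
  rewrite normrM ger0_norm ?exprn_ge0// ler_wpM2l ?exprn_ge0//.
  rewrite normrM (le_trans (ler_pM _ _ (pbes_le _) (pbes_le _)))// mulrACA mulrC -invfM.
  rewrite ler_wpM2r ?invr_ge0 ?mulr_ge0 ?factR_ge0//.
  have p1 k : 1 <= 2 ^+ k :> R by rewrite exprn_ege1// ler1n.
  have a1 : 1 <= (N + x)%:R :> R by rewrite ler1n addn_gt0 x0 orbT.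
  have b1 : 0 <= (N + y)%:R :> R by [].
  have e0 : 0 <= expR th * expR th by rewrite mulr_ge0// expR_ge0.
  rewrite -[leLHS]mul1r; apply: ler_pM => //; first lra.
  rewrite -mulrA ler_peMr//; have := p1 (N + x)%N; have := p1 (N + y)%N; nra.
apply: cvgM; first exact: cvg_cst.
apply: cvgM; first exact: cvg_cst.
apply: cvgD; last by apply: cvgM; [exact: P0 | exact: cvg_cst].
by apply: cvgB; [exact: cvg_cst | exact: T0].
Unshelve. all: by end_near. Qed.

End plancherel_kernel.

Arguments is_cvg_expc {R} c x.

(** * Convergence of the truncated kernels and of the mean size *)

Lemma sparts_strict N l : l \in sparts N -> is_strict_partition l.
Proof.
elim: N l => [|N IH] l /=; first by rewrite inE => /eqP ->.
rewrite mem_cat => /orP[/IH //|/mapP[l' lN ->]].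
have /andP[sl l0] := IH _ lN; rewrite /is_strict_partition/= in_cons negb_or l0 andbT.
rewrite (path_min_sorted _) ?sl//; apply/allP => x /(sparts_le lN)/andP[_ xN].
by rewrite /gtn/= ltnS.
Qed.

Lemma strict_uniq l : is_strict_partition l -> uniq l.
Proof.
move=> /andP[sl _]; apply: sorted_uniq sl.
  by move=> y x z /= h1 h2; exact: ltn_trans h2 h1.
by move=> x /=; rewrite ltnn.
Qed.

Section finite_approximation.
Context {R : realType} (th : R) (th0 : 0 < th).
Let th0' : 0 <= th := ltW th0.

Lemma sum_ord_rev (N : nat) (F : nat -> R) :
  \sum_(i < N) F (N - i)%N = \sum_(1 <= z < N.+1) F z.
Proof.
elim: N => [|N IH]; first by rewrite big_ord0 big_geq.
rewrite big_ord_recl/= subn0 big_nat_recr//= addrC -IH; congr (_ + _).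
Qed.

Let a0 N x : (0 < x <= N)%N -> aw th x != 0.
Proof. by move=> /andP[x0 _]; exact: aw_neq0. Qed.

Lemma unit_1L N : 1%:M + Lmx N (aw th) \in unitmx.
Proof.
rewrite unitmxE unitfE gt_eqF// (lt_le_trans ltr01)//.
exact: det_1L_ge1 (@a0 N).
Qed.

Lemma KN_mul N : KN N (aw th) *m (1%:M + Lmx N (aw th)) = Lmx N (aw th).
Proof. by rewrite /KN mulmxBl mul1mx mulVmx ?unit_1L// addrC addKr. Qed.

(** Measures what is lost by cutting the sum over [z] in K L at [N]: there aw(z)^2 meets the bound
    2^z of [kap], and 2^z aw(z)^2 is at most the exponential coefficient at 2 theta. *)
Definition tail2 (N : nat) : R := expR (2 * th) - series (exp_coeff (2 * th)) N.

Lemma tail2_ge0 N : 0 <= tail2 N.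
Proof.
rewrite subr_ge0; apply: series_le_lim; last exact: is_cvg_series_exp_coeff.
by move=> n; rewrite exp_coeff_ge0'// mulr_ge0.
Qed.

Lemma tail2_cvg : tail2 N @[N --> \oo] --> (0 : R).
Proof.
rewrite -(subrr (expR (2 * th))); apply: cvgB; first exact: cvg_cst.
exact: is_cvg_series_exp_coeff.
Qed.

Lemma kap_conv_tail N x y : (0 < x)%N -> (0 < y)%N ->
  `|kap th x y + \sum_(1 <= z < N.+1) aw th z ^+ 2 / (z%:R + y%:R) * kap th x z
    - (x%:R + y%:R)^-1| <= 2 ^+ x * expR (4 * th) * tail2 N.+1.
Proof.
move=> x0 y0; pose h z := aw th z ^+ 2 / (z%:R + y%:R) * kap th x z.
pose u z := 2 ^+ x * expR (4 * th) * exp_coeff (2 * th) z.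
have hu z : `|h z| <= u z.
  rewrite /h normrM ger0_norm; last by rewrite divr_ge0 ?sqr_ge0 ?addr_ge0.
  apply: (@le_trans _ _ (aw th z ^+ 2 * (2 ^+ x * 2 ^+ z * expR (4 * th)))).
    apply: ler_pM => //; last exact: kap_le.
      by rewrite divr_ge0 ?sqr_ge0 ?addr_ge0.
    rewrite ler_piMr ?sqr_ge0// invf_le1 -?natrD ?ler1n ?ltr0n addn_gt0 y0 orbT//.
  have := aw_sq_le th0 z (ler0n R 2) => H.
  have c0 : 0 <= 2 ^+ x * expR (4 * th) by rewrite mulr_ge0 ?exprn_ge0 ?expR_ge0.
  have := ler_wpM2l c0 H; rewrite /u; lra.
have := series_tail N.+1 hu (is_cvg_expc _ _); rewrite lim_expc -/h => H.
have Eu : series u N.+1 = 2 ^+ x * expR (4 * th) * series (exp_coeff (2 * th)) N.+1.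
  by rewrite /series/= mulr_sumr.
rewrite Eu -mulrBr -/(tail2 _) kap_conv// in H.
have Eh : series h N.+1 = \sum_(1 <= z < N.+1) h z.
  by rewrite /series/= big_ltn// {1}/h aw_sq// !mul0r add0r.
rewrite Eh in H; rewrite distrC; apply: le_trans H.
by rewrite opprD addrA.
Qed.

Lemma sum_aw_sq N : \sum_(1 <= z < N.+1) aw th z ^+ 2 <= expR th.
Proof.
apply: (@le_trans _ _ (series (exp_coeff th) N.+1)); last first.
  apply: series_le_lim; last exact: is_cvg_series_exp_coeff.
  by move=> n; rewrite exp_coeff_ge0'.
rewrite /series/= [leRHS]big_ltn// -[leLHS]add0r lerD ?exp_coeff_ge0'//.
apply: ler_sum => z _; have := aw_sq_le th0 z (ler0n R 1).
by rewrite expr1n !mul1r.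
Qed.

(* [1 + L] is bounded below by [1], so an approximate solution of
   [k (1 + L) = row of L] is close to the exact one. *)
Lemma KN_close N (i j : 'I_N) :
  `|Kpl th (N - i) (N - j) - KN N (aw th) i j| <=
  aw th (N - i) * (2 ^+ (N - i) * expR (4 * th) * tail2 N.+1) * expR th.
Proof.
set x := (N - i)%N; have x0 : (0 < x)%N by rewrite subn_gt0.
have y0 (k : 'I_N) : (0 < N - k)%N by rewrite subn_gt0.
pose k : 'rV[R]_N := \row_j Kpl th x (N - j).
pose d := k - row i (KN N (aw th)).
set E := 2 ^+ x * expR (4 * th) * tail2 N.+1.
have E0 : 0 <= E by rewrite !mulr_ge0 ?exprn_ge0 ?expR_ge0 ?tail2_ge0.
have dr : d *m (1%:M + Lmx N (aw th)) = k *m (1%:M + Lmx N (aw th)) - row i (Lmx N (aw th)).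
  by rewrite mulmxBl -row_mul KN_mul.
have := psd_contract (Lmx_psd (@a0 N)) dr.
set r := k *m _ - _ => H.
have rj j' : r 0 j' ^+ 2 <= (aw th x * E) ^+ 2 * aw th (N - j') ^+ 2.
  have -> : r 0 j' = aw th x * aw th (N - j') * (kap th x (N - j') +
     \sum_(1 <= z < N.+1) aw th z ^+ 2 / (z%:R + (N - j')%N%:R) * kap th x z
      - (x%:R + (N - j')%N%:R)^-1).
    rewrite /r mulmxDr mulmx1 !mxE -sum_ord_rev mulrBr mulrDr mulr_sumr.
    congr (_ + _ - _); apply: eq_bigr => z _; rewrite !mxE /Kpl.
    by ring.
  rewrite -(real_normK (num_real (_ * _))) normrM -exprMn.
  have ax : 0 <= aw th x by exact: aw_ge0.
  have aj : 0 <= aw th (N - j') by exact: aw_ge0.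
  have p1 := mulr_ge0 (mulr_ge0 ax E0) aj.
  rewrite ler_pXn2r ?nnegrE//.
  rewrite (ger0_norm (mulr_ge0 ax aj)) mulrAC.
  apply: ler_wpM2r; first exact: aj.
  apply: ler_wpM2l; first exact: ax.
  exact: kap_conv_tail.
have {}H : d 0 j ^+ 2 <= (aw th x * E * expR th) ^+ 2.
  apply: (@le_trans _ _ (\sum_i d 0 i ^+ 2)).
    rewrite (bigD1 j)//= lerDl sumr_ge0// => *; exact: sqr_ge0.
  apply: le_trans H _; apply: le_trans (ler_sum _ (fun j' _ => rj j')) _.
  rewrite -mulr_sumr (sum_ord_rev N (fun z => aw th z ^+ 2)) [leRHS]exprMn.
  rewrite ler_wpM2l ?sqr_ge0// (le_trans (sum_aw_sq N))//.
  by rewrite expr2 ler_peMr ?expR_ge0// -expR0 ler_expR.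
have -> : Kpl th x (N - j) - KN N (aw th) i j = d 0 j by rewrite !mxE.
have p2 : 0 <= aw th x * E * expR th.
  by apply: mulr_ge0; [apply: mulr_ge0 => //; exact: aw_ge0 | exact: expR_ge0].
by rewrite -ler_sqr ?nnegrE// real_normK ?num_real.
Qed.

(** The lower bound holds because the entry is a ratio of nonnegative sums, the probability of a
    part. For the upper one let w be a row of K. As w + w L is that row of the symmetric L, the
    diagonal entry of K L = L - K is w w^T + w L w^T. *)
Lemma KN_diag N (i : 'I_N) :
  0 <= KN N (aw th) i i <= aw th (N - i) ^+ 2 / (2 * (N - i)%N%:R).
Proof.
set x := (N - i)%N; apply/andP; split.
  pose f (k : 'I_1) := i.
  have fi : injective f by move=> u v _; rewrite !ord1.
  have := det_correlation fi (@a0 N); rewrite det_mx11 mxE => E.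
  have Z0 : 0 < \sum_(l <- sparts N) cweight (aw th) l.
    by rewrite -det_1L ?(lt_le_trans ltr01 (det_1L_ge1 (@a0 N)))//; exact: a0.
  rewrite -(pmulr_rge0 _ Z0) -E sumr_ge0// => l _; exact: cweight_ge0.
pose w := row i (KN N (aw th)).
have := KN_mul N; rewrite mulmxDr mulmx1 => E.
have wE : w + w *m Lmx N (aw th) = row i (Lmx N (aw th)).
  by rewrite -row_mul -raddfD/= E.
have Ls : (Lmx N (aw th))^T = Lmx N (aw th).
  by apply/matrixP => a b; rewrite !mxE [X in X / _]mulrC [X in _ / X]addrC.
have : (KN N (aw th) *m Lmx N (aw th)) i i = (w *m w^T + w *m Lmx N (aw th) *m w^T) 0 0.
  rewrite -[Lmx N (aw th) in RHS]Ls -mulmxA -trmx_mul -mulmxDr -raddfD/= wE.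
  rewrite !mxE; apply: eq_bigr => k _; rewrite !mxE; congr (_ * _).
  by rewrite [X in X / _]mulrC [X in _ / X]addrC.
have := congr1 (fun M : 'M[R]_N => M i i) E; rewrite mxE => E1.
rewrite -[aw th x ^+ 2 / _](_ : Lmx N (aw th) i i = _); last first.
  by rewrite mxE -/x -expr2 -mulr2n -(mulr_natl x%:R).
move=> E2; rewrite -E1 lerDl E2 mxE addr_ge0//; last exact: (Lmx_psd (@a0 N)).
by rewrite rnorm_sum sumr_ge0// => k _; exact: sqr_ge0.
Qed.

Lemma KN_cvg x y (f g : forall N, 'I_N.+1) : (0 < x)%N -> (0 < y)%N ->
  (forall N, (x <= N)%N -> (N.+1 - f N = x)%N) ->
  (forall N, (y <= N)%N -> (N.+1 - g N = y)%N) ->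
  KN N.+1 (aw th) (f N) (g N) @[N --> \oo] --> Kpl th x y.
Proof.
move=> x0 y0 fx gy.
have H : Kpl th x y - KN N.+1 (aw th) (f N) (g N) @[N --> \oo] --> (0 : R).
  have T : aw th x * (2 ^+ x * expR (4 * th)) * expR th * tail2 (N + 2)%N @[N --> \oo] --> (0 : R).
    rewrite -[X in _ --> X](mulr0 (aw th x * (2 ^+ x * expR (4 * th)) * expR th)).
    by apply: cvgM; [exact: cvg_cst | rewrite (cvg_shiftn 2 tail2); exact: tail2_cvg].
  apply: cvg0_le T; near=> N.
  have xN : (x <= N)%N by near: N; exact: nbhs_infty_ge.
  have yN : (y <= N)%N by near: N; exact: nbhs_infty_ge.
  have := KN_close (f N) (g N); rewrite fx// gy// => /le_trans; apply.
  by rewrite addn2 le_eqVlt; apply/orP; left; apply/eqP; ring.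
rewrite (_ : (fun N => KN N.+1 (aw th) (f N) (g N)) = fun N => Kpl th x y -
  (Kpl th x y - KN N.+1 (aw th) (f N) (g N))); last first.
  by apply/funext => N; rewrite subKr.
rewrite -[X in _ --> X]subr0; apply: cvgB; [exact: cvg_cst | exact: H].
Unshelve. all: by end_near. Qed.

Lemma sum_corr_one N (x : nat) : (0 < x <= N)%N -> exists2 i : 'I_N, (N - i)%N = x &
  \sum_(l <- sparts N | x \in l) cweight (aw th) l =
  (\sum_(l <- sparts N) cweight (aw th) l) * KN N (aw th) i i.
Proof.
move=> /andP[x0 xN]; have iN : (N - x < N)%N by lia.
exists (Ordinal iN) => /=; first by rewrite subKn.
pose f (k : 'I_1) := Ordinal iN.
have fi : injective f by move=> u v _; rewrite !ord1.
have := det_correlation fi (@a0 N); rewrite det_mx11 mxE => <-.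
apply: eq_bigl => l; apply/idP/forallP => [xl k|/(_ ord0)] /=; by rewrite subKn.
Qed.

Definition Ztot N := \sum_(l <- sparts N) cweight (aw th) l.

(** Probability of the part [x] in the truncated ensemble, extended by 0 so that it can enter a
    series over all [x]. *)
Definition Kdiag N x : R := if (0 < x <= N)%N then
  (\sum_(l <- sparts N | x \in l) cweight (aw th) l) / Ztot N else 0.

Lemma Ztot_ge1 N : 1 <= Ztot N.
Proof. by rewrite /Ztot -det_1L ?det_1L_ge1//; exact: a0. Qed.

Lemma sum_seq_mem N (l : seq nat) : uniq l ->
  (forall x, x \in l -> (0 < x <= N)%N) ->
  (sumn l)%:R = \sum_(0 <= x < N.+1) x%:R * (x \in l)%:R :> R.
Proof.
move=> ul lN; rewrite sumnE natr_sum.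
rewrite [RHS](bigID (fun x => x \in l))/= [X in _ + X]big1 ?addr0; last first.
  by move=> x /negbTE ->; rewrite mulr0.
rewrite [RHS](eq_bigr (fun x => x%:R)); last by move=> x ->; rewrite mulr1.
rewrite -[RHS]big_filter; apply: perm_big; apply: uniq_perm => //.
  by rewrite filter_uniq// iota_uniq.
move=> x; rewrite mem_filter mem_index_iota/= ltnS; case: (boolP (x \in l)) => // /lN.
by move=> /andP[_ ->].
Qed.

Lemma weighted_size N :
  \sum_(l <- sparts N) (sumn l)%:R * cweight (aw th) l =
  Ztot N * \sum_(0 <= x < N.+1) x%:R * Kdiag N x.
Proof.
have Z0 : Ztot N != 0 by rewrite gt_eqF// (lt_le_trans ltr01 (Ztot_ge1 N)).
transitivity (\sum_(l <- sparts N) \sum_(0 <= x < N.+1)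
    x%:R * ((x \in l)%:R * cweight (aw th) l)).
  rewrite big_seq [in RHS]big_seq; apply: eq_bigr => l lN.
  rewrite (@sum_seq_mem N) ?(strict_uniq (sparts_strict lN))//; last first.
    by move=> x; exact: sparts_le.
  by rewrite mulr_suml; apply: eq_bigr => x _; rewrite mulrA.
rewrite exchange_big/= mulr_sumr; apply: eq_big_nat => x /andP[_ xN].
rewrite -mulr_sumr mulrCA; congr (_ * _).
case: x xN => [|x] xN.
  rewrite /Kdiag/= mulr0 big_seq big1// => l lN.
  case: (boolP (0%N \in l)) => [/(sparts_le lN)//|_]; by rewrite mul0r.
rewrite /Kdiag/= -ltnS xN mulrCA divff// mulr1 [RHS]big_mkcond/=.
by apply: eq_bigr => l _; case: ifP => _; rewrite ?mul1r ?mul0r.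
Qed.

Lemma Kdiag_bound N x : `|x%:R * Kdiag N x| <= exp_coeff th x.
Proof.
rewrite /Kdiag; case: ifPn => xN; last first.
  by rewrite mulr0 normr0 exp_coeff_ge0'.
have [i ix ->] := sum_corr_one xN.
have Z0 : Ztot N != 0 by rewrite gt_eqF// (lt_le_trans ltr01 (Ztot_ge1 N)).
rewrite -/(Ztot N) mulrAC divff// mul1r.
have /andP[k0 k1] := KN_diag i; rewrite ix in k1.
have x0 : 0 < x%:R :> R by rewrite ltr0n; case/andP: xN.
rewrite ger0_norm ?mulr_ge0//; apply: le_trans (ler_wpM2l (ltW x0) k1) _.
have := aw_sq_le th0 x (ler0n R 1); rewrite expr1n !mul1r.
apply: le_trans.
rewrite (_ : _ * (_ / _) = aw th x ^+ 2 / 2); last by field; rewrite gt_eqF.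
by rewrite ler_pdivrMr// ler_peMr ?sqr_ge0// ler1n.
Qed.

Lemma Kdiag_cvg x : Kdiag N x @[N --> \oo] --> (if x is 0%N then 0 else Kpl th x x).
Proof.
case: x => [|x]; first exact: cvg_cst.
rewrite -(cvg_shiftS (fun N => Kdiag N x.+1))/=.
pose f N : 'I_N.+1 := inord (N.+1 - x.+1).
have fx N : (x.+1 <= N)%N -> (N.+1 - f N = x.+1)%N.
  by move=> xN; rewrite /f inordK; lia.
have := KN_cvg (ltn0Sn x) (ltn0Sn x) fx fx; apply: cvg_trans.
apply: near_eq_cvg; near=> N.
have xN : (x.+1 <= N)%N by near: N; exact: nbhs_infty_ge.
have xN' : (0 < x.+1 <= N.+1)%N by move: xN; lia.
rewrite /Kdiag xN'; have [i ix ->] := sum_corr_one xN'.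
have Z0 : Ztot N.+1 != 0 by rewrite gt_eqF// (lt_le_trans ltr01 (Ztot_ge1 _)).
rewrite -/(Ztot _) mulrAC divff// mul1r.
have -> // : f N = i.
apply/val_inj => /=; have := fx _ xN; have := ltn_ord i; have := ltn_ord (f N); lia.
Unshelve. all: by end_near. Qed.

Lemma mean_size_cvg :
  \sum_(0 <= x < N.+1) x%:R * Kdiag N x @[N --> \oo] --> th / 2.
Proof.
rewrite -Kpl_trace//.
have -> : limn (series (fun x => x%:R * Kpl th x x)) =
  limn (series (fun x => x%:R * (if x is 0%N then 0 else Kpl th x x))).
  by congr (limn (series _)); apply/funext => -[|x]//; rewrite !mul0r.
rewrite [X in X @ _ --> _](_ : _ = fun N => limn (series (fun x => x%:R * Kdiag N x))).
  apply: (@tannery R _ \oo _ _ _ (exp_coeff th)).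
  - exact: is_cvg_series_exp_coeff.
  - by apply: nearW => N x; exact: Kdiag_bound.
  - by move=> x; apply: cvgM; [exact: cvg_cst | exact: Kdiag_cvg].
apply/funext => N; rewrite (@cvgn_limn _ _ _ (@limn_series_fin _ _ N.+1 _))//.
move=> x xN; by rewrite /Kdiag [(x <= N)%N]leqNgt xN andbF mulr0.
Qed.

End finite_approximation.

(** * The total mass by comparison of coefficients in theta *)

Section total_mass.
Context {R : realType}.

Definition pweight (l : seq nat) : R :=
  \prod_(x <- l) (2 * factR x ^+ 2)^-1 * pairs l.

Lemma pweight_ge0 l : 0 <= pweight l.
Proof.
by rewrite mulr_ge0 ?pairs_ge0// prodr_ge0// => x _; rewrite invr_ge0 mulr_ge0 ?sqr_ge0.
Qed.

Lemma cweight_pweight (th : R) N l : 0 < th -> l \in sparts N ->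
  cweight (aw th) l = th ^+ sumn l * pweight l.
Proof.
move=> th0 lN; rewrite /cweight /pweight mulrA; congr (_ * _).
have : {in l, forall x, (0 < x)%N} by move=> x /(sparts_le lN)/andP[].
elim: l {lN} => [|x l IH] lx; first by rewrite !big_nil expr0 mul1r.
rewrite !big_cons IH; last by move=> y yl; apply: lx; rewrite inE yl orbT.
have x0 : x%:R != 0 :> R by rewrite pnatr_eq0 -lt0n lx// mem_head.
rewrite /= exprD aw_sq//; have := factR_neq0 x => f0.
by field; rewrite -/(factR x) x0 f0.
Qed.

Definition subsum (v : nat -> R) N := \sum_(l <- sparts N) \prod_(x <- l) v x.

Lemma subsumE v N : subsum v N = \prod_(1 <= x < N.+1) (1 + v x).
Proof.
elim: N => [|N IH]; first by rewrite /subsum big_seq1 big_nil big_geq.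
rewrite /subsum/= big_cat/= big_map -/(subsum v N) big_nat_recr//= -IH mulrDr mulr1.
by congr (_ + _); rewrite /subsum mulr_suml; apply: eq_bigr => l _; rewrite big_cons mulrC.
Qed.

Lemma subsum_le (v : nat -> R) N : (forall x, 0 <= v x) -> cvgn (series v) ->
  subsum v N <= expR (limn (series v)).
Proof.
move=> v0 cv; rewrite subsumE.
apply: (@le_trans _ _ (\prod_(1 <= x < N.+1) expR (v x))).
  by apply: ler_prod => x _; rewrite expR_ge1Dx addr_ge0.
rewrite -expR_sum ler_expR; apply: (le_trans _ (series_le_lim N.+1 v0 cv)).
by rewrite /series/= [leRHS]big_ltn// lerDr.
Qed.

(** Pair factors are at most 1, and a sum of products over all sets of parts is a product of factors
    1 + v(x) <= exp(v(x)). The uniformity in [N] makes the limiting series in theta converge. *)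
Lemma Ztot_le (th : R) N : 0 < th -> Ztot th N <= expR (expR th).
Proof.
move=> th0; apply: le_trans (@subsum_le (exp_coeff th) N _ _); last first.
- exact: is_cvg_series_exp_coeff.
- by move=> x; apply: exp_coeff_ge0'; exact: ltW.
apply: ler_sum => l _; rewrite /cweight.
have P0 : 0 <= \prod_(x <- l) (aw th x ^+ 2 / (2 * x%:R)).
  by apply: prodr_ge0 => x _; rewrite divr_ge0 ?sqr_ge0.
apply: le_trans (ler_piMr P0 (pairs_le1 _)) _.
apply: ler_prod => x _; rewrite divr_ge0 ?sqr_ge0//=.
have := aw_sq_le th0 x (ler0n R 1); rewrite expr1n !mul1r; apply: le_trans.
case: x => [|x]; first by rewrite mulr0 invr0 mulr0 sqr_ge0.
by rewrite ler_pdivrMr// ler_peMr ?sqr_ge0// -natrM ler1n.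
Qed.

Definition zcoef N n : R := \sum_(l <- sparts N | sumn l == n) pweight l.

(** Runs over all strict partitions of [n], since their parts do not exceed [n]. *)
Definition zlim n : R := zcoef n n.

Lemma zcoefS N n : (n <= N)%N -> zcoef N.+1 n = zcoef N n.
Proof.
move=> nN; rewrite /zcoef/= big_cat/= big_map [X in _ + X]big1 ?addr0//.
by move=> l /eqP E; move: nN; rewrite -E /= -ltnS; lia.
Qed.

Lemma zcoef_stable N n : (n <= N)%N -> zcoef N n = zlim n.
Proof.
move=> nN; rewrite -(subnKC nN); elim: (N - n)%N => [|k IH]; first by rewrite addn0.
by rewrite addnS zcoefS ?IH// leq_addr.
Qed.

Lemma zcoef_ge0 N n : 0 <= zcoef N n.
Proof. by apply: sumr_ge0 => l _; exact: pweight_ge0. Qed.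

Lemma zcoef_le N n : zcoef N n <= zlim n.
Proof.
have [nN|/ltnW nN] := leqP n N; first by rewrite zcoef_stable.
rewrite /zlim -(subnKC nN); move: {1 3}(n) => m.
elim: (n - N)%N => [|k IH]; first by rewrite addn0.
apply: le_trans IH _; rewrite addnS /zcoef/= big_cat/= lerDl.
by apply: sumr_ge0 => l _; exact: pweight_ge0.
Qed.

Lemma sum_by_size N B (G : nat -> R) :
  (forall l, l \in sparts N -> (sumn l < B)%N) ->
  \sum_(l <- sparts N) G (sumn l) * pweight l = \sum_(0 <= n < B) G n * zcoef N n.
Proof.
move=> lB; under [RHS]eq_bigr do rewrite mulr_sumr big_mkcond.
rewrite exchange_big/= big_seq [in RHS]big_seq; apply: eq_bigr => l lN.
rewrite -big_mkcond/= (eq_bigl (fun n => n == sumn l)); last by move=> n; rewrite eq_sym.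
rewrite big_mkcond/= (bigD1_seq (sumn l)) ?iota_uniq ?mem_index_iota ?lB//= eqxx.
by rewrite big1 ?addr0// => n /negbTE ->.
Qed.

Lemma sumn_bound N : exists B, forall l, l \in sparts N -> (sumn l < B)%N.
Proof.
exists (\sum_(l <- sparts N) sumn l).+1 => l lN.
by rewrite ltnS (big_rem l)//= leq_addr.
Qed.

Lemma sum_by_size_series N (G : nat -> R) :
  \sum_(l <- sparts N) G (sumn l) * pweight l = limn (series (fun n => G n * zcoef N n)).
Proof.
have [B HB] := sumn_bound N; rewrite (sum_by_size _ HB); apply/esym/cvgn_limn.
apply: limn_series_fin => n Bn; rewrite /zcoef big_seq_cond big1 ?mulr0//.
by move=> l /andP[/HB lB /eqP E]; move: lB; rewrite E ltnNge Bn.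
Qed.

Lemma Ztot_series (th : R) N : 0 < th ->
  Ztot th N = limn (series (fun n => th ^+ n * zcoef N n)).
Proof.
move=> th0; rewrite -sum_by_size_series /Ztot big_seq [RHS]big_seq.
by apply: eq_bigr => l lN; rewrite (cweight_pweight th0 lN).
Qed.

Lemma is_cvg_zlim (th : R) : 0 < th -> cvgn (series (fun n => th ^+ n * zlim n)).
Proof.
move=> th0.
have t0 n : 0 <= th ^+ n * zlim n by rewrite mulr_ge0 ?exprn_ge0 ?zcoef_ge0// ltW.
apply: nondecreasing_is_cvgn; first by apply: nondecreasing_series => n _ _.
exists (expR (expR th)) => _ [M _ <-].
apply: le_trans (Ztot_le M th0); rewrite Ztot_series//.
have -> : series (fun n => th ^+ n * zlim n) M = series (fun n => th ^+ n * zcoef M n) M.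
  by apply: eq_big_nat => n /andP[_ nM]; rewrite zcoef_stable// ltnW.
apply: series_le_lim => [n|]; first by rewrite mulr_ge0 ?exprn_ge0 ?zcoef_ge0// ltW.
have [B HB] := sumn_bound M; apply/cvg_ex.
exists (\sum_(0 <= n < B) th ^+ n * zcoef M n).
apply: limn_series_fin => n Bn; rewrite /zcoef big_seq_cond big1 ?mulr0//.
by move=> l /andP[/HB lB /eqP E]; move: lB; rewrite E ltnNge Bn.
Qed.

Lemma is_cvg_nzlim (th : R) : 0 < th -> cvgn (series (fun n => n%:R * th ^+ n * zlim n)).
Proof.
move=> th0; have th2 : 0 < 2 * th by rewrite mulr_gt0.
have t0 n : 0 <= th ^+ n * zlim n by rewrite mulr_ge0 ?exprn_ge0 ?zcoef_ge0// ltW.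
apply: abs_cvg_series (is_cvg_zlim th2) => n.
rewrite -mulrA ger0_norm; last by apply: mulr_ge0.
rewrite exprMn -[leRHS]mulrA ler_wpM2r//.
by rewrite -natrX ler_nat ltnW// ltn_expl.
Qed.

Lemma Ztot_cvg (th : R) : 0 < th ->
  Ztot th N @[N --> \oo] --> limn (series (fun n => th ^+ n * zlim n)).
Proof.
move=> th0; under eq_fun do rewrite Ztot_series//.
apply: tannery (is_cvg_zlim th0) _ _.
  apply: nearW => N n; rewrite ger0_norm ?mulr_ge0 ?exprn_ge0 ?zcoef_ge0 ?(ltW th0)//.
  by rewrite ler_wpM2l ?exprn_ge0 ?zcoef_le// (ltW th0).
move=> n; apply: cvgM; first exact: cvg_cst.
apply: cvg_near_cst; near=> N; rewrite zcoef_stable//.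
by near: N; exact: nbhs_infty_ge.
Unshelve. all: by end_near. Qed.

(* Both sides are the limit of the unnormalised mean of the size: the left one
   summed over partitions, the right one through the diagonal of the kernel. *)
Lemma zlim_eq (th : R) : 0 < th ->
  limn (series (fun n => n%:R * th ^+ n * zlim n)) =
  th / 2 * limn (series (fun n => th ^+ n * zlim n)).
Proof.
move=> th0.
have H1 : Ztot th N * \sum_(0 <= x < N.+1) x%:R * Kdiag th N x @[N --> \oo] -->
    limn (series (fun n => th ^+ n * zlim n)) * (th / 2).
  by apply: cvgM; [exact: Ztot_cvg | exact: mean_size_cvg].
rewrite mulrC -(cvgn_limn H1); apply/esym/cvgn_limn.
rewrite [X in X @ _ --> _](_ : _ = fun N =>
   limn (series (fun n => n%:R * th ^+ n * zcoef N n))); last first.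
  apply/funext => N; rewrite -weighted_size// -sum_by_size_series.
  rewrite big_seq [RHS]big_seq.
  by apply: eq_bigr => l lN; rewrite (cweight_pweight th0 lN) mulrA.
apply: tannery (is_cvg_nzlim th0) _ _.
  apply: nearW => N n.
  rewrite ger0_norm ?mulr_ge0 ?exprn_ge0 ?zcoef_ge0 ?(ltW th0)//.
  by rewrite ler_wpM2l ?zcoef_le// mulr_ge0 ?exprn_ge0 ?(ltW th0).
move=> n; apply: cvgM; first exact: cvg_cst.
apply: cvg_near_cst; near=> N; rewrite zcoef_stable//.
by near: N; exact: nbhs_infty_ge.
Unshelve. all: by end_near. Qed.

(** [zlim_eq] reads theta Z' = theta Z / 2 for the generating function Z of [zlim], and coefficients
    of power series are unique. *)
Lemma zlim_rec n : n.+1%:R * zlim n.+1 = zlim n / 2.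
Proof.
pose c m : R := if m is k.+1 then k.+1%:R * zlim k.+1 - zlim k / 2 else 0.
have z0 m : 0 <= zlim m by exact: zcoef_ge0.
have E (t : R) : 0 < t -> series (fun m => c m * t ^+ m) @ \oo --> (0 : R).
  move=> t0.
  have C1 : series (fun m => m%:R * t ^+ m * zlim m) n0.+1 @[n0 --> \oo] -->
     t / 2 * limn (series (fun n => t ^+ n * zlim n)).
    by rewrite (cvg_shiftS (series _)) -zlim_eq//; exact: is_cvg_nzlim.
  have C2 : t / 2 * series (fun m => t ^+ m * zlim m) n0 @[n0 --> \oo] -->
     t / 2 * limn (series (fun n => t ^+ n * zlim n)).
    by apply: cvgM; [exact: cvg_cst | exact: is_cvg_zlim].
  have C : series (fun m => m%:R * t ^+ m * zlim m) N.+1 -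
     t / 2 * series (fun m => t ^+ m * zlim m) N @[N --> \oo] --> (0 : R).
    rewrite -(subrr (t / 2 * limn (series (fun n => t ^+ n * zlim n)))).
    by apply: cvgB; [exact: C1 | exact: C2].
  rewrite -(cvg_shiftS (series _)); apply: cvg_trans C.
  apply: near_eq_cvg; apply: nearW => N; apply/esym; rewrite /series/= big_nat_recl// mul0r add0r.
  rewrite [in RHS]big_nat_recl// !mul0r add0r mulr_sumr -sumrB.
  by apply: eq_bigr => i _; rewrite /c exprS; ring.
have cc : cvgn (series (fun m => `|c m|)).
  have I1 := is_cvg_nzlim (@ltr01 R).
  have I2 := is_cvg_zlim (@ltr01 R).
  apply: is_cvg_seriesSV.
  apply: (@abs_cvg_series _ _ (fun m => m.+1%:R * zlim m.+1 + zlim m)).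
    move=> m; rewrite normr_id (le_trans (ler_normB _ _))// ger0_norm ?mulr_ge0//.
    by rewrite ger0_norm ?divr_ge0// lerD2l ler_pdivrMr// ler_peMr// ler1n.
  have -> : (fun m => m.+1%:R * zlim m.+1 + zlim m) =
    (fun m => m.+1%:R * 1 ^+ m.+1 * zlim m.+1) + (fun m => 1 ^+ m * zlim m).
    by apply/funext => m; rewrite fctE !expr1n mulr1 mul1r.
  rewrite seriesD; apply: is_cvgD => //.
  exact: (is_cvg_seriesS I1).
have := pseries_uniq cc (fun t t01 => cvgn_limn (E t (proj1 (andP t01)))) n.+1.
by rewrite /c => /eqP; rewrite subr_eq0 => /eqP.
Qed.

(** Equivalent to Schur's identity: 2^(n - ell) g^2 sums to n! over the strict partitions of n,
    where ell counts the parts and g the shifted standard tableaux. *)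
Lemma zlimE n : zlim n = 2^-1 ^+ n / factR n.
Proof.
elim: n => [|n IH].
  by rewrite /zlim /zcoef/= big_cons big_nil/= addr0 /pweight big_nil expr0 /factR fact0 divr1 mul1r.
have n0 : n.+1%:R != 0 :> R by rewrite pnatr_eq0.
apply: (mulfI n0); rewrite zlim_rec IH factRS exprSr.
move: (n.+1%:R : R) n0 (factR n) (@factR_neq0 R n) => a a0 b b0.
by field; rewrite a0 b0.
Qed.

Lemma Ztot_cvg_exp (th : R) : 0 < th -> Ztot th N @[N --> \oo] --> expR (th / 2).
Proof.
move=> th0; have := Ztot_cvg th0; congr (_ --> _).
congr (limn (series _)); apply/funext => n.
by rewrite zlimE /exp_coeff/= exprMn mulrA.
Qed.

End total_mass.

(** * Gamma on the positive reals from monotone Gauss products *)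

Section real_gamma.
Context {R : realType}.
Implicit Types (x y : R) (n : nat).

Definition rgauss x n : R :=
  n`!%:R * expR (x * ln n%:R) / \prod_(0 <= j < n.+1) (x + j%:R).

Lemma expC_real x : expC x%:C%C = (expR x)%:C%C :> R[i].
Proof. by rewrite /expC /= cos0 sin0 mulr1 mulr0. Qed.

Lemma gauss_Gamma_real x n : gauss_Gamma x%:C%C n = (rgauss x n)%:C%C.
Proof.
rewrite /gauss_Gamma /rgauss -rmorphM /= expC_real big_mkord fmorph_div !rmorphM.
rewrite rmorph_nat rmorph_prod; congr (_ / _); apply: eq_bigr => j _.
by rewrite rmorphD/= rmorph_nat.
Qed.

Lemma rGammaE x : rGamma x = limn (rgauss x).
Proof.
rewrite /rGamma /Gamma /=; congr (limn _); apply/funext => n.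
by rewrite gauss_Gamma_real.
Qed.

Lemma prod_shift_gt0 x n : 0 < x -> 0 < \prod_(0 <= j < n) (x + j%:R).
Proof. by move=> x0; apply: prodr_gt0 => j _; rewrite ltr_wpDr. Qed.

Lemma rgauss_gt0 x n : 0 < x -> 0 < rgauss x n.
Proof.
by move=> x0; rewrite divr_gt0 ?mulr_gt0 ?expR_gt0 ?prod_shift_gt0// ltr0n fact_gt0.
Qed.

Lemma rgaussS x n : 0 < x -> rgauss x n.+1 =
  rgauss x n * (n.+1%:R * expR (x * (ln n.+1%:R - ln n%:R)) / (x + n.+1%:R)).
Proof.
move=> x0; rewrite /rgauss factS natrM [in LHS]big_nat_recr//= mulrBr expRB.
have := prod_shift_gt0 n.+1 x0; have := expR_gt0 (x * ln n%:R).
have : 0 < x + n.+1%:R by rewrite ltr_wpDr.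
move: (\prod_(0 <= i < _) _) (expR _) (expR _) (_ + _) => a b c d.
by move=> /gt_eqF d0 /gt_eqF c0 /gt_eqF a0; field; rewrite d0 c0 a0.
Qed.

Lemma ln_incr_ge n : (0 < n)%N -> n.+1%:R^-1 <= ln n.+1%:R - ln n%:R :> R.
Proof.
move=> n0; have n0' : 0 < n%:R :> R by rewrite ltr0n.
have n1 : 0 < n.+1%:R :> R by rewrite ltr0n.
rewrite -opprB lerNr -ln_div ?posrE//.
have -> : n%:R / n.+1%:R = 1 + - n.+1%:R^-1 :> R.
  by rewrite -natr1; field; rewrite natr1 gt_eqF.
by apply: le_ln1Dx; rewrite ltrN2 invf_lt1// ltr1n.
Qed.

Lemma ln_incr_le n : (0 < n)%N -> ln n.+1%:R - ln n%:R <= n%:R^-1 :> R.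
Proof.
move=> n0; have n0' : 0 < n%:R :> R by rewrite ltr0n.
rewrite -ln_div ?posrE//.
have -> : n.+1%:R / n%:R = 1 + n%:R^-1 :> R.
  by rewrite -natr1; field; rewrite gt_eqF.
by apply: le_ln1Dx; rewrite (@lt_le_trans _ _ 0)// ltrN10.
Qed.

Lemma rgauss_incr x n : 0 < x -> (0 < n)%N -> rgauss x n <= rgauss x n.+1.
Proof.
move=> x0 n0; rewrite rgaussS// ler_peMr ?(ltW (rgauss_gt0 _ _))//.
have d0 : 0 < x + n.+1%:R by rewrite ltr_wpDr.
have n1 : 0 < n.+1%:R :> R by rewrite ltr0n.
rewrite ler_pdivlMr// mul1r.
apply: (@le_trans _ _ (n.+1%:R * expR (x / n.+1%:R))).
  have -> : x + n.+1%:R = n.+1%:R * (1 + x / n.+1%:R) by field; rewrite gt_eqF.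
  by rewrite ler_pM2l// expR_ge1Dx.
by rewrite ler_pM2l// ler_expR ler_wpM2l ?(ltW x0)// ln_incr_ge.
Qed.

(** The correction turns the increasing Gauss products into a decreasing sequence with the same
    limit. Its exponent comes from one step of the product, whose logarithm grows by at most x / n -
    x / (x + n + 1) = x (x + 1) / (n (x + n + 1)). *)
Definition rgaussU x n : R := rgauss x n * expR (x * (x + 1) / n%:R).

Lemma rgaussU_decr x n : 0 < x -> (0 < n)%N -> rgaussU x n.+1 <= rgaussU x n.
Proof.
move=> x0 n0; rewrite /rgaussU rgaussS// -[leLHS]mulrA (ler_pM2l (rgauss_gt0 n x0)).
have d0 : 0 < x + n.+1%:R by rewrite ltr_wpDr.
have n0' : 0 < n%:R :> R by rewrite ltr0n.
have n1 : 0 < n.+1%:R :> R by rewrite ltr0n.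
have L : n.+1%:R / (x + n.+1%:R) <= expR (- (x / (x + n.+1%:R))).
  have -> : n.+1%:R / (x + n.+1%:R) = 1 + - (x / (x + n.+1%:R)).
    by move: (n.+1%:R) d0 => a /gt_eqF d0; field; rewrite d0.
  exact: expR_ge1Dx.
have U : expR (x * (ln n.+1%:R - ln n%:R)) <= expR (x / n%:R).
  by rewrite ler_expR ler_wpM2l ?(ltW x0)// ln_incr_le.
rewrite -[X in X * _ <= _](_ : expR (x * (ln n.+1%:R - ln n%:R)) *
  (n.+1%:R / (x + n.+1%:R)) = _); last by rewrite [LHS]mulrA [_ * n.+1%:R]mulrC.
apply: le_trans (ler_wpM2r (expR_ge0 _) (ler_pM (expR_ge0 _) _ U L)) _.
  by rewrite divr_ge0// ltW.
rewrite -!expRD ler_expR -subr_ge0.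
have -> : x * (x + 1) / n%:R -
   (x / n%:R + - (x / (x + n.+1%:R)) + x * (x + 1) / n.+1%:R) =
   x * (x + 1) / n%:R * (n.+1%:R^-1 - (x + n.+1%:R)^-1).
  by rewrite -natr1; field; rewrite natr1 !gt_eqF.
apply: mulr_ge0; first by rewrite divr_ge0 ?mulr_ge0 ?addr_ge0 ?(ltW x0).
by rewrite subr_ge0 lef_pV2 ?posrE// lerDr ltW.
Qed.

Lemma rgauss_le_U x n m : 0 < x -> (0 < n)%N -> (0 < m)%N -> rgauss x n <= rgaussU x m.
Proof.
move=> x0 n0 m0.
have mono a b : (0 < a)%N -> rgauss x a <= rgauss x (a + b).
  move=> a0; elim: b => [|b IH]; first by rewrite addn0.
  by rewrite addnS (le_trans IH)// rgauss_incr// addn_gt0 a0.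
have monoU a b : (0 < a)%N -> rgaussU x (a + b) <= rgaussU x a.
  move=> a0; elim: b => [|b IH]; first by rewrite addn0.
  by rewrite addnS (le_trans _ IH)// rgaussU_decr// addn_gt0 a0.
apply: le_trans (mono n m n0) _; rewrite addnC.
apply: le_trans (monoU m n m0).
rewrite /rgaussU ler_peMr ?(ltW (rgauss_gt0 _ _))// -expR0 ler_expR.
by rewrite divr_ge0// mulr_ge0 ?addr_ge0// ltW.
Qed.

Lemma rgauss_cvg x : 0 < x -> rgauss x @ \oo --> rGamma x.
Proof.
move=> x0; rewrite rGammaE.
suff : cvgn (rgauss x) by [].
suff H : cvgn (fun n => rgauss x n.+1).
  by apply/cvg_ex; exists (limn (fun n => rgauss x n.+1)); rewrite -(cvg_shiftS (rgauss x)).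
apply: nondecreasing_is_cvgn.
  by apply/nondecreasing_seqP => n; exact: rgauss_incr.
by exists (rgaussU x 1) => _ [n _ <-]; exact: rgauss_le_U.
Qed.

Lemma rgauss_le x n : 0 < x -> (0 < n)%N -> rgauss x n <= rGamma x.
Proof.
move=> x0 n0; rewrite -(cvgn_limn (rgauss_cvg x0)).
apply: limr_ge; first exact: cvgP (rgauss_cvg x0).
near=> m; have nm : (n <= m)%N by near: m; exact: nbhs_infty_ge.
rewrite -(subnKC nm); elim: (m - n)%N => [|k IH]; first by rewrite addn0.
by rewrite addnS (le_trans IH)// rgauss_incr// addn_gt0 n0.
Unshelve. all: by end_near. Qed.

Lemma rgaussU_ge x n : 0 < x -> (0 < n)%N -> rGamma x <= rgaussU x n.
Proof.
move=> x0 n0; rewrite -(cvgn_limn (rgauss_cvg x0)).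
apply: limr_le; first exact: cvgP (rgauss_cvg x0).
near=> m; apply: rgauss_le_U => //.
by near: m; exact: nbhs_infty_gt.
Unshelve. all: by end_near. Qed.

Lemma rGamma_gt0 x : 0 < x -> 0 < rGamma x.
Proof. by move=> x0; apply: lt_le_trans (rgauss_le x0 (ltn0Sn 0)); exact: rgauss_gt0. Qed.

Lemma cvg_natratio x : 0 < x -> n%:R / (x + n.+1%:R) @[n --> \oo] --> (1 : R).
Proof.
move=> x0.
have H : (x + 1) * (n.+1%:R)^-1 @[n --> \oo] --> (0 : R).
  rewrite -[X in _ --> X](mulr0 (x + 1)); apply: cvgM; first exact: cvg_cst.
  exact: cvg_harmonic.
have H2 : 1 - n%:R / (x + n.+1%:R) @[n --> \oo] --> (0 : R).
  apply: cvg0_le H; apply: nearW => n.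
  have d0 : 0 < x + n.+1%:R by rewrite ltr_wpDr.
  have -> : 1 - n%:R / (x + n.+1%:R) = (x + 1) / (x + n.+1%:R).
    by rewrite -natr1; field; rewrite natr1 gt_eqF.
  rewrite ger0_norm; last by rewrite divr_ge0 ?addr_ge0 ?ltW.
  by rewrite ler_wpM2l ?addr_ge0 ?(ltW x0)// lef_pV2 ?posrE// lerDr ltW.
rewrite (_ : (fun n => n%:R / (x + n.+1%:R)) = fun n => 1 - (1 - n%:R / (x + n.+1%:R))).
  by rewrite -[X in _ --> X]subr0; apply: cvgB; [exact: cvg_cst | exact: H2].
by apply/funext => n; rewrite subKr.
Qed.

Lemma rGammaS x : 0 < x -> rGamma (x + 1) = x * rGamma x.
Proof.
move=> x0; have x1 : 0 < x + 1 by rewrite addr_gt0.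
have H : x * (rgauss x n * (n%:R / (x + n.+1%:R))) @[n --> \oo] --> x * (rGamma x * 1).
  apply: cvgM; first exact: cvg_cst.
  by apply: cvgM; [exact: rgauss_cvg | exact: cvg_natratio].
rewrite mulr1 in H; rewrite -(cvgn_limn H) -(cvgn_limn (rgauss_cvg x1)).
apply: cvgn_limn; rewrite (cvgn_limn H); apply: cvg_trans H.
apply: near_eq_cvg; near=> n.
have n0 : (0 < n)%N by near: n; exact: nbhs_infty_gt.
rewrite /rgauss mulrDl mul1r expRD lnK ?posrE ?ltr0n//.
rewrite [in RHS]big_nat_recr// [in LHS]big_nat_recl//= addr0.
have -> : \prod_(0 <= i < n) (x + 1 + i%:R) = \prod_(0 <= i < n) (x + i.+1%:R).
  by apply: eq_bigr => i _; rewrite -natr1 addrAC addrA.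
have P0 : \prod_(0 <= i < n) (x + i.+1%:R) != 0.
  by rewrite gt_eqF// prodr_gt0// => i _; rewrite ltr_wpDr.
have d0 : x + n.+1%:R != 0 by rewrite gt_eqF// ltr_wpDr.
rewrite -addrA -[1 + _]addrC natr1.
move: (\prod_(0 <= i < n) _) P0 (expR _) (_ + n.+1%:R) d0 => P P0 e d d0.
by field; rewrite P0 d0 gt_eqF.
Unshelve. all: by end_near. Qed.

Lemma rGamma1 : rGamma 1 = 1 :> R.
Proof.
rewrite -(cvgn_limn (rgauss_cvg ltr01)); apply: cvgn_limn.
have H : 1 - n.+1%:R^-1 @[n --> \oo] --> (1 : R).
  by rewrite -[X in _ --> X]subr0; apply: cvgB; [exact: cvg_cst | exact: cvg_harmonic].
apply: cvg_trans H; apply: near_eq_cvg; near=> n.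
have n0 : (0 < n)%N by near: n; exact: nbhs_infty_gt.
rewrite /rgauss mul1r lnK ?posrE ?ltr0n//.
have -> : \prod_(0 <= j < n.+1) (1 + j%:R) = n.+1`!%:R :> R.
  elim: n.+1 => [|m IH]; first by rewrite big_geq.
  by rewrite big_nat_recr//= IH factS natrM nat1r mulrC.
rewrite factS natrM -natr1.
have f0 : n`!%:R != 0 :> R by rewrite pnatr_eq0 -lt0n fact_gt0.
have n1 : n%:R + 1 != 0 :> R by rewrite natr1 pnatr_eq0.
by move: (n`!%:R) f0 => f f0; field; rewrite f0 n1.
Unshelve. all: by end_near. Qed.

Lemma rGamma_nat n : rGamma n.+1%:R = n`!%:R :> R.
Proof.
elim: n => [|n IH]; first exact: rGamma1.
by rewrite -natr1 rGammaS// IH factS natrM.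
Qed.

Lemma rgauss_continuous x n : 0 < x -> {for x, continuous (rgauss ^~ n)}.
Proof.
move=> x0; apply: cvgM.
  apply: cvgM; first exact: cvg_cst.
  apply: (@continuous_comp _ _ _ (fun y => y * ln n%:R) expR); last exact: continuous_expR.
  by apply: cvgM; [exact: cvg_id | exact: cvg_cst].
apply: cvgV; first by rewrite gt_eqF// prod_shift_gt0.
elim: n.+1 => [|m IH].
  by rewrite big_geq//; under eq_fun do rewrite big_geq//; exact: cvg_cst.
rewrite big_nat_recr//=; under eq_fun do rewrite big_nat_recr//=.
apply: cvgM; first exact: IH.
by apply: cvgD; [exact: cvg_id | exact: cvg_cst].
Qed.

Lemma rgaussU_continuous x n : 0 < x -> {for x, continuous (rgaussU ^~ n)}.
Proof.
move=> x0; apply: cvgM; first exact: rgauss_continuous.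
apply: (@continuous_comp _ _ _ (fun y => y * (y + 1) / n%:R) expR); last exact: continuous_expR.
apply: cvgM; last exact: cvg_cst.
by apply: cvgM; [exact: cvg_id | apply: cvgD; [exact: cvg_id | exact: cvg_cst]].
Qed.

Lemma rgaussU_cvg x : 0 < x -> rgaussU x @ \oo --> rGamma x.
Proof.
move=> x0; rewrite -[X in _ --> X](mulr1); apply: cvgM; first exact: rgauss_cvg.
have Z : x * (x + 1) * n.+1%:R^-1 @[n --> \oo] --> x * (x + 1) * (0 : R).
  by apply: cvgM; [exact: cvg_cst | exact: cvg_harmonic].
rewrite mulr0 (cvg_shiftS (fun n => x * (x + 1) / n%:R)) in Z.
rewrite -[X in _ --> X]expR0; apply: continuous_cvg => //.
exact: continuous_expR.
Qed.

(** One large [n] suffices: near [x] the function lies between [rgauss] and [rgaussU], both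
    continuous and both close to its value at [x]. *)
Lemma rGamma_continuous x : 0 < x -> {for x, continuous (@rGamma R)}.
Proof.
move=> x0; apply/cvgrPdist_lt => e e0.
have /cvgrPdist_lt /(_ _ e0) [n1 _ H1] := rgauss_cvg x0.
have /cvgrPdist_lt /(_ _ e0) [n2 _ H2] := rgaussU_cvg x0.
pose n := (maxn n1 n2).+1.
have {}H1 := H1 n (leqW (leq_maxl _ _)); have {}H2 := H2 n (leqW (leq_maxr _ _)).
rewrite /= in H1 H2.
pose d := Num.min (e - `|rGamma x - rgauss x n|) (e - `|rGamma x - rgaussU x n|).
have d0 : 0 < d by rewrite /d lt_min !subr_gt0 H1 H2.
have /cvgrPdist_lt /(_ _ d0) C1 := rgauss_continuous (n := n) x0.
have /cvgrPdist_lt /(_ _ d0) C2 := rgaussU_continuous (n := n) x0.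
near=> y.
have y0 : 0 < y by near: y; exact: lt_nbhsr.
have L := rgauss_le y0 (ltn0Sn _ : (0 < n)%N).
have U := rgaussU_ge y0 (ltn0Sn _ : (0 < n)%N).
have E1 : `|rgauss x n - rgauss y n| < d by near: y.
have E2 : `|rgaussU x n - rgaussU y n| < d by near: y.
move: E1 E2; rewrite /d !lt_min => /andP[E1 _] /andP[_ E2].
move: E1 E2 H1 H2 L U; rewrite !ltrBrDr.
move: (rgauss x n) (rgauss y n) (rgaussU x n) (rgaussU y n) (rGamma x) (rGamma y).
move=> a b c f g h E1 E2 _ _ bh hf.
have D1 : `|g - b| < e.
  by apply: le_lt_trans (ler_distD a _ _) _; rewrite addrC.
have D2 : `|g - f| < e.
  by apply: le_lt_trans (ler_distD c _ _) _; rewrite addrC.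
by move: D1 D2; rewrite !ltr_norml; lra.
Unshelve. all: by end_near. Qed.

End real_gamma.

(** * Christoffel-Darboux summation for a function with a three-term recurrence *)

Section christoffel_darboux.
Context {R : realType} (s : R) (J : R -> R).
Implicit Types x y : R.
(** Orders start at 1/2 rather than 1 so that a neighbourhood of the order 1 is covered, while k - 1
    stays above -1, where the Gamma values of the Bessel series have positive arguments. *)
Context (Jrec : forall k, 2^-1 <= k -> s * J (k - 1) = k * J k - s * J (k + 1))
  (Jvan : forall x, 0 <= x -> J (m%:R + x) @[m --> \oo] --> (0 : R)).

Definition Abes x y : R := s * J (x - 1) * J y -
   s * J (y - 1) * J x - 2^-1 * (x - y) * J x * J y.

(** The recurrence eliminates J(x - 1) and J(y - 1) and produces (x - y) J(x) J(y). The correction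
    -(x - y) J(x) J(y) / 2 shares this term evenly between neighbouring steps, which explains the
    half weight at m = 0. *)
Lemma Abes_rec x y : 2^-1 <= x -> 2^-1 <= y -> Abes x y =
  (x - y) * (2^-1 * (J x * J y) +
             2^-1 * (J (x + 1) * J (y + 1))) + Abes (x + 1) (y + 1).
Proof.
move=> x1 y1; rewrite /Abes !addrK (Jrec x1) (Jrec y1).
move: (J x) (J y) (J (x + 1)) (J (y + 1)) => a b c d.
by field.
Qed.

Definition bsum x y (m : nat) : R :=
  (2^-1) ^+ (m == 0%N) * J (m%:R + x) * J (m%:R + y).

Lemma Abes_sum M x y : 2^-1 <= x -> 2^-1 <= y -> Abes x y =
  (x - y) * (series (bsum x y) M.+1 -
     2^-1 * (J (M%:R + x) * J (M%:R + y))) + Abes (M%:R + x) (M%:R + y).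
Proof.
move=> x1 y1; elim: M => [|M IH].
  by rewrite /series/= big_nat1 /bsum eqxx expr1 !add0r mulrA subrr mulr0 add0r.
rewrite IH Abes_rec; [|by have := ler0n R M; lra..].
have e (z : R) : M%:R + z + 1 = M.+1%:R + z by rewrite -natr1; ring.
rewrite !e (seriesSr _ M.+1) /bsum expr0 mul1r.
move: (J _) (J _) (J _) (J _) => a b c d.
by field.
Qed.

Lemma Abes_lim x y : 2^-1 <= x -> 2^-1 <= y -> cvgn (series (bsum x y)) ->
  Abes x y = (x - y) * limn (series (bsum x y)).
Proof.
move=> x1 y1 cb; have x0 : 0 <= x by lra.
have y0 : 0 <= y by lra.
have Jx := Jvan x0; have Jy := Jvan y0.
have pred z : 2^-1 <= z -> J (m%:R + z - 1) @[m --> \oo] --> (0 : R).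
  move=> z1; rewrite -(cvg_shiftS (fun m => J (m%:R + z - 1))).
  have z0 : 0 <= z by lra.
  rewrite (_ : (fun m => _) = fun m : nat => J (m%:R + z)); first exact: Jvan.
  by apply/funext => m; congr J; rewrite -natr1; ring.
have H : (x - y) * (series (bsum x y) M.+1 -
     2^-1 * (J (M%:R + x) * J (M%:R + y))) + Abes (M%:R + x) (M%:R + y)
   @[M --> \oo] --> (x - y) * (limn (series (bsum x y)) - 2^-1 * (0 * 0)) +
   (s * 0 * 0 - s * 0 * 0 - 2^-1 * (x - y) * 0 * 0).
  apply: cvgD.
    apply: cvgM; first exact: cvg_cst.
    apply: cvgB; first by rewrite (cvg_shiftS (series _)); exact: cb.
    by apply: cvgM; [exact: cvg_cst | exact: cvgM].
  rewrite /Abes.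
  have e (M : nat) : M%:R + x - (M%:R + y) = x - y by ring.
  under eq_fun do rewrite e.
  apply: cvgB; first apply: cvgB.
  - by apply: cvgM => //; apply: cvgM; [exact: cvg_cst | exact: pred].
  - by apply: cvgM => //; apply: cvgM; [exact: cvg_cst | exact: pred].
  - by apply: cvgM => //; apply: cvgM => //; exact: cvg_cst.
rewrite !mulr0 !subr0 addr0 in H.
apply: (cvg_unique _ _ H) => //.
apply: cvg_near_cst; apply: nearW => M; by rewrite -Abes_sum.
Qed.

End christoffel_darboux.

(** * Bessel functions of real order: recurrence, decay, continuity in the order *)

Section bessel_real_order.
Context {R : realType} (th : R) (th0 : 0 < th).
Let th0' : 0 <= th := ltW th0.
Let s : R := Num.sqrt th.
Let s0 : 0 < s. Proof. by rewrite /s sqrtr_gt0. Qed.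
Let ss : s ^+ 2 = th. Proof. by rewrite /s sqr_sqrtr. Qed.
Implicit Types k x y : R.

Lemma th_powRD (a b : R) : th `^ (a + b) = th `^ a * th `^ b.
Proof. by rewrite powRD// (gt_eqF th0) implybT. Qed.

(** Gamma(r + k + 1) / Gamma(k + 1): it lets a single Gamma value be taken out of the whole Bessel
    series. *)
Definition poch (r : nat) k : R := \prod_(0 <= j < r) (k + 1 + j%:R).

Definition bterm k (r : nat) : R := (- th) ^+ r / (factR r * poch r k).

Definition bser k : R := limn (series (bterm k)).

Lemma poch_gt0 r k : - 1 < k -> 0 < poch r k.
Proof. by move=> k1; apply: prod_shift_gt0; lra. Qed.

Lemma rGamma_poch r k : -1 < k -> rGamma (r%:R + k + 1) = poch r k * rGamma (k + 1).
Proof.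
move=> k1; elim: r => [|r IH]; first by rewrite /poch big_geq// add0r mul1r.
have -> : r.+1%:R + k + 1 = (r%:R + k + 1) + 1 by rewrite -natr1; ring.
rewrite (rGammaS (x := r%:R + k + 1)); last by move: (ler0n R r) k1; lra.
by rewrite IH /poch big_nat_recr//= mulrA; congr (_ * _); rewrite mulrC; congr (_ * _); ring.
Qed.

(** Each factor is at least 1/2. The bound is crude but uniform in the order, as continuity in the
    order requires. *)
Lemma poch_half r k : - 2^-1 <= k -> 2^-1 ^+ r <= poch r k.
Proof.
move=> k1; elim: r => [|r IH]; first by rewrite /poch big_geq.
rewrite /poch big_nat_recr//= exprSr; apply: ler_pM => //.
by have := ler0n R r; lra.
Qed.

Lemma bterm_bound k r : - 2^-1 <= k -> `|bterm k r| <= exp_coeff (2 * th) r.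
Proof.
move=> k1; have p0 : 0 < poch r k by apply: poch_gt0; lra.
rewrite /bterm normrM normNth// ger0_norm; last first.
  by rewrite invr_ge0 mulr_ge0 ?factR_ge0// ltW.
rewrite /exp_coeff/= exprMn -/(factR r) (mulrC (2 ^+ r)) -mulrA.
rewrite ler_wpM2l ?exprn_ge0// invfM mulrC ler_wpM2r ?invr_ge0 ?factR_ge0//.
have := poch_half r k1; rewrite exprVn => H.
by rewrite -[2 ^+ r]invrK lef_pV2 ?posrE ?invr_gt0 ?exprn_gt0.
Qed.

Lemma is_cvg_bterm k : - 2^-1 <= k -> cvgn (series (bterm k)).
Proof.
move=> k1; apply: abs_cvg_series (fun r => bterm_bound r k1) _.
exact: is_cvg_series_exp_coeff.
Qed.

Lemma bser_le k : - 2^-1 <= k -> `|bser k| <= expR (2 * th).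
Proof.
move=> k1; apply: series_lim_norm (fun r => bterm_bound r k1) _.
exact: is_cvg_series_exp_coeff.
Qed.

Definition bfac k : R := th `^ (k / 2) / rGamma (k + 1).

Lemma besselJE k : - 2^-1 <= k -> besselJ th k = bfac k * bser k.
Proof.
move=> k1; have k2 : -1 < k by lra.
rewrite /bser -[RHS]lim_seriesZ; last exact: is_cvg_bterm.
rewrite /besselJ; congr (limn (series _)); apply/funext => r /=.
rewrite rGamma_poch// th_powRD powR_mulrn//.
have p0 : 0 < poch r k by exact: poch_gt0.
have g0 : 0 < rGamma (k + 1) by apply: rGamma_gt0; lra.
transitivity (bfac k * bterm k r); last by [].
rewrite /bfac /bterm -/(factR r) (exprNn th).
move: ((-1) ^+ r) (th ^+ r) (th `^ _) (factR r) (@factR_neq0 R r) => a b c f f0.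
by field; rewrite f0 !gt_eqF.
Qed.

Lemma besselJ_nat (n : nat) : besselJ th n%:R = s ^+ n * pbes th n.
Proof.
rewrite /pbes -[RHS]lim_seriesZ; last first.
  exact: abs_cvg_series (pbes_bound th0 n) (is_cvg_expc _ _).
rewrite /besselJ; congr (limn (series _)); apply/funext => r /=.
have -> : r%:R + n%:R + 1 = (r + n).+1%:R :> R by rewrite -natrD natr1.
rewrite rGamma_nat -/(factR _) -/(factR _) th_powRD powR_mulrn//.
have -> : th `^ (n%:R / 2) = s ^+ n.
  by rewrite mulrC powRrM powR12_sqrt// powR_mulrn// sqrtr_ge0.
transitivity (s ^+ n * ((- th) ^+ r / (factR r * factR (r + n)))); last by [].
by rewrite (exprNn th); move: ((-1) ^+ r) => a; ring.
Qed.

(** A contiguous relation of the hypergeometric function 0F1 with parameter k + 1, checked on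
    partial sums, with the series at k + 1 one term shorter. *)
Lemma bser_rec k : 2^-1 <= k ->
  bser (k - 1) = bser k - th / (k * (k + 1)) * bser (k + 1).
Proof.
move=> k1; have h1 : - 2^-1 <= k - 1 by lra.
have h2 : - 2^-1 <= k by lra.
have h3 : - 2^-1 <= k + 1 by lra.
have L : (fun N => series (bterm k) N.+1 - th / (k * (k + 1)) * series (bterm (k + 1)) N) @ \oo -->
  bser k - th / (k * (k + 1)) * bser (k + 1).
  apply: cvgB; first by rewrite (cvg_shiftS (series _)); exact: is_cvg_bterm.
  by apply: cvgM; [exact: cvg_cst | exact: is_cvg_bterm].
rewrite -(cvgn_limn L); apply: cvgn_limn; rewrite (cvgn_limn L); apply: cvg_trans L.
rewrite -(cvg_shiftS (series (bterm (k - 1)))).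
apply: near_eq_cvg; apply: nearW => N.
change (series (bterm k) N.+1 - th / (k * (k + 1)) * series (bterm (k + 1)) N =
  series (bterm (k - 1)) N.+1).
elim: N => [|N IH].
  by rewrite /series/= !big_nat1 !big_geq// mulr0 subr0 /bterm /poch !big_geq.
rewrite (seriesSr (bterm k) N.+1) (seriesSr (bterm (k - 1)) N.+1).
rewrite (seriesSr (bterm (k + 1)) N).
rewrite mulrDr opprD addrACA IH; congr (_ + _).
rewrite /bterm factRS exprS.
have E1 : poch N.+1 (k - 1) = k * poch N k.
  rewrite /poch big_nat_recl// subrK addr0; congr (_ * _).
  by apply: eq_bigr => i _; rewrite -natr1; ring.
have E2 : poch N.+1 k = poch N k * (k + N.+1%:R).
  by rewrite /poch big_nat_recr//=; congr (_ * _); rewrite -natr1; ring.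
have E3 : poch N.+1 k = (k + 1) * poch N (k + 1).
  rewrite /poch big_nat_recl// addr0; congr (_ * _).
  by apply: eq_bigr => i _; rewrite -natr1; ring.
have k0 : k != 0 by rewrite gt_eqF//; lra.
have k10 : k + 1 != 0 by rewrite gt_eqF//; lra.
have p0 : poch N k != 0 by rewrite gt_eqF// poch_gt0//; lra.
have p1 : poch N (k + 1) != 0 by rewrite gt_eqF// poch_gt0//; lra.
have kN : k + N.+1%:R != 0 by rewrite gt_eqF// ltr_wpDr//; lra.
have E4 : poch N (k + 1) = poch N k * (k + N.+1%:R) / (k + 1).
  by rewrite -E2 E3; field.
have N0 : N.+1%:R != 0 :> R by rewrite pnatr_eq0.
rewrite E1 E2 E4; move: (poch N k) p0 (N.+1%:R : R) N0 kN (factR N) (@factR_neq0 R N) (_ ^+ N).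
move=> p p0 n n0 kn f f0 e.
by field; rewrite p0 n0 kn f0 k0 k10.
Qed.

Lemma besselJ_rec k : 2^-1 <= k ->
  s * besselJ th (k - 1) = k * besselJ th k - s * besselJ th (k + 1).
Proof.
move=> k1; have h1 : - 2^-1 <= k - 1 by lra.
have h2 : - 2^-1 <= k by lra.
have h3 : - 2^-1 <= k + 1 by lra.
have k0 : 0 < k by lra.
rewrite !besselJE// bser_rec// /bfac subrK.
rewrite (rGammaS (x := k + 1)); last by lra.
rewrite (rGammaS k0).
have E (z : R) : th `^ ((z + 1) / 2) = s * th `^ (z / 2).
  rewrite mulrDl mul1r th_powRD.
  by rewrite powR12_sqrt// mulrC.
have E1 : th `^ (k / 2) = s * th `^ ((k - 1) / 2) by rewrite -E subrK.
rewrite E E1.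
have g0 : rGamma k != 0 by rewrite gt_eqF// rGamma_gt0.
have k10 : k + 1 != 0 by rewrite gt_eqF//; lra.
rewrite -ss; move: (rGamma k) g0 (th `^ ((k - 1) / 2)) (bser k) (bser (k + 1)) => g g0 p b c.
by field; rewrite g0 k10 gt_eqF.
Qed.

Definition Cbes x : R := th `^ (x / 2) * expR (2 * th) / rGamma (x + 1).

(** (x + 1) ... (x + m) >= m! gives factorial decay in [m], and the dependence on [x] sits in the
    constant [Cbes x]. *)
Lemma besselJ_bound (m : nat) x : 0 <= x ->
  `|besselJ th (m%:R + x)| <= Cbes x * (s ^+ m / factR m).
Proof.
move=> x0; have h : - 2^-1 <= m%:R + x by have := ler0n R m; lra.
have g0 : 0 < rGamma (x + 1) by apply: rGamma_gt0; lra.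
have mp : factR m <= poch m x.
  elim: m {h} => [|m IH]; first by rewrite /poch big_geq.
  rewrite /poch big_nat_recr//= factRS mulrC; apply: ler_pM => //; rewrite ?factR_ge0//.
  by rewrite -natr1; lra.
have p0 : 0 < poch m x by apply: poch_gt0; lra.
rewrite besselJE// normrM /bfac rGamma_poch; last by lra.
have -> : th `^ ((m%:R + x) / 2) = s ^+ m * th `^ (x / 2).
  rewrite mulrDl th_powRD.
  by congr (_ * _); rewrite mulrC powRrM powR12_sqrt// powR_mulrn// ltW.
have t0 : 0 <= th `^ (x / 2) by exact: powR_ge0.
have sm : 0 <= s ^+ m by rewrite exprn_ge0// ltW.
rewrite ger0_norm; last by rewrite divr_ge0 ?mulr_ge0// ltW.
apply: le_trans (ler_wpM2l _ (bser_le h)) _; first by rewrite divr_ge0 ?mulr_ge0// ltW.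
rewrite /Cbes.
have -> : s ^+ m * th `^ (x / 2) / (poch m x * rGamma (x + 1)) * expR (2 * th) =
  (th `^ (x / 2) * expR (2 * th) / rGamma (x + 1) * s ^+ m) / poch m x.
  by field; rewrite !gt_eqF.
rewrite mulrA ler_wpM2l ?mulr_ge0 ?invr_ge0 ?expR_ge0 ?(ltW g0)//.
by rewrite lef_pV2 ?posrE ?factR_gt0.
Qed.

Lemma bsum_bound x y m : 0 <= x -> 0 <= y ->
  `|bsum (besselJ th) x y m| <= Cbes x * Cbes y * exp_coeff th m.
Proof.
move=> x0 y0.
have C0 (z : R) : 0 <= z -> 0 <= Cbes z.
  move=> z0; rewrite /Cbes divr_ge0 ?mulr_ge0 ?powR_ge0 ?expR_ge0//.
  by rewrite ltW// rGamma_gt0//; lra.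
rewrite /bsum -mulrA normrM ger0_norm ?exprn_ge0//.
rewrite -[leRHS]mul1r; apply: ler_pM => //; first by rewrite exprn_ile1 // invf_le1 // ler1n.
rewrite normrM (le_trans (ler_pM _ _ (besselJ_bound m x0) (besselJ_bound m y0)))//.
rewrite mulrACA; apply: ler_wpM2l; first by apply: mulr_ge0; exact: C0.
rewrite /exp_coeff/= -/(factR m) -[in leRHS]ss.
have f1 : 1 <= factR m :> R by rewrite ler1n fact_gt0.
rewrite mulrACA -expr2 -exprM mulnC exprM -invfM ler_wpM2l ?exprn_ge0 ?sqr_ge0 ?(ltW s0)//.
by rewrite lef_pV2 ?posrE ?mulr_gt0 ?factR_gt0// ler_peMr ?factR_ge0.
Qed.

Lemma is_cvg_bsum x y : 0 <= x -> 0 <= y -> cvgn (series (bsum (besselJ th) x y)).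
Proof.
move=> x0 y0.
exact: abs_cvg_series (fun m => bsum_bound m x0 y0) (is_cvg_expc _ _).
Qed.

Lemma besselJ_vanish x : 0 <= x -> besselJ th (m%:R + x) @[m --> \oo] --> (0 : R).
Proof.
move=> x0.
have H : Cbes x * exp_coeff s m @[m --> \oo] --> (0 : R).
  rewrite -[X in _ --> X](mulr0 (Cbes x)); apply: cvgM; first exact: cvg_cst.
  exact: cvg_exp_coeff.
by apply: cvg0_le H; apply: nearW => m; exact: besselJ_bound.
Qed.

Lemma bfac_continuous x : 0 <= x -> {for x, continuous bfac}.
Proof.
move=> x0; apply: cvgM.
  have P (k : R) : th `^ k = expR (k * ln th) by rewrite /powR gt_eqF.
  under eq_fun do rewrite P; rewrite P.
  apply: continuous_cvg; first exact: continuous_expR.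
  apply: cvgM; last exact: cvg_cst.
  by apply: cvgM; [exact: cvg_id | exact: cvg_cst].
apply: cvgV; first by rewrite gt_eqF// rGamma_gt0//; lra.
apply: (@continuous_comp _ _ _ (fun k => k + 1) (@rGamma R)); last first.
  by apply: rGamma_continuous; lra.
by apply: cvgD; [exact: cvg_id | exact: cvg_cst].
Qed.

Lemma bser_continuous x : 0 <= x -> {for x, continuous bser}.
Proof.
move=> x0; apply: (@tannery R R (nbhs x) _ bterm (bterm x) (exp_coeff (2 * th))).
- exact: is_cvg_series_exp_coeff.
- near=> y => r; apply: bterm_bound.
  by apply: ltW; near: y; apply: lt_nbhsr; lra.
- move=> r; apply: cvgM; first exact: cvg_cst.
  apply: cvgV; first by rewrite mulf_neq0 ?factR_neq0// gt_eqF// poch_gt0//; lra.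
  apply: cvgM; first exact: cvg_cst.
  rewrite /poch; elim: r => [|r IH].
    by rewrite big_geq//; under eq_fun do rewrite big_geq//; exact: cvg_cst.
  rewrite big_nat_recr//=; under eq_fun do rewrite big_nat_recr//=.
  apply: cvgM; first exact: IH.
  apply: cvgD; last exact: cvg_cst.
  by apply: cvgD; [exact: cvg_id | exact: cvg_cst].
Unshelve. all: by end_near. Qed.

Lemma besselJ_continuous x : 0 <= x -> {for x, continuous (besselJ th)}.
Proof.
move=> x0; have x1 : - 2^-1 <= x by lra.
have H : bfac y * bser y @[y --> x] --> bfac x * bser x.
  by apply: cvgM; [exact: bfac_continuous | exact: bser_continuous].
rewrite -besselJE// in H; apply: cvg_trans H; apply: near_eq_cvg; near=> y.
rewrite besselJE//; apply: ltW; near: y; apply: lt_nbhsr; lra.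
Unshelve. all: by end_near. Qed.

Lemma bsum_continuous x : 0 < x ->
  limn (series (bsum (besselJ th) x y)) @[y --> x] --> limn (series (bsum (besselJ th) x x)).
Proof.
move=> x0.
have C0 (z : R) : 0 <= z -> 0 <= Cbes z.
  move=> z0; rewrite /Cbes divr_ge0 ?mulr_ge0 ?powR_ge0 ?expR_ge0//.
  by rewrite ltW// rGamma_gt0//; lra.
have CC : Cbes y @[y --> x] --> Cbes x.
  rewrite (_ : Cbes = fun y => bfac y * expR (2 * th)); last first.
    by apply/funext => z; rewrite /Cbes /bfac; ring.
  by apply: cvgM; [apply: bfac_continuous; exact: ltW | exact: cvg_cst].
(* [Cbes] is continuous, so [Cbes x + 1] bounds it near [x] and one summable majorant serves all
   nearby orders. *)
apply: (@tannery R R (nbhs x) _ (bsum (besselJ th) x) (bsum (besselJ th) x x)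
   (fun m => Cbes x * (Cbes x + 1) * exp_coeff th m)).
- exact: is_cvg_expc.
- near=> y => m.
  have y0 : 0 <= y by apply: ltW; near: y; exact: lt_nbhsr.
  apply: le_trans (bsum_bound m (ltW x0) y0) _.
  apply: ler_wpM2r; first exact: exp_coeff_ge0'.
  apply: ler_wpM2l; first by apply: C0; exact: ltW.
  near: y; apply: filterS (cvgr_lt _ CC (Cbes x + 1) _); last by rewrite ltrDl.
  by move=> z /ltW.
- move=> m; rewrite /bsum; apply: cvgM; first exact: cvg_cst.
  apply: (@continuous_comp _ _ _ (fun y => m%:R + y) (besselJ th)).
    by apply: cvgD; [exact: cvg_cst | exact: cvg_id].
  by apply: besselJ_continuous; rewrite addr_ge0// ltW.
Unshelve. all: by end_near. Qed.

End bessel_real_order.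

(** * Explicit derivatives and monotonicity *)

Section derivatives.
Context {R : realType}.
Implicit Types f g : R -> R.

(** Integrals are replaced by explicit primitives, so that inequalities between them reduce to
    [der_le]. *)
Definition der f f' := forall x : R, is_derive x 1 f (f' x).

Lemma derM f g f' g' : der f f' -> der g g' ->
  der (fun x => f x * g x) (fun x => f' x * g x + f x * g' x).
Proof.
move=> df dg x; apply: (is_derive_eq (is_deriveM (df x) (dg x))).
by rewrite /GRing.scale/= addrC [g x * _]mulrC.
Qed.

Lemma derD f g f' g' : der f f' -> der g g' ->
  der (fun x => f x + g x) (fun x => f' x + g' x).
Proof. by move=> df dg x; exact: is_deriveD (df x) (dg x). Qed.

Lemma derZ c f f' : der f f' -> der (fun x => c * f x) (fun x => c * f' x).
Proof. by move=> df x; exact: is_deriveZ (df x). Qed.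

Lemma derB f g f' g' : der f f' -> der g g' ->
  der (fun x => f x - g x) (fun x => f' x - g' x).
Proof. by move=> df dg x; exact: is_deriveB (df x) (dg x). Qed.

Lemma derX n f f' : der f f' ->
  der (fun x => f x ^+ n.+1) (fun x => n.+1%:R * f x ^+ n * f' x).
Proof.
move=> df; elim: n => [|n IH] x.
  by apply: (is_derive_eq (df x)); rewrite expr0 !mul1r.
apply: (is_derive_eq (derM df IH x)).
by rewrite -[in RHS]natr1 !exprS; ring.
Qed.

Lemma der_mvt f f' a b : der f f' -> a <= b ->
  exists2 c, a <= c <= b & f b - f a = f' c * (b - a).
Proof.
move=> df ab; have [c] := @MVT_segment R f f' a b ab (fun x _ => df x)
  (derivable_within_continuous (fun x _ => @ex_derive _ _ _ _ _ _ _ (df x))).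
by rewrite in_itv/=; exists c.
Qed.

Lemma der_le f f' h : der f f' -> 0 <= h -> (forall x, 0 <= x <= h -> 0 <= f' x) ->
  f 0 <= f h.
Proof.
move=> df h0 f0; have [c ch E] := der_mvt df h0.
by rewrite -subr_ge0 E mulr_ge0 ?f0// subr0.
Qed.

End derivatives.

(** * Primitives of powers of cosine times cosh *)

Section cosine_integrals.
Context {R : realType} (b : R).

Definition ch (x : R) : R := (expR (b * x) + expR (- (b * x))) / 2.
Definition sh (x : R) : R := (expR (b * x) - expR (- (b * x))) / 2.

Lemma der_exp (c : R) : der (fun x => expR (c * x)) (fun x => c * expR (c * x)).
Proof.
move=> x; have H : is_derive x 1 (fun y : R => c * y) (c * 1) by exact: (derZ c (fun y => is_derive_id y 1) x).
by apply: (is_derive_eq (is_derive1_comp (is_derive_expR (c * x)) H)); rewrite mulr1 mulrC.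
Qed.

Lemma der_expN (c : R) : der (fun x => expR (- (c * x))) (fun x => - c * expR (- (c * x))).
Proof.
have := der_exp (- c); rewrite (_ : (fun x => expR (- c * x)) = fun x => expR (- (c * x))).
  by move=> H x; apply: (is_derive_eq (H x)); rewrite [- c * x]mulNr.
by apply/funext => x; rewrite mulNr.
Qed.

Lemma der_ch : der ch (fun x => b * sh x).
Proof.
move=> x; rewrite (_ : ch = fun x => 2^-1 * (expR (b * x) + expR (- (b * x)))); last first.
  by apply/funext => y; rewrite /ch mulrC.
by apply: (is_derive_eq (derZ 2^-1 (derD (der_exp b) (der_expN b)) x)); rewrite /sh; ring.
Qed.

Lemma der_sh : der sh (fun x => b * ch x).
Proof.
move=> x; rewrite (_ : sh = fun x => 2^-1 * (expR (b * x) - expR (- (b * x)))); last first.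
  by apply/funext => y; rewrite /sh mulrC.
by apply: (is_derive_eq (derZ 2^-1 (derB (der_exp b) (der_expN b)) x)); rewrite /ch; ring.
Qed.

Lemma sh0 : sh 0 = 0. Proof. by rewrite /sh mulr0 oppr0 subrr mul0r. Qed.

Lemma ch_ge1 x : 1 <= ch x.
Proof.
rewrite /ch ler_pdivlMr// mul1r; have := expR_gt0 (b * x); rewrite expRN.
move: (expR _) => e e0; rewrite -subr_ge0.
have -> : e + e^-1 - 2 = (e - 1) ^+ 2 / e by field; rewrite gt_eqF.
by rewrite divr_ge0 ?sqr_ge0// ltW.
Qed.

(* [cprim m] is the primitive of [cos^m * ch] vanishing at 0; for even [m] this
   needs [b = 0]. *)
Fixpoint cprim (m : nat) : R -> R :=
  match m with
  | 0 => id
  | 1 => fun x => (1 + b ^+ 2)^-1 * (b * (cos x * sh x) + sin x * ch x)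
  | n.+2 => fun x => (n.+2%:R ^+ 2 + b ^+ 2)^-1 *
      (b * (cos x ^+ n.+2 * sh x) + n.+2%:R * (cos x ^+ n.+1 * (sin x * ch x)) +
       n.+2%:R * n.+1%:R * cprim n x)
  end.

Lemma der_cos : der (@cos R) (fun x => - sin x).
Proof. by move=> x; exact: is_derive_cos. Qed.

Lemma der_sin : der (@sin R) (@cos R).
Proof. by move=> x; exact: is_derive_sin. Qed.

(** The recursive formula is integration by parts, checked here with sin^2 = 1 - cos^2. The descent
    by two ends at [id], a primitive of cosh(b x) only for b = 0, or at exponent 1, where every [b]
    is allowed. *)
Lemma der_cprim m : b = 0 \/ odd m -> der (cprim m) (fun x => cos x ^+ m * ch x).
Proof.
have pos (n : nat) : n.+1%:R ^+ 2 + b ^+ 2 != 0 :> R.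
  by rewrite gt_eqF// ltr_wpDr ?sqr_ge0// exprn_gt0.
have S x : sin x * sin x = 1 - cos x ^+ 2 :> R.
  by rewrite -(cos2Dsin2 x) -expr2 addrAC subrr add0r.
have [k] := ubnP m; elim: k m => // k IH [|[|n]] mk bm x.
- case: bm => // b0; apply: (is_derive_eq (is_derive_id x 1)).
  by rewrite expr0 mul1r /ch b0 mul0r oppr0 expR0 -mulr2n divff.
- have p1 := pos 0%N; rewrite expr1n in p1.
  apply: (is_derive_eq (derZ _ (derD (derZ b (derM der_cos der_sh)) (derM der_sin der_ch)) x)).
  by field.
have bn : b = 0 \/ odd n by case: bm => [|/=]; [left|rewrite negbK; right].
have nk : (n < k)%N by rewrite ltnS in mk; exact: leq_trans mk.
apply: (is_derive_eq (derZ _ (derD (derD (derZ b (derM (derX n.+1 der_cos) der_sh))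
   (derZ _ (derM (derX n der_cos) (derM der_sin der_ch)))) (derZ _ (IH n nk bn))) x)).
have p1 := pos n.+1.
rewrite -[RHS](mulKf p1); congr (_ * _).
have := S x; move: (cos x) (sin x) (sh x) (ch x) => c s S' C Sx.
have -> : n.+2%:R = n.+1%:R + 1 :> R by rewrite natr1.
rewrite !exprS; move: (n.+1%:R : R) (c ^+ n) => N u.
apply: subr0_eq.
transitivity (- ((N + 1) * N * u * C) * (s * s - (1 - c ^+ 2))); first by ring.
by rewrite Sx subrr mulr0.
Qed.

Lemma cprim0 m : cprim m 0 = 0.
Proof.
have [k] := ubnP m; elim: k m => // k IH [|[|n]] mk //=.
  by rewrite sh0 sin0 mulr0 mul0r mulr0 addr0 mulr0.
rewrite IH; last by rewrite ltnS in mk; exact: leq_trans mk.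
by rewrite sh0 sin0 !(mulr0, mul0r, addr0).
Qed.

(* This is the integral of [cos^m * ch] over [0, pi / 2]. *)
Definition cint m : R := cprim m (pi / 2).

Lemma cint1 : cint 1 = ch (pi / 2) / (1 + b ^+ 2).
Proof. by rewrite /cint/= cos_pihalf sin_pihalf mul0r mulr0 add0r mul1r mulrC. Qed.

Lemma cintSS n : cint n.+2 = n.+2%:R * n.+1%:R / (n.+2%:R ^+ 2 + b ^+ 2) * cint n.
Proof.
rewrite /cint/= cos_pihalf !expr0n/= !mul0r !mulr0 !add0r; ring.
Qed.

End cosine_integrals.

(** * Wallis' formula and the squared modulus of Gamma on the line of real part 1/2 *)

Section wallis.
Context {R : realType}.
Notation I0 := (@cint R 0).
Let h : R := pi / 2.
Let h0 : 0 <= h. Proof. by rewrite /h divr_ge0// pi_ge0. Qed.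

Let cos_bd (x : R) : 0 <= x <= h -> 0 <= cos x <= 1.
Proof.
move=> /andP[x0 xh]; rewrite cos_le1 andbT cos_ge0_pihalf// xh andbT.
by apply: le_trans x0; rewrite oppr_le0.
Qed.

Lemma ch0E x : ch 0 x = 1 :> R.
Proof. by rewrite /ch mul0r oppr0 expR0 -mulr2n divff. Qed.

Lemma der_cprim0 m : der (cprim 0 m) (fun x : R => cos x ^+ m).
Proof.
move=> x; apply: (is_derive_eq (der_cprim (or_introl erefl) x)).
by rewrite ch0E mulr1.
Qed.

Lemma cint0_0 : I0 0%N = h. Proof. by []. Qed.

Lemma cint0_1 : I0 1%N = 1.
Proof. by rewrite cint1 ch0E expr0n addr0 divr1. Qed.

Lemma cint0SS n : I0 n.+2 = n.+1%:R / n.+2%:R * I0 n.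
Proof.
rewrite cintSS expr0n addr0; congr (_ * _); field.
by rewrite -natrD pnatr_eq0.
Qed.

Lemma cint0_gt0 n : 0 < I0 n.
Proof.
have [k] := ubnP n; elim: k n => // k IH [|[|n]] nk.
- by rewrite cint0_0 /h divr_gt0// pi_gt0.
- by rewrite cint0_1.
rewrite cint0SS mulr_gt0 ?divr_gt0// IH//.
by rewrite ltnS in nk; exact: leq_trans nk.
Qed.

Lemma cint0_decr n : I0 n.+1 <= I0 n.
Proof.
have := der_le (derB (der_cprim0 n) (der_cprim0 n.+1)) h0.
rewrite !cprim0 subrr subr_ge0; apply => x /cos_bd /andP[c0 c1].
by rewrite subr_ge0 exprS ler_piMl// exprn_ge0.
Qed.

Lemma cint0_mul n : I0 n * I0 n.+1 = h / n.+1%:R.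
Proof.
elim: n => [|n IH]; first by rewrite cint0_0 cint0_1 mulr1 divr1.
rewrite cint0SS mulrCA [_ * I0 n]mulrC IH.
have : n.+1%:R != 0 :> R by rewrite pnatr_eq0.
have : n.+2%:R != 0 :> R by rewrite pnatr_eq0.
move: (n.+1%:R : R) (n.+2%:R : R) => p q p0 q0.
by field; rewrite p0 q0.
Qed.

(** Monotonicity puts the square of the integral with exponent 2n + 1 between its products with the
    two neighbouring integrals, both explicit by [cint0_mul]. *)
Lemma wallis : 4 * n%:R * I0 n.*2.+1 ^+ 2 @[n --> \oo] --> (pi : R).
Proof.
have pi0 : 0 <= (pi : R) by exact: pi_ge0.
have H1 : pi * (1 - n.+1%:R^-1) @[n --> \oo] --> pi * (1 - 0 : R).
  apply: cvgM; first exact: cvg_cst.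
  by apply: cvgB; [exact: cvg_cst | exact: cvg_harmonic].
rewrite subr0 mulr1 in H1.
apply: (squeeze_cvgr _ H1 (cvg_cst pi)).
apply: nearW => n.
have e : h = pi / 2 by [].
have i1 := cint0_decr n.*2.+1; have i0 := cint0_decr n.*2.
have m1 := cint0_mul n.*2.+1; have m0 := cint0_mul n.*2.
have p0 := cint0_gt0 n.*2; have p1 := cint0_gt0 n.*2.+1; have p2 := cint0_gt0 n.*2.+2.
have n0 := ler0n R n.
have E2 : n.*2.+2%:R = 2 * n%:R + 2 :> R by rewrite -addn2 natrD -mul2n natrM.
have E1 : n.*2.+1%:R = 2 * n%:R + 1 :> R by rewrite -addn1 natrD -mul2n natrM.
have E0 : n.+1%:R = n%:R + 1 :> R by rewrite natr1.
rewrite E2 in m1; rewrite E1 in m0; rewrite E0.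
apply/andP; split.
  have -> : pi * (1 - (n%:R + 1)^-1) = 4 * n%:R * (h / (2 * n%:R + 2)).
    by rewrite e; field; rewrite -E2 -E0 !pnatr_eq0.
  by rewrite -m1 expr2 ler_wpM2l ?mulr_ge0// ler_wpM2l ?(ltW p1).
apply: (@le_trans _ _ (4 * n%:R * (h / (2 * n%:R + 1)))).
  by rewrite -m0 expr2 ler_wpM2l ?mulr_ge0// ler_wpM2r ?(ltW p1).
have -> : 4 * n%:R * (h / (2 * n%:R + 1)) = pi * (2 * n%:R / (2 * n%:R + 1)).
  by rewrite e; field; rewrite -E1 pnatr_eq0.
by rewrite ler_piMr// ler_pdivrMr ?mul1r ?lerDl// ltr_wpDl// mulr_ge0.
Qed.

Context (b : R).
Notation Ib := (@cint R (2 * b)).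

Lemma cint_ge n : odd n -> I0 n <= Ib n.
Proof.
move=> on; have db := der_cprim (or_intror on : 2 * b = 0 \/ odd n).
have := der_le (derB db (der_cprim0 n)) h0.
rewrite !cprim0 subrr subr_ge0; apply => x /cos_bd /andP[c0 c1].
by rewrite subr_ge0 ler_peMr ?ch_ge1// exprn_ge0.
Qed.

Let C : R := `|b| * ch b h.

Lemma ch_mono (c : R) x : 0 <= c -> 0 <= x <= h -> ch c x <= ch c h.
Proof.
move=> c0 /andP[x0 xh]; have [y /andP[xy _] E] := der_mvt (der_ch c) xh.
rewrite -subr_ge0 E mulr_ge0 ?subr_ge0// mulr_ge0// /sh divr_ge0// subr_ge0 ler_expR.
have : 0 <= c * y by rewrite mulr_ge0// (le_trans x0).
by move: (c * y) => z; lra.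
Qed.

Lemma sh_ge0 (c : R) x : 0 <= c -> 0 <= x -> 0 <= sh c x.
Proof.
move=> c0 x0; rewrite /sh divr_ge0// subr_ge0 ler_expR.
have : 0 <= c * x by rewrite mulr_ge0.
by move: (c * x) => z; lra.
Qed.

(** Both sides vanish at 0, and their difference has derivative c cos(y) (ch c h - ch c y) + sin(y)
    sh c y >= 0. *)
Lemma cos_sh_le_pos (c : R) x : 0 <= c -> 0 <= x <= h ->
  cos x * sh c x <= c * ch c h * sin x.
Proof.
move=> c0 /andP[x0 xh].
have := der_le (derB (derZ (c * ch c h) der_sin) (derM der_cos (der_sh c))) x0.
rewrite sin0 sh0 !mulr0 subrr subr_ge0; apply => y /andP[y0 yx].
have yh : 0 <= y <= h by rewrite y0 (le_trans yx).
have /andP[cy _] := cos_bd yh.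
have sy : 0 <= sin y.
  apply: sin_ge0_pi; rewrite y0/=; case/andP: yh => _ /le_trans; apply.
  by rewrite /h ler_pdivrMr// ler_peMr ?pi_ge0// ler1n.
have m := ch_mono c0 yh; have s0 := sh_ge0 c0 y0.
have : 0 <= c * cos y * (ch c h - ch c y) by rewrite mulr_ge0 ?mulr_ge0// subr_ge0.
have : 0 <= sin y * sh c y by rewrite mulr_ge0.
by move: (sin y) (cos y) (sh c y) (ch c y) (ch c h) => p q r t u; nra.
Qed.

Lemma cos_sh_le x : 0 <= x <= h -> `|cos x * sh b x| <= C * sin x.
Proof.
move=> xh; have /andP[c0 _] := cos_bd xh; have x0 : 0 <= x by case/andP: xh.
have [b0|/ltW b0] := leP 0 b.
  by rewrite /C (ger0_norm b0) (ger0_norm (mulr_ge0 c0 (sh_ge0 b0 x0))) cos_sh_le_pos.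
have nb : 0 <= - b by rewrite oppr_ge0.
have es : sh b x = - sh (- b) x by rewrite /sh !mulNr opprK; ring.
have ec : ch b h = ch (- b) h by rewrite /ch !mulNr opprK addrC.
rewrite /C es ec mulrN normrN (ger0_norm (mulr_ge0 c0 (sh_ge0 nb x0))) (ler0_norm b0).
exact: cos_sh_le_pos.
Qed.

(** cosh(2 b x) = 1 + 2 sinh(b x)^2, and [cos_sh_le] trades cos^2 sinh^2 for C^2 sin^2 = C^2 (1 -
    cos^2). The excess over b = 0 is thus bounded by a difference of consecutive Wallis integrals,
    of smaller order than either. *)
Lemma cint_le n : odd n -> Ib n.+2 <= I0 n.+2 + 2 * C ^+ 2 * (I0 n - I0 n.+2).
Proof.
move=> on; have on2 : odd n.+2 by rewrite /= negbK.
have db := der_cprim (or_intror on2 : 2 * b = 0 \/ odd n.+2).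
have dd := derB (derD (der_cprim0 n.+2) (derZ (2 * C ^+ 2) (derB (der_cprim0 n) (der_cprim0 n.+2)))) db.
have := der_le dd h0; rewrite !cprim0 !(subrr, addr0, mulr0) subr_ge0; apply => x xh.
have /andP[c0 c1] := cos_bd xh.
have ch2 : ch (2 * b) x = 1 + 2 * sh b x ^+ 2.
  have e : 2 * b * x = b * x + b * x by ring.
  rewrite /ch /sh e opprD !expRD expRN; have := expR_gt0 (b * x).
  by move: (expR _) => z z0; field; rewrite gt_eqF.
have := cos_sh_le xh; rewrite ch2.
have -> : cos x ^+ n.+2 + 2 * C ^+ 2 * (cos x ^+ n - cos x ^+ n.+2) -
   cos x ^+ n.+2 * (1 + 2 * sh b x ^+ 2) =
   2 * cos x ^+ n * ((C * sin x) ^+ 2 - (cos x * sh b x) ^+ 2).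
  rewrite [(C * _) ^+ 2]exprMn sin2cos2 !exprS; ring.
move=> H; rewrite mulr_ge0 ?mulr_ge0 ?exprn_ge0// subr_ge0.
rewrite -(real_normK (num_real (_ * sh _ _))) ler_pXn2r ?nnegrE//.
exact: le_trans H.
Qed.

Lemma cint_ratio : Ib n.*2.+1 / I0 n.*2.+1 @[n --> \oo] --> (1 : R).
Proof.
have H : 1 + 2 * C ^+ 2 * n.+1%:R^-1 @[n --> \oo] --> 1 + 2 * C ^+ 2 * (0 : R).
  apply: cvgD; first exact: cvg_cst.
  by apply: cvgM; [exact: cvg_cst | exact: cvg_harmonic].
rewrite mulr0 addr0 in H.
rewrite -(cvg_shiftS (fun n => Ib n.*2.+1 / I0 n.*2.+1)).
apply: (squeeze_cvgr _ (cvg_cst (1 : R)) H); apply: nearW => n /=.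
have on : odd n.*2.+1 by rewrite /= odd_double.
have on2 : odd n.*2.+3 by rewrite /= odd_double.
rewrite doubleS ler_pdivlMr ?cint0_gt0// mul1r cint_ge//=.
rewrite ler_pdivrMr ?cint0_gt0//.
apply: le_trans (cint_le on) _; rewrite [leRHS]mulrDl mul1r lerD2l -[leRHS]mulrA.
rewrite ler_wpM2l ?mulr_ge0 ?sqr_ge0//.
have := cint0SS n.*2.+1; have := cint0_gt0 n.*2.+1; move: (I0 n.*2.+1) (I0 n.*2.+3) => p q p0 ->.
have m0 : 0 < n.+1%:R :> R by [].
have E2 : n.*2.+2%:R = 2 * n.+1%:R :> R by rewrite -doubleS -mul2n natrM.
have E3 : n.*2.+3%:R = 2 * n.+1%:R + 1 :> R by rewrite -natr1 E2.
rewrite E2 E3; move: (n.+1%:R : R) m0 => m m0.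
have d0 : 0 < 2 * m + 1 by rewrite addr_gt0// mulr_gt0.
rewrite -subr_ge0 (_ : _ - _ = p / (2 * m + 1)); first by rewrite divr_ge0// ltW.
by field; rewrite !gt_eqF.
Qed.

(** |(1/2 + i b) ... (1/2 + i b + n)|^2, from the denominator of the Gauss product. *)
Definition halfprod n : R := \prod_(0 <= j < n.+1) ((2^-1 + j%:R) ^+ 2 + b ^+ 2).

(** Equal to (2n + 1)! / 4^(n + 1). *)
Fixpoint qfac (n : nat) : R :=
  if n is k.+1 then qfac k * (n.*2.+1%:R * n.*2%:R / 4) else 4^-1.

Let half2 : 0 < 2^-1 :> R. Proof. by rewrite invr_gt0. Qed.

(** At frequency 2 b the denominators of the reduction formula are (2j + 1)^2 + (2b)^2, four times
    the factors of [halfprod]; the boundary value is cosh(2 b pi / 2) = cosh(pi b). *)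
Lemma cint_halfprod n : Ib n.*2.+1 * halfprod n = ch b pi * qfac n.
Proof.
have e : ch (2 * b) h = ch b pi.
  by rewrite /ch (_ : 2 * b * h = b * pi)// /h; field.
elim: n => [|n IH].
  rewrite cint1 -/h e /halfprod big_nat1 addr0 /=.
  by field; rewrite gt_eqF// ltr_wpDr ?sqr_ge0// ltr01.
rewrite doubleS cintSS /halfprod big_nat_recr//= -/(halfprod n).
have p : 0 < n.*2.+3%:R ^+ 2 + (2 * b) ^+ 2 :> R.
  by rewrite ltr_wpDr ?sqr_ge0// exprn_gt0.
transitivity (Ib n.*2.+1 * halfprod n * (n.*2.+3%:R * n.*2.+2%:R / 4)); last first.
  by rewrite IH doubleS mulrA.
have E : n.*2.+3%:R = 2 * n.+1%:R + 1 :> R.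
  by rewrite -natr1 -doubleS -mul2n natrM.
rewrite E in p *; move: (Ib _) (halfprod n) (n.*2.+2%:R : R) (n.+1%:R : R) p => i P m k p.
by field; rewrite gt_eqF.
Qed.

Lemma qfac_fact n : qfac n * I0 n.*2.+1 = n`!%:R ^+ 2 / 4.
Proof.
elim: n => [|n IH]; first by rewrite cint0_1 /= expr1n mulr1 mul1r.
rewrite doubleS cint0SS /= doubleS.
transitivity (qfac n * I0 n.*2.+1 * (n.*2.+2%:R ^+ 2 / 4)).
  by field; rewrite -!natrD pnatr_eq0.
by rewrite IH factS natrM -doubleS -mul2n natrM; field.
Qed.

Lemma halfprod_gt0 n : 0 < halfprod n.
Proof.
apply: prodr_gt0 => j _; rewrite ltr_wpDr ?sqr_ge0// exprn_gt0//.
Qed.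

(** The left side is the squared modulus of the Gauss product at 1/2 + i b. In terms of cosine
    integrals it is Wallis' expression over cosh(pi b), times the ratio of the integrals with and
    without cosh. *)
Lemma gamma_half_cvg : n`!%:R ^+ 2 * n%:R / halfprod n @[n --> \oo] --> pi / ch b pi.
Proof.
have c0 : 0 < ch b pi by rewrite (lt_le_trans ltr01)// ch_ge1.
rewrite -[X in _ --> X](mulr1 (pi / ch b pi)).
rewrite [X in X @ _ --> _](_ : _ = fun n => 4 * n%:R * I0 n.*2.+1 ^+ 2 / ch b pi *
   (Ib n.*2.+1 / I0 n.*2.+1)).
  apply: cvgM; last exact: cint_ratio.
  by apply: cvgM; [exact: wallis | exact: cvg_cst].
apply/funext => n.
have := cint_halfprod n; have := qfac_fact n; have := halfprod_gt0 n.
have := cint0_gt0 n.*2.+1.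
move: (I0 _) (Ib _) (halfprod n) (qfac n) (ch b pi) c0 => i j P q c c0 i0 P0 E1 E2.
have -> : n`!%:R ^+ 2 = 4 * (q * i) by rewrite E1; field.
have -> : q = j * P / c by rewrite E2; field; rewrite gt_eqF.
by field; rewrite !gt_eqF.
Qed.

End wallis.

(** * Complex Gauss products in polar form, and the weight for alpha > 1/4 *)

Section complex_gamma.
Context {R : realType}.
Local Open Scope complex_scope.

Definition phase (t : R) : R[i] := cos t +i* sin t.

Lemma phaseD s t : phase (s + t) = phase s * phase t.
Proof. by rewrite /phase cosD sinD; simpc; congr (_ +i* _); ring. Qed.

Lemma phase0 : phase 0 = 1. Proof. by rewrite /phase cos0 sin0. Qed.

Lemma phaseN t : phase (- t) = (phase t)^-1.
Proof.
have e : phase t * phase (- t) = 1 by rewrite -phaseD subrr phase0.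
have n0 : phase t != 0.
  by apply/eqP => z; move: e; rewrite z mul0r => /eqP; rewrite eq_sym oner_eq0.
by apply: (mulfI n0); rewrite e divff.
Qed.

Lemma phase_sum (I : Type) (s : seq I) (f : I -> R) :
  phase (\sum_(i <- s) f i) = \prod_(i <- s) phase (f i).
Proof.
elim: s => [|i s IH]; first by rewrite !big_nil phase0.
by rewrite !big_cons phaseD IH.
Qed.

Definition modulus (d b : R) : R := Num.sqrt (d ^+ 2 + b ^+ 2).

Lemma polar (d b : R) : 0 < d -> d +i* b = (modulus d b)%:C * phase (atan (b / d)).
Proof.
move=> d0; have m0 : 0 < modulus d b by rewrite sqrtr_gt0 ltr_wpDr ?sqr_ge0// exprn_gt0.
have c : cos (atan (b / d)) = d / modulus d b.
  rewrite cos_atan; have -> : 1 + (b / d) ^+ 2 = (d ^+ 2 + b ^+ 2) / d ^+ 2.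
    by field; rewrite gt_eqF.
  rewrite sqrtrM ?addr_ge0 ?sqr_ge0// sqrtrV ?sqr_ge0// sqrtr_sqr gtr0_norm//.
  by rewrite invf_div.
have s : sin (atan (b / d)) = b / modulus d b.
  have cn : cos (atan (b / d)) != 0 by rewrite c mulf_neq0 ?invr_neq0 ?gt_eqF.
  have := atanK (b / d); rewrite /tan => /(congr1 (fun u => u * cos (atan (b / d)))).
  rewrite mulfVK// c => ->; by field; rewrite !gt_eqF.
rewrite /phase c s; simpc; congr (_ +i* _); by field; rewrite gt_eqF.
Qed.

Definition crho (d b : R) (n : nat) : R :=
  n`!%:R * expR (d * ln n%:R) / \prod_(0 <= j < n.+1) modulus (d + j%:R) b.

(** The phase of the Gauss product as a real number, not modulo 2 pi, so that its convergence makes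
    sense and can be read off its increments. *)
Definition cphi (d b : R) (n : nat) : R :=
  b * ln n%:R - \sum_(0 <= j < n.+1) atan (b / (d + j%:R)).

Lemma gauss_polar (d b : R) n : 0 < d ->
  gauss_Gamma (d +i* b) n = (crho d b n)%:C * phase (cphi d b n).
Proof.
move=> d0; rewrite /gauss_Gamma /crho /cphi phaseD phaseN phase_sum.
have -> : expC ((d +i* b) * (ln n%:R)%:C) = (expR (d * ln n%:R))%:C * phase (b * ln n%:R).
  by rewrite /expC /phase; simpc.
have -> : \prod_(j < n.+1) (d +i* b + j%:R) =
    (\prod_(0 <= j < n.+1) modulus (d + j%:R) b)%:C *
    \prod_(0 <= j < n.+1) phase (atan (b / (d + j%:R))).
  rewrite rmorph_prod -big_split/= big_mkord; apply: eq_bigr => j _.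
  rewrite -polar ?ltr_wpDr//.
  have -> : (j%:R : R[i]) = (j%:R : R)%:C by rewrite rmorph_nat.
  by simpc.
rewrite fmorph_div rmorphM/= rmorph_nat invfM.
by rewrite !mulrA; congr (_ * _); rewrite -!mulrA; congr (_ * (_ * _)); rewrite mulrC.
Qed.

Lemma cphiN (d b : R) n : cphi d (- b) n = - cphi d b n.
Proof.
rewrite /cphi mulNr opprB [RHS]addrC; congr (_ + _).
by rewrite -sumrN; apply: eq_bigr => j _; rewrite mulNr atanN opprK.
Qed.

Lemma crhoN (d b : R) n : crho d (- b) n = crho d b n.
Proof. by rewrite /crho /modulus sqrrN. Qed.

Lemma Gamma_polar (d b : R) (rho phi : R) : 0 < d ->
  crho d b @ \oo --> rho -> cphi d b @ \oo --> phi ->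
  Gamma (d +i* b) = rho%:C * phase phi.
Proof.
move=> d0 cr cp; rewrite /Gamma /phase.
have -> : rho%:C * (cos phi +i* sin phi) = (rho * cos phi) +i* (rho * sin phi) by simpc.
congr (_ +i* _); apply: cvgn_limn.
  rewrite (_ : (fun n => _) = fun n => crho d b n * cos (cphi d b n)).
    by apply: cvgM => //; apply: continuous_cvg => //; exact: continuous_cos.
  by apply/funext => n; rewrite gauss_polar// /phase; simpc.
rewrite (_ : (fun n => _) = fun n => crho d b n * sin (cphi d b n)).
  by apply: cvgM => //; apply: continuous_cvg => //; exact: continuous_sin.
by apply/funext => n; rewrite gauss_polar// /phase; simpc.
Qed.

(** The phases at b and -b are opposite and cancel; of the limiting phase only its existence
    enters. *)
Lemma Gamma_conj_mul (d b rho : R) : 0 < d ->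
  crho d b @ \oo --> rho -> cvgn (cphi d b) ->
  Gamma (d +i* - b) * Gamma (d +i* b) = (rho ^+ 2)%:C.
Proof.
move=> d0 cr cp; rewrite (Gamma_polar d0 cr cp).
rewrite (@Gamma_polar d (- b) rho (- limn (cphi d b)))//; last first.
- rewrite (_ : cphi d (- b) = fun n => - cphi d b n); first exact: cvgN.
  by apply/funext => n; exact: cphiN.
- by rewrite (_ : crho d (- b) = crho d b)//; apply/funext => n; exact: crhoN.
rewrite mulrACA -phaseD addNr phase0 mulr1.
by rewrite -rmorphM/= expr2.
Qed.

Lemma der_atan : der (@atan R) (fun x => (1 + x ^+ 2)^-1).
Proof.
move=> x; rewrite -derive1_atan derive1E; apply: derivableP.
exact: derivable_atan.
Qed.

(** Quadratic order is enough: it is summable at u = b / (d + j). *)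
Lemma atan_sub (u : R) : `|u - atan u| <= u ^+ 2.
Proof.
have aux (c : R) : 0 <= 1 - (1 + c ^+ 2)^-1 <= `|c|.
  have c2 : 0 < 1 + c ^+ 2 by rewrite ltr_wpDr ?sqr_ge0.
  rewrite subr_ge0 invf_le1// lerDl sqr_ge0/=.
  have -> : 1 - (1 + c ^+ 2)^-1 = c ^+ 2 / (1 + c ^+ 2) by field; rewrite gt_eqF.
  rewrite ler_pdivrMr//.
  have := sqr_ge0 (`|c| - 1); have := real_normK (num_real c); have := normr_ge0 c.
  move: `|c| => a a0 <-; nra.
have [u0|/ltW u0] := leP 0 u.
  have [c /andP[c0 cu] E] := der_mvt der_atan u0.
  rewrite atan0 !subr0 in E; rewrite E.
  have -> : u - (1 + c ^+ 2)^-1 * u = (1 - (1 + c ^+ 2)^-1) * u by ring.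
  have /andP[a0 a1] := aux c.
  rewrite ger0_norm ?mulr_ge0// expr2 ler_wpM2r//.
  by apply: le_trans a1 _; rewrite ger0_norm.
have [c /andP[uc c0] E] := der_mvt der_atan u0.
rewrite atan0 !sub0r in E.
have {}E : atan u = (1 + c ^+ 2)^-1 * u by rewrite -[LHS]opprK E mulrN opprK.
rewrite E; have -> : u - (1 + c ^+ 2)^-1 * u = (1 - (1 + c ^+ 2)^-1) * u by ring.
have /andP[a0 a1] := aux c.
rewrite normrM (ger0_norm a0) (ler0_norm u0) [leRHS]expr2 -[leRHS]mulrNN.
rewrite ler_wpM2r ?oppr_ge0//; apply: le_trans a1 _.
by rewrite ler0_norm// lerN2.
Qed.

Lemma cvg_telescope_bound (u : nat -> R) (C : R) :
  (forall n, `|u n.+1 - u n| <= C * (n.+1%:R^-1 - n.+2%:R^-1)) -> cvgn u.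
Proof.
move=> H.
pose v n := u n + C * n.+1%:R^-1; pose w n := u n - C * n.+1%:R^-1.
have C0 : 0 <= C.
  have := le_trans (normr_ge0 _) (H 0%N); rewrite pmulr_lge0// subr_gt0.
  by rewrite ltf_pV2 ?posrE// ltr_nat.
have vd : nonincreasing_seq v.
  apply/nonincreasing_seqP => n; have := H n; rewrite ler_norml /v => /andP[] _.
  by move: (n.+1%:R^-1) (n.+2%:R^-1) (u n) (u n.+1) => p q s t; lra.
have wi : nondecreasing_seq w.
  apply/nondecreasing_seqP => n; have := H n; rewrite ler_norml /w => /andP[] + _.
  by move: (n.+1%:R^-1) (n.+2%:R^-1) (u n) (u n.+1) => p q s t; lra.
have cv : cvgn v.
  apply: nonincreasing_is_cvgn => //; exists (w 0%N) => _ [n _ <-].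
  apply: le_trans (wi _ _ (leq0n n)) _.
  have : 0 <= C * n.+1%:R^-1 by rewrite mulr_ge0.
  by rewrite /v /w; move: (C / _) (u n) => p q; lra.
have h : C * n.+1%:R^-1 @[n --> \oo] --> C * (0 : R).
  by apply: cvgM; [exact: cvg_cst | exact: cvg_harmonic].
rewrite (_ : u = fun n => v n - C * n.+1%:R^-1).
  by apply: is_cvgB => //; exact: cvgP h.
by apply/funext => n; rewrite /v addrK.
Qed.

Lemma cphi_cvg (d b : R) : 0 < d -> cvgn (cphi d b).
Proof.
move=> d0; suff H : cvgn (fun n => cphi d b n.+1).
  by apply/cvg_ex; exists (limn (fun n => cphi d b n.+1)); rewrite -(cvg_shiftS (cphi d b)).
(* The three summands of the constant bound, in this order, the gap between the increment of ln and
   1 / (n + 2), the shift by [d], and the nonlinearity of [atan]. *)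
apply: (@cvg_telescope_bound _ (`|b| + `|b| * d + b ^+ 2)) => n.
have n1 : 0 < n.+1%:R :> R by [].
have n2 : 0 < n.+2%:R :> R by [].
have e2 : n.+2%:R = n.+1%:R + 1 :> R by rewrite natr1.
have dn : 0 < d + n.+2%:R by rewrite addr_gt0.
have -> : cphi d b n.+2 - cphi d b n.+1 =
  b * (ln n.+2%:R - ln n.+1%:R - n.+2%:R^-1) + b * (n.+2%:R^-1 - (d + n.+2%:R)^-1) +
   (b / (d + n.+2%:R) - atan (b / (d + n.+2%:R))).
  by rewrite /cphi [X in _ - X - _]big_nat_recr//=; ring.
have g : n.+1%:R^-1 - n.+2%:R^-1 = (n.+1%:R * n.+2%:R)^-1 :> R.
  rewrite e2; move: (n.+1%:R : R) n1 => m m0.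
  by field; rewrite !gt_eqF// addr_gt0.
rewrite !mulrDl; apply: le_trans (ler_normD _ _) _; apply: lerD; last first.
  apply: le_trans (atan_sub _) _; rewrite expr_div_n g ler_wpM2l ?sqr_ge0//.
  rewrite lef_pV2 ?posrE ?mulr_gt0 ?exprn_gt0// expr2 ler_pM ?(ltW n1) ?(ltW n2)//.
    by rewrite e2; lra.
  by rewrite lerDr ltW.
apply: le_trans (ler_normD _ _) _; apply: lerD.
  rewrite normrM ler_wpM2l// ger0_norm ?subr_ge0 ?ln_incr_ge//.
  by rewrite lerD2r ln_incr_le.
rewrite normrM -mulrA ler_wpM2l// ger0_norm; last first.
  by rewrite subr_ge0 lef_pV2 ?posrE// lerDr ltW.
have -> : n.+2%:R^-1 - (d + n.+2%:R)^-1 = d * (n.+2%:R * (d + n.+2%:R))^-1.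
  by move: (n.+2%:R : R) n2 dn => m m0 dm; field; rewrite !gt_eqF.
rewrite g ler_wpM2l ?(ltW d0)// lef_pV2 ?posrE ?mulr_gt0//.
by rewrite mulrC ler_wpM2l ?(ltW n2)//; rewrite e2; lra.
Qed.

Definition shiftprod (b : R) (x n : nat) : R :=
  \prod_(0 <= j < n.+1) ((2^-1 + x%:R + j%:R) ^+ 2 + b ^+ 2).

Definition ratprod (b : R) (x : nat) : R :=
  \prod_(0 <= j < x) ((2^-1 + j%:R) ^+ 2 + b ^+ 2).

Let half2 : 0 < 2^-1 :> R. Proof. by rewrite invr_gt0. Qed.

Let term_gt0 (b : R) (t : R) : 0 <= t -> 0 < (2^-1 + t) ^+ 2 + b ^+ 2.
Proof. by move=> t0; rewrite ltr_wpDr ?sqr_ge0// exprn_gt0// ltr_wpDr. Qed.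

Lemma shiftprod_gt0 b x n : 0 < shiftprod b x n.
Proof. by apply: prodr_gt0 => j _; rewrite -addrA term_gt0// addr_ge0. Qed.

(** The functional equation of Gamma at the level of squared Gauss products: raising [x] by one
    drops the factor j = 0 and gains one at n + 1, whose quotient with n^2 tends to 1. *)
Lemma shiftprod_cvg b x :
  n`!%:R ^+ 2 * n%:R * (n%:R ^+ 2) ^+ x / shiftprod b x n @[n --> \oo] -->
  pi / ch b pi * ratprod b x.
Proof.
elim: x => [|x IH].
  rewrite /ratprod big_geq// mulr1; have := @gamma_half_cvg R b.
  apply: cvg_trans; apply: near_eq_cvg; apply: nearW => n.
  rewrite expr0 mulr1; congr (_ / _).
  by apply: eq_bigr => j _; rewrite addr0.
have R1 : n%:R ^+ 2 / ((2^-1 + x%:R + n.+1%:R) ^+ 2 + b ^+ 2) @[n --> \oo] --> (1 : R).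
  have d0 : 0 < 2^-1 + x%:R :> R by rewrite ltr_wpDr.
  have T : b / (2^-1 + x%:R + n.+1%:R) @[n --> \oo] --> (0 : R).
    have H0 : `|b| * n.+1%:R^-1 @[n --> \oo] --> `|b| * (0 : R).
      by apply: cvgM; [exact: cvg_cst | exact: cvg_harmonic].
    rewrite mulr0 in H0; apply: cvg0_le H0; apply: nearW => n.
    rewrite normrM ler_wpM2l// normfV gtr0_norm; last by rewrite ltr_wpDr.
    by rewrite lef_pV2 ?posrE ?ltr_wpDr// lerDr ltW.
  have H := cvg_natratio d0.
  rewrite (_ : (fun n => _) = fun n =>
     (n%:R / (2^-1 + x%:R + n.+1%:R)) * (n%:R / (2^-1 + x%:R + n.+1%:R)) *
     (1 + (b / (2^-1 + x%:R + n.+1%:R)) * (b / (2^-1 + x%:R + n.+1%:R)))^-1); last first.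
    apply/funext => n; have dn : 0 < 2^-1 + x%:R + n.+1%:R :> R by rewrite ltr_wpDr.
    move: (2^-1 + x%:R + n.+1%:R : R) dn => d dn.
    have e1 : d ^+ 2 + b ^+ 2 != 0 by rewrite gt_eqF// ltr_wpDr ?sqr_ge0// exprn_gt0.
    have e2 : d != 0 by rewrite gt_eqF.
    by field; rewrite ?e1 ?e2 // -!expr2 ?e1 ?e2.
  rewrite -[X in _ --> X](_ : 1 * 1 * (1 + 0 * 0)^-1 = 1); last by rewrite mulr0 addr0 invr1 !mulr1.
  apply: cvgM; first exact: cvgM.
  apply: cvgV; first by rewrite mulr0 addr0 oner_eq0.
  by apply: cvgD; [exact: cvg_cst | exact: cvgM].
rewrite /ratprod big_nat_recr//= -/(ratprod b x) mulrA.
have H : n`!%:R ^+ 2 * n%:R * (n%:R ^+ 2) ^+ x / shiftprod b x n *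
   (n%:R ^+ 2 / ((2^-1 + x%:R + n.+1%:R) ^+ 2 + b ^+ 2)) *
   ((2^-1 + x%:R) ^+ 2 + b ^+ 2) @[n --> \oo] -->
   pi / ch b pi * ratprod b x * 1 * ((2^-1 + x%:R) ^+ 2 + b ^+ 2).
  by apply: cvgM; [exact: cvgM | exact: cvg_cst].
rewrite mulr1 in H; apply: cvg_trans H; apply: near_eq_cvg; apply: nearW => n.
have E : shiftprod b x.+1 n * ((2^-1 + x%:R) ^+ 2 + b ^+ 2) =
    shiftprod b x n * ((2^-1 + x%:R + n.+1%:R) ^+ 2 + b ^+ 2).
  have S : shiftprod b x n.+1 = shiftprod b x n * ((2^-1 + x%:R + n.+1%:R) ^+ 2 + b ^+ 2).
    by rewrite /shiftprod big_nat_recr.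
  rewrite -S /shiftprod [in RHS]big_nat_recl// addr0 mulrC; congr (_ * _).
  by apply: eq_bigr => j _; congr (_ ^+ 2 + _); rewrite -!natr1; ring.
have s1 := shiftprod_gt0 b x.+1 n; have s0 := shiftprod_gt0 b x n.
have t1 := @term_gt0 b x%:R (ler0n R x).
have t2 := @term_gt0 b (x%:R + n.+1%:R) (addr_ge0 (ler0n R x) (ler0n R _)).
rewrite addrA in t2.
have -> : shiftprod b x.+1 n = shiftprod b x n *
   ((2^-1 + x%:R + n.+1%:R) ^+ 2 + b ^+ 2) / ((2^-1 + x%:R) ^+ 2 + b ^+ 2).
  by rewrite -E mulfK// gt_eqF.
rewrite [_ ^+ x.+1]exprS.
move: (shiftprod b x n) s0 (_ + b ^+ 2) t1 (_ + b ^+ 2) t2 => P P0 t t0 u u0.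
by field; rewrite !gt_eqF.
Qed.

Lemma crho_sq b x n : (0 < n)%N ->
  crho (2^-1 + x%:R) b n ^+ 2 = n`!%:R ^+ 2 * n%:R * (n%:R ^+ 2) ^+ x / shiftprod b x n.
Proof.
move=> n0; rewrite /crho expr_div_n exprMn; congr (_ / _).
  rewrite -mulrA; congr (_ * _); rewrite -expRM_natl -exprM.
  have -> : 2 * ((2^-1 + x%:R) * ln n%:R) = (1 + 2 * x)%N%:R * ln n%:R :> R.
    by rewrite natrD natrM; field.
  by rewrite expRM_natl lnK ?posrE ?ltr0n// exprD expr1.
rewrite /shiftprod -prodrXl; apply: eq_bigr => j _.
by rewrite /modulus sqr_sqrtr// addr_ge0 ?sqr_ge0.
Qed.

Lemma crho_ge0 (d b : R) n : 0 <= crho d b n.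
Proof.
by rewrite /crho divr_ge0 ?mulr_ge0 ?expR_ge0// prodr_ge0// => j _; exact: sqrtr_ge0.
Qed.

Lemma crho_cvg b x :
  crho (2^-1 + x%:R) b @ \oo --> Num.sqrt (pi / ch b pi * ratprod b x).
Proof.
have H := @shiftprod_cvg b x.
have {}H : Num.sqrt (n`!%:R ^+ 2 * n%:R * (n%:R ^+ 2) ^+ x / shiftprod b x n) @[n --> \oo]
   --> Num.sqrt (pi / ch b pi * ratprod b x).
  by apply: continuous_cvg => //; exact: sqrt_continuous.
apply: cvg_trans H; apply: near_eq_cvg; near=> n.
rewrite -crho_sq; last by near: n; exact: nbhs_infty_gt.
by rewrite sqrtr_sqr ger0_norm ?crho_ge0.
Unshelve. all: by end_near. Qed.

Lemma nu_imaginary (alpha : {posnum R}) : 4^-1 < alpha%:num ->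
  exists2 b : R, nu alpha = 0 +i* b & b ^+ 2 = alpha%:num - 4^-1.
Proof.
move=> a4; rewrite /nu; set c : R := 1 - 4 * alpha%:num.
have c0 : c < 0 by rewrite /c; lra.
have [u [v [Ez re im]]] : exists u v, [/\ sqrtC (c%:C : R[i]) = u +i* v,
   u * u - v * v = c & u * v + v * u = 0].
  have := sqrtCK (c%:C : R[i]); case: (sqrtC _) => u v; rewrite expr2; simpc => -[re im].
  by exists u, v.
rewrite Ez; have uv : u * v = 0 by move: im; rewrite (mulrC v); lra.
have u0 : u = 0.
  apply/eqP; have /eqP := uv; rewrite mulf_eq0 => /orP[//|/eqP v0].
  by move: re c0; rewrite v0 mulr0 subr0 => <-; rewrite -expr2 ltNge sqr_ge0.
exists (2^-1 * v).
  have -> : (2^-1 : R[i]) = (2^-1 : R)%:C by rewrite fmorphV rmorph_nat.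
  by rewrite u0; simpc.
move: re; rewrite u0 mul0r sub0r exprMn expr2 => re.
by rewrite -[v ^+ 2]/(v * v) -[v * v]opprK re /c; field.
Qed.

(** cos(pi nu) = cosh(pi b) cancels the denominator of |Gamma(1/2 + i b)|^2, and (1/2 + j)^2 + b^2 =
    j (j + 1) + alpha. *)
Lemma gamma_factorE (alpha : {posnum R}) x : 4^-1 < alpha%:num ->
  complex.Re (gamma_factor alpha x) =
  pi * \prod_(0 <= j < x) (j%:R * (j%:R + 1) + alpha%:num).
Proof.
move=> a4; have [b nub b2] := nu_imaginary a4.
have c0 : 0 < ch b pi by rewrite (lt_le_trans ltr01)// ch_ge1.
have d0 : 0 < 2^-1 + x%:R :> R by rewrite ltr_wpDr.
have rp : 0 <= ratprod b x by apply: prodr_ge0 => j _; rewrite ltW// term_gt0.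
have half : (2^-1 : R[i]) = (2^-1 : R)%:C by rewrite fmorphV rmorph_nat.
have xC : (x%:R : R[i]) = (x%:R : R)%:C by rewrite rmorph_nat.
rewrite /gamma_factor nub -mulrA.
have -> : 2^-1 - 0 +i* b + x%:R = (2^-1 + x%:R) +i* - b.
  by rewrite half xC; simpc.
have -> : 2^-1 + 0 +i* b + x%:R = (2^-1 + x%:R) +i* b.
  by rewrite half xC; simpc.
rewrite (Gamma_conj_mul d0 (@crho_cvg b x) (@cphi_cvg _ b d0)).
rewrite sqr_sqrtr; last by rewrite mulr_ge0// divr_ge0 ?pi_ge0// (ltW c0).
have -> : cosC (pi%:C * (0 +i* b)) = (ch b pi)%:C.
  rewrite /cosC (_ : 'i * _ = (- (pi * b))%:C); last by simpc.
  rewrite -rmorphN !expC_real -rmorphD half -rmorphM; congr (_%:C).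
  by rewrite /ch opprK (mulrC b) addrC.
rewrite -rmorphM/= mulrA mulrCA divff ?gt_eqF// mulr1; congr (_ * _).
apply: eq_bigr => j _; by rewrite b2; field.
Qed.

Lemma weightE (alpha : {posnum R}) (xi : R) x : 4^-1 < alpha%:num ->
  weight alpha xi x = 2^-1 * \prod_(0 <= j < x)
     ((xi * (j%:R * (j%:R + 1)) + alpha%:num * xi) / (j%:R + 1) ^+ 2).
Proof.
move=> a4; rewrite /weight gamma_factorE//.
have p0 : (pi : R) != 0 by rewrite gt_eqF// pi_gt0.
move: (pi : R) p0 => q p0; elim: x => [|x IH].
  by rewrite !big_geq// fact0 expr0; field.
rewrite [in RHS]big_nat_recr//= [RHS]mulrA -IH big_nat_recr//= factS natrM exprS -[x.+1%:R]natr1.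
have f0 : x`!%:R != 0 :> R by rewrite pnatr_eq0 -lt0n fact_gt0.
have x1 : x%:R + 1 != 0 :> R by rewrite natr1 pnatr_eq0.
move: x1; rewrite /=; move: (x`!%:R) f0 (x%:R : R) (\prod_(0 <= i < x) _) => f f0 y P y1.
by field; rewrite f0 y1 p0.
Qed.

End complex_gamma.

(** * Exhaustion of the strict partitions by finite boxes *)

Lemma sparts_uniq N : uniq (sparts N).
Proof.
elim: N => //= N IH; rewrite cat_uniq IH map_inj_uniq ?IH ?andbT/=; last by move=> ? ? [].
by apply/hasPn => _ /mapP[l _ ->]; apply/negP => /sparts_notin; rewrite mem_head.
Qed.

Lemma strict_sparts l N : is_strict_partition l ->
  (forall x, x \in l -> (x <= N)%N) -> l \in sparts N.
Proof.
elim: N l => [|N IH] l sl lN.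
  case: l sl lN => // x l /andP[_]; rewrite inE negb_or => /andP[x0 _] /(_ x (mem_head _ _)).
  by rewrite leqn0 eq_sym (negbTE x0).
rewrite /= mem_cat; apply/orP.
case: l sl lN => [|x l] sl lN; first by left; exact: sparts_nil.
have /andP[/= pl] := sl; rewrite inE negb_or => /andP[x0 l0].
have xl y : y \in l -> (y < x)%N.
  move: pl; rewrite path_sortedE; last by move=> a b c /= h1 h2; exact: ltn_trans h2 h1.
  by move=> /andP[/allP h _]; exact: h.
have xN := lN x (mem_head _ _).
have [xE|xN'] := eqVneq x N.+1.
  right; rewrite xE; apply/mapP; exists l => //; apply: IH.
    by rewrite /is_strict_partition l0 andbT (path_sorted pl).
  by move=> y /xl; rewrite xE ltnS.
left; apply: IH => // y; rewrite inE => /orP[/eqP ->|/xl h]; first by lia.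
by lia.
Qed.

(** Masses of events and integrals are computed below as limits along this increasing exhaustion. *)
Definition box N : seq strict_partition := pmap insub (sparts N).

Lemma mem_box N l : (l \in box N) = (parts l \in sparts N).
Proof. exact: mem_pmap_sub. Qed.

Lemma box_uniq N : uniq (box N).
Proof. exact/pmap_sub_uniq/sparts_uniq. Qed.

Lemma map_box N : [seq parts l | l <- box N] = sparts N.
Proof.
rewrite /box (pmap_filter (insubK _)); apply/all_filterP/allP => l /sparts_strict ls.
by rewrite insubT.
Qed.

Lemma box_layer N : box N.+1 =
  box N ++ (pmap insub [seq N.+1 :: l | l <- sparts N] : seq strict_partition).
Proof. by rewrite /box -pmap_cat. Qed.

Lemma bigcup_box : \bigcup_N [set` box N] = [set: strict_partition].
Proof.
rewrite -subTset => l _; exists (\max_(x <- parts l) x)%N => //=.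
rewrite mem_box strict_sparts//; first exact: (valP l).
by move=> x xl; exact: leq_bigmax_seq.
Qed.

(** * Measures and integrals as limits of sums over boxes *)

Section discrete_measure_theory.
Context {R : realType} (p : strict_partition -> {nonneg R}).
Local Notation mu := (discrete_measure p).

Lemma measurable_partition (A : set strict_partition) : measurable A.
Proof. by []. Qed.

Lemma discrete_measure_seq (s : seq strict_partition) : uniq s ->
  mu [set` s] = (\sum_(l <- s) (p l)%:num)%:E.
Proof.
move=> us; rewrite /discrete_measure esum_fset; last first.
- by move=> l _; rewrite lee_fin.
- exact: finite_seq.
by rewrite -fsbig_seq// sumEFin.
Qed.

Lemma discrete_measure_cvg (A : set strict_partition) :
  (\sum_(l <- box N | l \in A) (p l)%:num)%:E @[N --> \oo] --> mu A.
Proof.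
have -> : mu A = mu (\bigcup_N (A `&` [set` box N])).
  by rewrite -setI_bigcupr bigcup_box setIT.
have H := @nondecreasing_cvg_mu _ _ _ mu (fun N => A `&` [set` box N])
  (fun _ => measurable_partition _) (measurable_partition _).
have /H {}H : nondecreasing_seq (fun N => A `&` [set` box N]).
  apply/nondecreasing_seqP => N; apply/subsetPset => l [Al lN]; split => //=.
  by rewrite box_layer mem_cat [_ \in _]lN.
apply: cvg_trans H; apply: near_eq_cvg; apply: nearW => N /=.
rewrite -big_filter.
have -> : A `&` [set` box N] = [set` [seq l <- box N | l \in A]].
  apply/seteqP; split => l /=; rewrite mem_filter.
    by move=> [Al ->]; rewrite mem_set.
  by move=> /andP[/set_mem Al ->].
by rewrite discrete_measure_seq// filter_uniq// box_uniq.
Qed.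

Lemma discrete_measure_lim (A : set strict_partition) (r : R) :
  \sum_(l <- box N | l \in A) (p l)%:num @[N --> \oo] --> r -> mu A = r%:E.
Proof.
move=> H; have h := @discrete_measure_cvg A.
have {}H : (\sum_(l <- box N | l \in A) (p l)%:num)%:E @[N --> \oo] --> r%:E.
  by apply: cvg_EFin; [exact: nearW | exact: H].
by rewrite -(cvg_lim (@ereal_hausdorff R) h); apply/(cvg_lim (@ereal_hausdorff R)).
Qed.

Lemma discrete_measure_fin (B : R) :
  (forall N, \sum_(l <- box N) (p l)%:num <= B) -> (mu setT < +oo)%E.
Proof.
move=> h; apply: (@le_lt_trans _ _ B%:E); last exact: ltry.
have h' := @discrete_measure_cvg setT.
rewrite -(cvg_lim (@ereal_hausdorff R) h'); apply: lime_le; first exact: cvgP h'.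
by apply: nearW => N; rewrite lee_fin (eq_bigl xpredT)// => l; rewrite in_setT.
Qed.

Lemma Rintegral_discrete_seq (f : strict_partition -> R) (s : seq strict_partition) :
  uniq s -> \int[mu]_(l in [set` s]) f l = \sum_(l <- s) f l * (p l)%:num.
Proof.
move=> us.
have -> : [set` s] = \big[setU/set0]_(l <- s) [set l].
  elim: s {us} => [|l s IH]; first by rewrite big_nil; apply/seteqP; split.
  by rewrite big_cons -IH; apply/seteqP; split => x /=; rewrite inE;
    [move=> /orP[/eqP|]; [left | right] | move=> [->|->]; rewrite ?eqxx ?orbT].
rewrite /Rintegral integral_bigsetU_EFin//; last first.
  by move=> i j _ _ [l [-> ->]].
rewrite (eq_bigr (fun l => (f l * (p l)%:num)%:E)) ?sumEFin// => l _.
rewrite (eq_integral (cst (f l)%:E)); last by move=> x /set_mem ->.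
rewrite integral_cst// EFinM; congr (_ * _)%E.
by rewrite /= /discrete_measure esum_set1// lee_fin.
Qed.

(** The error is an integral over the complement of a box, at most [C] times its mass, which tends
    to 0 because the total mass is finite. *)
Lemma Rintegral_discrete_cvg (f : strict_partition -> R) (C : R) :
  (mu setT < +oo)%E -> (forall l, `|f l| <= C) ->
  \sum_(l <- box N) f l * (p l)%:num @[N --> \oo] --> \int[mu]_(l in setT) f l.
Proof.
move=> mufin fC.
have intb (g : strict_partition -> R) (A : set strict_partition) :
    (forall l, `|g l| <= C) -> mu.-integrable A (EFin \o g).
  move=> gC.
  apply: (@integrableS _ _ _ _ setT) => //.
  apply: measurable_bounded_integrable => //; exists C; split; first exact: num_real.
  by move=> M CM x _; apply: le_trans (gC x) (ltW CM).
have intf A := intb f A fC.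
have fr : mu setT \is a fin_num by rewrite ge0_fin_numE.
have [m mE] : exists m, mu setT = m%:E by exists (fine (mu setT)); rewrite fineK.
have S : (m - \sum_(l <- box N) (p l)%:num) * C @[N --> \oo] --> 0.
  rewrite -[X in _ --> X](mul0r C); apply: cvgM; last exact: cvg_cst.
  rewrite -[X in _ --> X](subrr m); apply: cvgB; first exact: cvg_cst.
  have := @discrete_measure_cvg setT; rewrite mE => /fine_cvg/=.
  apply: cvg_trans; apply: near_eq_cvg; apply: nearW => N /=.
  by apply: eq_bigl => l; rewrite in_setT.
rewrite -[X in _ --> X]subr0.
have T : (\int[mu]_(l in ~` [set` box N]) f l) @[N --> \oo] --> (0 : R).
  apply: cvg0_le S; apply: nearW => N.
  apply: le_trans (le_normr_Rintegral _ _) _ => //.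
  have -> : (m - \sum_(l <- box N) (p l)%:num) * C = \int[mu]_(l in ~` [set` box N]) C.
    rewrite Rintegral_cst//= mulrC; congr (_ * _).
    have mc : (mu setT = mu [set` box N] + mu (~` [set` box N]))%E.
      by rewrite -measureU ?setUv// setICr.
    have muc : mu (~` [set` box N]) \is a fin_num.
      by rewrite ge0_fin_numE//; apply: le_lt_trans mufin; apply: le_measure; rewrite ?inE.
    move: mc; rewrite mE discrete_measure_seq ?box_uniq// -(fineK muc) -EFinD => -[->].
    by rewrite addrC addKr.
  apply: le_Rintegral => //.
  - apply: (eq_integrable _ (fun x => `|(EFin \o f) x|%E)) => //.
    exact: integrable_abse.
  - by apply: intb => l; rewrite ger0_norm// (le_trans _ (fC l)).
have -> : (fun N => \sum_(l <- box N) f l * (p l)%:num) =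
    (fun N => \int[mu]_(l in setT) f l - \int[mu]_(l in ~` [set` box N]) f l).
  apply/funext => N; rewrite -(Rintegral_discrete_seq f (box_uniq N)).
  rewrite -(setUv [set` box N]) Rintegral_setU// ?addrK//.
    by apply/disj_setPS; rewrite setICr.
by apply: cvgB => //; exact: cvg_cst.
Qed.

End discrete_measure_theory.

(** * Limits of finite sums, products and determinants *)

Section cvg_products.
Context {R : realType} {T : Type} (F : set_system T) {FF : Filter F}.

Lemma cvg_bigsum (I : Type) (r : seq I) (P : pred I) (f : I -> T -> R) (g : I -> R) :
  (forall i, P i -> f i t @[t --> F] --> g i) ->
  \sum_(i <- r | P i) f i t @[t --> F] --> \sum_(i <- r | P i) g i.
Proof. by apply: cvg_big; exact: add_continuous. Qed.

Lemma cvg_bigprod (I : Type) (r : seq I) (P : pred I) (f : I -> T -> R) (g : I -> R) :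
  (forall i, P i -> f i t @[t --> F] --> g i) ->
  \prod_(i <- r | P i) f i t @[t --> F] --> \prod_(i <- r | P i) g i.
Proof. by apply: cvg_big; exact: mul_continuous. Qed.

Lemma cvg_det n (A : T -> 'M[R]_n) (B : 'M[R]_n) :
  (forall i j, A t i j @[t --> F] --> B i j) -> \det (A t) @[t --> F] --> \det B.
Proof.
move=> AB; rewrite /determinant; apply: cvg_bigsum => s _.
by apply: cvgM; [exact: cvg_cst | apply: cvg_bigprod => i _].
Qed.

End cvg_products.

(** * The Plancherel measure: total mass, correlations, both forms of the kernel *)

Section plancherel_measure.
Context {R : realType}.

Lemma pairs_ord (s : seq nat) :
  \prod_(k < size s) \prod_(j < size s | (k < j)%N)
    (((nth 0%N s k)%:R - (nth 0%N s j)%:R) /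
     ((nth 0%N s k)%:R + (nth 0%N s j)%:R)) ^+ 2 = pairs s :> R.
Proof.
elim: s => [|x s IH]; first by rewrite big_ord0.
rewrite [size _]/= big_ord_recl [RHS]/= -IH; congr (_ * _).
  rewrite big_mkcond big_ord_recl/= mul1r (big_nth 0%N) big_mkord.
  by apply: eq_bigr.
apply: eq_bigr => k _; rewrite big_mkcond big_ord_recl/= mul1r [RHS]big_mkcond.
by apply: eq_bigr.
Qed.

Lemma pair_factorE l : pair_factor l = pairs (parts l) :> R.
Proof. exact: pairs_ord. Qed.

Lemma parts_sparts l : exists N, parts l \in sparts N.
Proof.
have [N _ H] : (\bigcup_N [set` box N]) l by rewrite bigcup_box.
by exists N; rewrite -mem_box.
Qed.

Lemma Pl_massE (theta : {posnum R}) l :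
  Pl_mass theta l = expR (- (theta%:num / 2)) * cweight (aw theta%:num) (parts l).
Proof.
have [N lN] := parts_sparts l.
rewrite (cweight_pweight _ lN)// /Pl_mass pair_factorE.
have sz : (size (parts l) <= sumn (parts l))%N.
  have : {in parts l, forall x, (0 < x)%N} by move=> x /(sparts_le lN)/andP[].
  elim: (parts l) => //= x s IH xs; have := xs x (mem_head _ _).
  have : (size s <= sumn s)%N by apply: IH => y ys; apply: xs; rewrite inE ys orbT.
  by lia.
have -> : pweight (parts l) =
   (2 ^+ size (parts l) * (\prod_(x <- parts l) x`!%:R) ^+ 2)^-1 * pairs (parts l) :> R.
  rewrite /pweight; congr (_ * _); elim: (parts l) => [|x s IH].
    by rewrite !big_nil expr0 expr1n mulr1 invr1.
  rewrite !big_cons IH /= [2 ^+ (size s).+1]exprS -invfM; congr (_^-1).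
  by rewrite /factR; ring.
have -> : (theta%:num / 2) ^+ sumn (parts l) = theta%:num ^+ sumn (parts l) /
    (2 ^+ (sumn (parts l) - size (parts l)) * 2 ^+ size (parts l)).
  by rewrite -exprD subnK// expr_div_n.
have f0 : (sumn (parts l))`!%:R != 0 :> R by rewrite pnatr_eq0 -lt0n fact_gt0.
have p0 : \prod_(x <- parts l) x`!%:R != 0 :> R.
  by rewrite gt_eqF// prodr_gt0// => x _; rewrite ltr0n fact_gt0.
have t1 : 2 ^+ size (parts l) != 0 :> R by rewrite expf_neq0.
have t2 : 2 ^+ (sumn (parts l) - size (parts l)) != 0 :> R by rewrite expf_neq0.
move: (sumn _)`!%:R f0 (\prod_(x <- _) _) p0 (2 ^+ size _) t1 (2 ^+ (_ - _)) t2.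
move=> f f0 P p0 a a0 b b0; move: (expR _) (_ ^+ _) (pairs _) => e t q.
by field; rewrite f0 p0 a0 b0.
Qed.

Context (theta : {posnum R}).
Local Notation th := (theta%:num).
Let th0 : 0 < th := [gt0 of th].

Lemma sum_Pl_mass N (P : pred (seq nat)) :
  \sum_(l <- box N | P (parts l)) Pl_mass theta l =
  expR (- (th / 2)) * \sum_(l <- sparts N | P l) cweight (aw th) l.
Proof.
rewrite mulr_sumr -map_box big_map; apply: eq_bigr => l _; exact: Pl_massE.
Qed.

Lemma Ztot_normal : expR (- (th / 2)) * Ztot th N @[N --> \oo] --> (1 : R).
Proof.
rewrite [X in _ --> X](_ : 1 = expR (- (th / 2)) * expR (th / 2)); last by rewrite -expRD addNr expR0.
by apply: cvgM; [exact: cvg_cst | exact: Ztot_cvg_exp].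
Qed.

Lemma Pl_total : Pl theta setT = 1%E.
Proof.
apply: discrete_measure_lim; apply: cvg_trans Ztot_normal; apply: near_eq_cvg.
apply: nearW => N; rewrite /Ztot -(sum_Pl_mass N xpredT).
by apply: eq_bigl => l; rewrite in_setT.
Qed.

(** Inside a box the event has mass exp(- theta / 2) times the partition function times a minor of
    the truncated kernel, by [det_correlation]; the first two factors have product tending to 1. *)
Lemma Pl_determinantal : determinantal (Pl theta) (Kpl th).
Proof.
move=> n x xinj x0; apply: discrete_measure_lim; rewrite -cvg_shiftS.
suff : \sum_(l <- box N.+1 | l \in [set l | forall i, x i \in parts l])
    Pl_mass theta l @[N --> \oo] --> \det (\matrix_(k < n, j < n) Kpl th (x k) (x j)) by [].
(* For a part beyond the box the subtraction truncates to 0, so injectivity of [f N] is claimed only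
   for large [N]. *)
pose f N (k : 'I_n) : 'I_N.+1 := inord (N.+1 - x k).
have fE N k : (x k <= N)%N -> (N.+1 - f N k = x k)%N.
  by move=> xN; rewrite inordK; have := x0 k; lia.
pose m := (\max_(k < n) x k)%N.
have xm k : (x k <= m)%N by exact: leq_bigmax.
have D : \det (mxsub (f N) (f N) (KN N.+1 (aw th))) @[N --> \oo] -->
    \det (\matrix_(k < n, j < n) Kpl th (x k) (x j)).
  apply: cvg_det => i j; rewrite mxE.
  have := @KN_cvg R th th0 (x i) (x j) (f^~ i) (f^~ j) (x0 i) (x0 j) (fE^~ i) (fE^~ j).
  rewrite (_ : (fun N => mxsub (f N) (f N) (KN N.+1 (aw th)) i j) =
    (fun N => KN N.+1 (aw th) (f N i) (f N j)))//.
  by apply/funext => N; rewrite mxE.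
have Z : expR (- (th / 2)) * Ztot th N.+1 @[N --> \oo] --> (1 : R).
  by have := Ztot_normal; rewrite -cvg_shiftS.
have H : expR (- (th / 2)) * Ztot th N.+1 * \det (mxsub (f N) (f N) (KN N.+1 (aw th)))
    @[N --> \oo] --> \det (\matrix_(k < n, j < n) Kpl th (x k) (x j)).
  by rewrite -[X in _ --> X]mul1r; exact: cvgM.
apply: cvg_trans H; apply: near_eq_cvg; near=> N.
have mN : (m <= N)%N by near: N; exact: nbhs_infty_ge.
have finj : injective (f N).
  move=> i j /(congr1 (fun k : 'I_N.+1 => N.+1 - k)%N).
  by rewrite !fE ?(leq_trans (xm _))// => /xinj.
have a0 y : (0 < y <= N.+1)%N -> aw th y != 0 by move=> /andP[y0 _]; exact: aw_neq0.
rewrite /= -mulrA -(det_correlation finj a0).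
rewrite -(sum_Pl_mass N.+1 (fun l => [forall k, (N.+1 - f N k)%N \in l])).
apply: eq_bigl => l; apply/forallP/idP => [h|/set_mem h k].
  by apply/mem_set => k; have := h k; rewrite fE ?(leq_trans (xm _)).
by rewrite fE ?(leq_trans (xm _)).
Unshelve. all: by end_near. Qed.

Lemma Kpl_bessel (x y : nat) : (0 < x)%N -> (0 < y)%N ->
  (fun N : nat => 2 * Num.sqrt (x%:R * y%:R) / (x%:R + y%:R) *
    \sum_(0 <= m < N) (2^-1) ^+ (m == 0%N) *
      besselJ th (m + x)%:R * besselJ th (m + y)%:R) @ \oo --> Kpl th x y.
Proof.
move=> x0 y0; have := @Kpl_series R th th0 x y x0 y0.
apply: cvg_trans; apply: near_eq_cvg; apply: nearW => N.
by congr (_ * _); apply: eq_bigr => m _; rewrite !besselJ_nat.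
Qed.

Lemma Kpl_bsum (x y : nat) : (0 < x)%N -> (0 < y)%N ->
  Kpl th x y = 2 * Num.sqrt (x%:R * y%:R) / (x%:R + y%:R) *
    limn (series (bsum (besselJ th) x%:R y%:R)).
Proof.
move=> x0 y0; apply/esym.
apply: (@cvg_unique R _ ((fun N : nat => 2 * Num.sqrt (x%:R * y%:R) / (x%:R + y%:R) *
    \sum_(0 <= m < N) (2^-1) ^+ (m == 0%N) *
      besselJ th (m + x)%:R * besselJ th (m + y)%:R) @ \oo)).
- exact: Rhausdorff.
- apply: cvgM; first exact: cvg_cst.
  have C := @is_cvg_bsum R th th0 x%:R y%:R (ler0n R x) (ler0n R y).
  apply: cvg_trans C; apply: near_eq_cvg; apply: nearW => N.
  by rewrite /series/=; apply: eq_bigr => m _; rewrite /bsum !natrD.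
- exact: Kpl_bessel.
Qed.

Lemma integrable_kernelE (x y : R) : 2^-1 <= x -> 2^-1 <= y -> x != y ->
  integrable_kernel theta x y = 2 * Num.sqrt (x * y) / (x + y) *
    limn (series (bsum (besselJ th) x y)).
Proof.
move=> x2 y2 xy.
have x0 : 0 <= x by lra.
have y0 : 0 <= y by lra.
have -> : integrable_kernel theta x y = 2 * Num.sqrt (x * y) / (x ^+ 2 - y ^+ 2) *
    Abes (Num.sqrt th) (besselJ th) x y by [].
rewrite (Abes_lim (@besselJ_rec R th th0) (@besselJ_vanish R th th0) x2 y2)//; last first.
  exact: is_cvg_bsum.
move: (limn _) (Num.sqrt _) => L q.
have d0 : x - y != 0 by rewrite subr_eq0.
have s0 : x + y != 0 by rewrite gt_eqF//; lra.
by rewrite subr_sqr; field; rewrite d0 s0.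
Qed.

Lemma Kpl_integrable (x y : nat) : (0 < x)%N -> (0 < y)%N -> x <> y ->
  Kpl th x y = integrable_kernel theta x%:R y%:R.
Proof.
move=> x0 y0 /eqP xy; have h (z : nat) : (0 < z)%N -> 2^-1 <= z%:R :> R.
  by move=> z0; apply: (@le_trans _ _ 1); [lra | rewrite ler1n].
by rewrite integrable_kernelE ?h ?eqr_nat// Kpl_bsum.
Qed.

(** Off the diagonal the integrable form agrees with the Bessel series at all real orders from 1/2
    on, and that series is continuous across y = x. *)
Lemma integrable_kernel_diag (x : nat) : (0 < x)%N ->
  integrable_kernel theta x%:R y @[y --> (x%:R : R)^'] --> Kpl th x x.
Proof.
move=> x0; have x1 : 1 <= x%:R :> R by rewrite ler1n.
rewrite Kpl_bsum//.
have H : 2 * Num.sqrt (x%:R * y) / (x%:R + y) * limn (series (bsum (besselJ th) x%:R y))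
    @[y --> (x%:R : R)] --> 2 * Num.sqrt (x%:R * x%:R) / (x%:R + x%:R) *
      limn (series (bsum (besselJ th) x%:R x%:R)).
  apply: cvgM; last by apply: bsum_continuous => //; lra.
  apply: cvgM; last first.
    by apply: cvgV; [rewrite gt_eqF//; lra | apply: cvgD; [exact: cvg_cst | exact: cvg_id]].
  apply: cvgM; first exact: cvg_cst.
  by apply: continuous_cvg; [exact: sqrt_continuous | apply: cvgM; [exact: cvg_cst | exact: cvg_id]].
apply: cvg_trans (cvg_trans (cvg_app _ (@nbhs_dnbhs _ (x%:R : R))) H).
apply: near_eq_cvg; near=> y.
rewrite integrable_kernelE//.
- lra.
- by near: y; apply: nbhs_dnbhs; apply: (@cvgr_ge _ _ (nbhs (x%:R : R)) _ id x%:R) => //; lra.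
- by rewrite eq_sym; near: y; exact: nbhs_dnbhs_neq.
Unshelve. all: by end_near. Qed.

End plancherel_measure.

(** * A summable bound for the weights, uniform in the parameters *)

Section domination.
Context {R : realType}.

(** From [J] on the products no longer increase, so the sum of the first [J.+1] of them bounds them
    all. *)
Lemma bounded_prod (u : nat -> R) J : (forall j, 0 <= u j) ->
  (forall j, (J <= j)%N -> u j <= 1) ->
  exists2 C, 0 <= C & forall x, \prod_(0 <= j < x) u j <= C.
Proof.
move=> u0 u1; have P0 x : 0 <= \prod_(0 <= j < x) u j by apply: prodr_ge0.
exists (\sum_(0 <= x < J.+1) \prod_(0 <= j < x) u j); first by apply: sumr_ge0.
elim=> [|x IH].
  by rewrite [leRHS]big_nat_recl//= lerDl sumr_ge0.
have [xJ|Jx] := leqP x.+1 J.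
  rewrite [leRHS](big_cat_nat (n := x.+1)) ?(leqW xJ)//=.
  rewrite [X in _ <= _ + X]big_ltn//.
  by rewrite addrCA lerDl addr_ge0 ?sumr_ge0.
by rewrite big_nat_recr//= (le_trans _ IH)// ler_piMr ?u1.
Qed.

(* [xi] bounds [xi j (j + 1) / (j + 1)^2]; the rest of the j-th factor of the
   weight is at most [1 / 4] for large j, which leaves a geometric bound. *)
Lemma weight_dominated (c : R) : 0 <= c -> exists v : nat -> R,
  [/\ forall x, 0 <= v x, cvgn (series v) &
      forall (alpha : {posnum R}) (xi : R), 0 <= xi <= 4^-1 -> 4^-1 < alpha%:num ->
        alpha%:num * xi <= c -> forall x, weight alpha xi x <= v x].
Proof.
move=> c0; pose g j : R := 4^-1 + c / (j%:R + 1) ^+ 2.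
have j1 j : 1 <= j%:R + 1 :> R by rewrite lerDr.
have s0 j : 0 < (j%:R + 1) ^+ 2 :> R by rewrite exprn_gt0// (lt_le_trans ltr01).
have g0 j : 0 <= g j by rewrite addr_ge0// divr_ge0// (ltW (s0 j)).
(* From j >= 4 c on, c / (j + 1)^2 <= 1/4 and so 2 [g j] <= 1. The factor 2 lent to each [g j] is
   returned as the geometric ratio 1/2. *)
have [J cJ] : exists J : nat, 4 * c <= J%:R.
  by exists (Num.truncn (4 * c)).+1; rewrite ltW// truncnS_gt.
have [C C0 HC] : exists2 C, 0 <= C & forall x, \prod_(0 <= j < x) (2 * g j) <= C.
  apply: (@bounded_prod _ J) => [j|j Jj]; first by rewrite mulr_ge0.
  suff : c / (j%:R + 1) ^+ 2 <= 4^-1 by rewrite /g; lra.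
  rewrite ler_pdivrMr//; have : J%:R <= j%:R :> R by rewrite ler_nat.
  have := ler0n R j; nra.
exists (geometric (2^-1 * C) 2^-1); split.
- by move=> x; rewrite /geometric/= mulr_ge0 ?exprn_ge0// mulr_ge0.
- by apply: is_cvg_geometric_series; rewrite ger0_norm; lra.
move=> alpha xi /andP[xi0 xi4] a4 axi x; rewrite weightE// /geometric/= -mulrA.
apply: ler_wpM2l; first by lra.
apply: (@le_trans _ _ (\prod_(0 <= j < x) g j)).
  apply: ler_prod => j _; apply/andP; split.
    apply: divr_ge0; last exact: ltW.
    by rewrite addr_ge0 ?mulr_ge0//; have := j1 j; lra.
  rewrite ler_pdivrMr// /g mulrDl divfK ?gt_eqF// lerD//.
  have := j1 j; have := ler0n R j; move: (j%:R : R) => y y0 y1; nra.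
rewrite -ler_pdivrMr ?exprn_gt0// -exprVn invrK mulrC.
rewrite (le_trans _ (HC x))// le_eqVlt; apply/orP; left; apply/eqP.
by rewrite big_split/= prodr_const_nat subn0.
Qed.

End domination.

(** * Weak convergence to the Plancherel measure *)

Section weak_convergence.
Context {R : realType} (theta : {posnum R}) (T : Type) (F : set_system T)
  {FF : ProperFilter F} (alpha : T -> {posnum R}) (xi : T -> {itv R & `]0, 1[}).
Local Notation th := (theta%:num).
Local Notation a := (fun t => (alpha t)%:num).
Local Notation x := (fun t => (xi t)%:num).
Context (alphaoo : a @ F --> +oo) (xi0 : x @ F --> (0 : R))
  (alphaxi : (alpha t)%:num * (xi t)%:num @[t --> F] --> th).

Let xi_gt0 t : 0 < (xi t)%:num. Proof. by []. Qed.
Let xi_lt1 t : (xi t)%:num < 1. Proof. by []. Qed.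

Lemma alpha_large : \forall t \near F, 4^-1 < (alpha t)%:num.
Proof. exact: (cvgry_gt alphaoo). Qed.

Lemma weight_cvg k : (0 < k)%N ->
  weight (alpha t) (xi t)%:num k @[t --> F] --> aw th k ^+ 2 / (2 * k%:R).
Proof.
move=> k0.
have H : 2^-1 * \prod_(0 <= j < k) (((xi t)%:num * (j%:R * (j%:R + 1)) +
     (alpha t)%:num * (xi t)%:num) / (j%:R + 1) ^+ 2) @[t --> F] -->
   2^-1 * \prod_(0 <= j < k) ((0 * (j%:R * (j%:R + 1)) + th) / (j%:R + 1) ^+ 2).
  apply: cvgM; first exact: cvg_cst.
  apply: cvg_bigprod => j _; apply: cvgM; last exact: cvg_cst.
  by apply: cvgD => //; apply: cvgM => //; exact: cvg_cst.
have -> : aw th k ^+ 2 / (2 * k%:R) =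
   2^-1 * \prod_(0 <= j < k) ((0 * (j%:R * (j%:R + 1)) + th) / (j%:R + 1) ^+ 2).
  have k1 : k%:R != 0 :> R by rewrite pnatr_eq0 -lt0n.
  have -> : \prod_(0 <= j < k) ((0 * (j%:R * (j%:R + 1)) + th) / (j%:R + 1) ^+ 2) =
     th ^+ k / factR k ^+ 2.
    elim: (k) => [|m IH]; first by rewrite big_geq// expr0 /factR fact0 expr1n divr1.
    rewrite big_nat_recr//= IH mul0r add0r factRS [th ^+ m.+1]exprS -[m.+1%:R]natr1.
    have m1 : m%:R + 1 != 0 :> R by rewrite natr1 pnatr_eq0.
    have := @factR_neq0 R m; move: (factR m) (m%:R : R) m1 => f y y1 f0.
    by field; rewrite f0 y1.
  rewrite aw_sq//; have := @factR_neq0 R k; move: (factR k) (k%:R : R) k1 => f y y1 f0.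
  by field; rewrite f0 y1.
apply: cvg_trans H; apply: near_eq_cvg; near=> t.
by rewrite weightE//; near: t; exact: alpha_large.
Unshelve. all: by end_near. Qed.

(** Squeezes ln(1 - xi) between - xi / (1 - xi) and - xi; multiplied by alpha, both bounds tend to -
    theta since xi tends to 0. *)
Lemma normalization_cvg :
  (1 - (xi t)%:num) `^ ((alpha t)%:num / 2) @[t --> F] --> expR (- (th / 2)).
Proof.
have L : (alpha t)%:num * ln (1 - (xi t)%:num) @[t --> F] --> - th.
  have x1 : 1 - (xi t)%:num @[t --> F] --> (1 : R).
    by rewrite -[X in _ --> X]subr0; apply: cvgB => //; exact: cvg_cst.
  have H2 : - ((alpha t)%:num * (xi t)%:num) @[t --> F] --> - th by exact: cvgN.
  have H1 : - ((alpha t)%:num * (xi t)%:num) / (1 - (xi t)%:num) @[t --> F] --> - th.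
    by rewrite -[X in _ --> X]divr1; apply: cvgM => //; apply: cvgV => //; exact: oner_neq0.
  apply: (squeeze_cvgr _ H1 H2); apply: nearW => t.
  have p0 : 0 < (alpha t)%:num by [].
  have := xi_gt0 t; have := xi_lt1 t; move: (xi t)%:num => y y1 y0.
  have d0 : 0 < 1 - y by lra.
  have u : ln (1 - y) <= - y by apply: le_ln1Dx; lra.
  have l : - (y / (1 - y)) <= ln (1 - y).
    have h : ln (1 + y / (1 - y)) <= y / (1 - y).
      by apply: le_ln1Dx; apply: (@lt_le_trans _ _ 0); rewrite ?ltrN10// divr_ge0 ?ltW.
    rewrite lerNl; apply: le_trans h.
    rewrite (_ : 1 + y / (1 - y) = (1 - y)^-1) ?lnV//.
    by field; rewrite gt_eqF.
  have -> : - ((alpha t)%:num * y) / (1 - y) = (alpha t)%:num * - (y / (1 - y)).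
    by rewrite mulrN mulNr mulrA.
  by rewrite -[- (_ * y)]mulrN !ler_pM2l// u l.
have P t : (1 - (xi t)%:num) `^ ((alpha t)%:num / 2) =
    expR (2^-1 * ((alpha t)%:num * ln (1 - (xi t)%:num))).
  rewrite /powR gt_eqF; last by rewrite subr_gt0.
  by congr expR; ring.
under eq_fun do rewrite P.
rewrite (_ : - (th / 2) = 2^-1 * - th); last by field.
apply: continuous_cvg; first exact: continuous_expR.
by apply: cvgM => //; exact: cvg_cst.
Qed.

Lemma M_mass_cvg l : M_mass (alpha t) (xi t) l @[t --> F] --> Pl_mass theta l.
Proof.
rewrite Pl_massE /M_mass /cweight pair_factorE mulrA.
apply: cvgM; last exact: cvg_cst.
apply: cvgM; first exact: normalization_cvg.
have [N lN] := parts_sparts l.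
rewrite big_seq; under eq_fun do rewrite big_seq.
by apply: cvg_bigprod => k /(sparts_le lN)/andP[k0 _]; exact: weight_cvg.
Qed.

Lemma powR_le_one (y b : R) : 0 < y <= 1 -> 0 <= b -> y `^ b <= 1.
Proof.
move=> /andP[y0 y1] b0; rewrite /powR gt_eqF// -expR0 ler_expR mulr_ge0_le0//.
exact: ln_le0.
Qed.

Lemma M_mass_dominated : exists v : nat -> R,
  [/\ forall k, 0 <= v k, cvgn (series v) &
      \forall t \near F, forall l, M_mass (alpha t) (xi t) l <= \prod_(k <- parts l) v k].
Proof.
have [v [v0 cv dom]] := @weight_dominated R (th + 1) (addr_ge0 (ltW [gt0 of th]) ler01).
exists v; split=> //; near=> t => l; rewrite /M_mass.
have w0 : 0 <= \prod_(k <- parts l) weight (alpha t) (xi t)%:num k.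
  by apply: prodr_ge0 => k _; apply: weight_ge0; exact: ltW.
have p1 : pair_factor l <= 1 :> R by rewrite pair_factorE pairs_le1.
have c1 : (1 - (xi t)%:num) `^ ((alpha t)%:num / 2) <= 1.
  apply: powR_le_one; last by rewrite divr_ge0.
  by have := xi_gt0 t; have := xi_lt1 t; lra.
apply: (@le_trans _ _ (\prod_(k <- parts l) weight (alpha t) (xi t)%:num k)).
  apply: (le_trans (ler_piMr _ p1)); first by rewrite mulr_ge0 ?powR_ge0.
  exact: ler_piMl.
apply: ler_prod => k _; rewrite weight_ge0 ?(ltW (xi_gt0 t))//=.
apply: dom.
- rewrite (ltW (xi_gt0 t))/=; near: t.
  by apply: (cvgr_le _ xi0); rewrite invr_gt0.
- by near: t; exact: alpha_large.
- by near: t; apply: (cvgr_le _ alphaxi); rewrite ltrDl.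
Unshelve. all: by end_near. Qed.

(** Sums over partitions are turned into series over the layers between successive boxes, to which
    [tannery] applies; a layer is dominated by [C] times an increment of the bounded sequence
    [subsum v]. The same domination makes the mass of [M] finite eventually along [F], so that its
    integrals are limits of box sums. *)
Lemma M_weak_cvg : weak_cvg F (fun t => M (alpha t) (xi t)) (Pl theta).
Proof.
move=> f [C fC].
have C0 : 0 <= C by apply: le_trans (fC empty_partition).
have [v [v0 cv dom]] := M_mass_dominated.
have B N : subsum v N <= expR (limn (series v)) by exact: subsum_le.
have subsumB N : \sum_(l <- box N) \prod_(k <- parts l) v k = subsum v N.
  by rewrite /subsum -map_box big_map.
pose S t N := \sum_(l <- box N) f l * M_mass (alpha t) (xi t) l.
pose S0 N := \sum_(l <- box N) f l * Pl_mass theta l.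
have ScvgN N : S t N @[t --> F] --> S0 N.
  apply: cvg_bigsum => l _; apply: cvgM; first exact: cvg_cst.
  exact: M_mass_cvg.
have It : \forall t \near F,
    S t @ \oo --> \int[M (alpha t) (xi t)]_(l in setT) f l.
  apply: filterS dom => t dom; apply: (Rintegral_discrete_cvg _ fC).
  apply: (@discrete_measure_fin _ _ (expR (limn (series v)))) => N.
  by apply: le_trans (B N); rewrite -subsumB; apply: ler_sum => l _; exact: dom.
have I0 : S0 @ \oo --> \int[Pl theta]_(l in setT) f l.
  by apply: (Rintegral_discrete_cvg _ fC); rewrite [discrete_measure _ _]Pl_total ltry.
have seriesS (s : nat -> R) N : series (fun n => s n.+1 - s n) N = s N - s 0%N.
  by rewrite /series/= telescope_sumr.
have lim_layer (s : nat -> R) (r : R) : s @ \oo --> r ->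
    limn (series (fun n => s n.+1 - s n)) = r - s 0%N.
  move=> sr; apply: cvgn_limn.
  rewrite (_ : series _ = (fun N => s N - s 0%N)); last exact/funext/seriesS.
  by apply: cvgB => //; exact: cvg_cst.
have H := @tannery R T F FF (fun t N => S t N.+1 - S t N) (fun N => S0 N.+1 - S0 N)
  (fun N => C * (subsum v N.+1 - subsum v N)).
have {}H : limn (series (fun N => S t N.+1 - S t N)) @[t --> F] -->
    limn (series (fun N => S0 N.+1 - S0 N)).
  apply: H.
  - have E : series (fun N => C * (subsum v N.+1 - subsum v N)) =
        (fun N => C * (subsum v N - subsum v 0)).
      by apply/funext => N; rewrite /series/= -mulr_sumr telescope_sumr.
    rewrite E; apply: is_cvgM; first exact: is_cvg_cst.
    apply: is_cvgB; last exact: is_cvg_cst.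
    apply: nondecreasing_is_cvgn; last by exists (expR (limn (series v))) => _ [N _ <-].
    apply/nondecreasing_seqP => N; rewrite /subsum/= big_cat/= lerDl.
    by apply: sumr_ge0 => l _; apply: prodr_ge0.
  - apply: filterS dom => t dom N.
    rewrite /S box_layer big_cat/= [X in `|X - _|]addrC addrK.
    apply: le_trans (ler_norm_sum _ _ _) _.
    rewrite -!subsumB box_layer [in X in _ <= X]big_cat/= [X in _ * (X - _)]addrC addrK.
    rewrite mulr_sumr; apply: ler_sum => l _; rewrite normrM.
    by rewrite ler_pM// ger0_norm ?M_mass_ge0.
  - by move=> N; apply: cvgB.
rewrite (lim_layer S0 _ I0) in H.
(* [S t 0], the term of the empty partition, lies in no layer and is added back. *)
have {}H : limn (series (fun N => S t N.+1 - S t N)) + S t 0%N @[t --> F] -->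
    \int[Pl theta]_(l in setT) f l.
  by rewrite -[X in _ --> X](subrK (S0 0%N)); exact: cvgD.
apply: cvg_trans H; apply: near_eq_cvg; apply: filterS It => t It.
by rewrite (lim_layer (S t) _ It) subrK.
Qed.

End weak_convergence.

Theorem theorem8p2 (R : realType) (theta : {posnum R}) :
  [/\ (forall (T : Type) (F : set_system T) (FF : ProperFilter F)
          (alpha : T -> {posnum R}) (xi : T -> {itv R & `]0, 1[}),
        (alpha t)%:num @[t --> F] --> +oo ->
        (xi t)%:num @[t --> F] --> (0 : R) ->
        (alpha t)%:num * (xi t)%:num @[t --> F] --> theta%:num ->
        weak_cvg F (fun t => M (alpha t) (xi t)) (Pl theta)),
      Pl theta setT = 1%E &
      exists K : nat -> nat -> R,
        [/\ determinantal (Pl theta) K,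
            (forall x y : nat, (0 < x)%N -> (0 < y)%N ->
              (fun N : nat => 2 * Num.sqrt (x%:R * y%:R) / (x%:R + y%:R) *
                \sum_(0 <= m < N) (2^-1) ^+ (m == 0%N) *
                  besselJ theta%:num (m + x)%:R * besselJ theta%:num (m + y)%:R)
                @ \oo --> K x y),
            (forall x y : nat, (0 < x)%N -> (0 < y)%N -> x <> y ->
              K x y = integrable_kernel theta x%:R y%:R) &
            (forall x : nat, (0 < x)%N ->
              integrable_kernel theta x%:R y @[y --> (x%:R : R)^'] --> K x x)]].
Proof.
split; [|exact: Pl_total|].
  by move=> T F FF alpha xi aoo xi0 axi; exact: M_weak_cvg.
exists (Kpl theta%:num); split.
- exact: Pl_determinantal.
- by move=> x y; exact: Kpl_bessel.
- by move=> x y; exact: Kpl_integrable.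
- by move=> x; exact: integrable_kernel_diag.
Qed.
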